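(* Let $K$ be an imaginary quadratic number field with ring of integers $\mathcal{O}_K$. Then there exists $N$ such that for every $n\geq N$ there is no $n$-optimal subset of $\mathcal{O}_K$.
   Context: For a domain $A$ with field of fractions $K$, a finite subset $S\subset A$ is called $n$-universal if for every polynomial $P\in K[X]$ of degree at most $n$ one has $P(A)\subset A$ if and only if $P(S)\subset A$. An $n$-optimal set is an $n$-universal set with exactly $n+1$ elements. *)

(* Defs.v *)
From HB Require Import structures.
From mathcomp Require Import all_boot all_order all_algebra all_field.
From mathcomp Require Import finmap classical_sets.

Set Implicit Arguments.
Unset Strict Implicit.
Unset Printing Implicit Defensive.

Import GRing.Theory Num.Theory.

Local Open Scope classical_set_scope.
Local Open Scope ring_scope.

(* A number field is a finite extension of Q, i.e. a [fieldExtType rat].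
   Its complex embeddings all land in the algebraic numbers [algC]. *)
Definition imaginary_quadratic (K : fieldExtType rat) : Prop :=
  \dim {:K} = 2%N /\
  forall iota : {rmorphism K -> algC}, exists x : K, iota x \isn't Num.real.

Definition ring_of_integers (K : fieldExtType rat) : set K :=
  [set x | integralOver (intr : int -> K) x].
Arguments ring_of_integers K : clear implicits.

(* The domain is given as a subset [A] of its field of fractions [K].
   [size P <= n.+1] says that P has degree at most n (or is zero). *)
Definition n_universal (K : fieldType) (A : set K) (n : nat) (S : {fset K}) :
    Prop :=
  [set` S] `<=` A /\
  forall P : {poly K}, (size P <= n.+1)%N ->
    (horner P @` A `<=` A <-> horner P @` [set` S] `<=` A).

Definition n_optimal (K : fieldType) (A : set K) (n : nat) (S : {fset K}) :
    Prop :=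
  n_universal A n S /\ #|` S|%fset = n.+1.

(* Main.v *)
Require Import Defs.
From HB Require Import structures.
From mathcomp Require Import all_boot all_order all_algebra all_field.
From mathcomp Require Import finmap classical_sets.
From mathcomp Require Import boolp reals topology normedtype sequences exp Rstruct.
From mathcomp Require Import zify ring lra.

(** Write O for the ring of integers. It has the form Z[w], where w is a root of
    a polynomial X^2 - T X + M that is Eisenstein at some prime p
    ([ring_of_integers_basis]). So O is treated as the lattice of integer pairs
    (x, y), with the positive definite form Q(x, y) = 4 N(x + y w) =
    a^2 + D b^2, where a = 2 x + T y, b = y and D = 4 M - T^2 > 0.

    Let S be n-optimal, with m = n + 1 points. Its Lagrange polynomials map O to
    O, and they express the Vandermonde matrix of any other set of m points by
    that of S. Hence the product of the norms of the differences in S divides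
    the same product for every other set of m points
    ([optimal_norm_product]). This has two consequences that are incompatible
    when m is large.

    The first is arithmetic. The p-adic valuation of the product is minimal,
    and this forces S to be equidistributed: for every j the numbers of points
    of S in the classes modulo p^j differ by at most one
    ([classes_balanced]).

    The second is geometric. The product itself is minimal, so S minimizes the
    logarithmic energy, the sum of ln Q(x - y) over pairs. Two kinds of
    rearrangement ([polarization]) give the shape of a minimizer. Reflections
    of one of the coordinates a and b are isometries; they show that S has a
    center and meets each line along an axis in an interval ([centered],
    [box_in]). For the other directions there are only approximate lattice
    reflections ([slide]); they change the energy by o(m^2)
    ([slide_gain_small]). If S had a gap much closer to the center than one of
    its points, such a reflection would gain a constant times m^2. Hence, away
    from the axes, S is the set of points with Q(z - c) at most r^2, up to an
    error that is small compared with m ([disc_property]).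

    For the contradiction let L be a power of p such that L^2 is of the order of
    m, and let l = L / p^5. A class modulo l, scaled down by l, is a translate of
    a fixed lattice, so that the points of S in a class are the lattice points
    in a disc of squared radius X = r^2 / l^2 in a bounded range, around a center
    that depends on the class and can be chosen almost freely. Take a circle
    through the two lattice points (0, 0) and (2 g, 0) that has no lattice point
    on the opposite arc. Moving its center slightly one way or the other
    includes or excludes these two points, and no other lattice point enters
    when they leave ([chord_locally]); compactness makes the margin uniform in
    X ([chord_uniform]). So two classes of S differ by at least two in size
    ([class_count_gap]), and S is not equidistributed. *)

Set Implicit Arguments.
Unset Strict Implicit.
Unset Printing Implicit Defensive.

Import Order.TTheory GRing.Theory Num.Theory.

Local Open Scope ring_scope.

(** * Polarization of a discrete energy *)

Section Polarization.
Variables (R : realType) (X : eqType) (w : X -> X -> R).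
Hypothesis wC : forall x y, w x y = w y x.

Definition energy (s : seq X) : R := \sum_(x <- s) \sum_(y <- s) w x y.

Lemma energy_perm s t : perm_eq s t -> energy s = energy t.
Proof.
move=> st; rewrite /energy (perm_big _ st); apply: eq_bigr => x _.
exact: perm_big.
Qed.

Lemma energy_cat s t :
  energy (s ++ t) =
  energy s + 2 * \sum_(x <- s) \sum_(y <- t) w x y + energy t.
Proof.
rewrite /energy big_cat /=.
under eq_bigr do rewrite big_cat.
under [X in _ + X = _]eq_bigr do rewrite big_cat.
rewrite !big_split /=.
have -> : \sum_(x <- t) \sum_(y <- s) w x y = \sum_(x <- s) \sum_(y <- t) w x y.
  by rewrite exchange_big; apply: eq_bigr => x _; apply: eq_bigr => y _.
ring.
Qed.

Variable tau : X -> X.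
Let err x y := w x y - w (tau x) (tau y).

(** Pairs inside [A] and pairs between [A] and [C] can be compared by applying
    [tau] to both members, because [tau] permutes [C]; only the pairs between
    [A] and [B] see a change of relative position. *)
Lemma energy_polarize A B C : perm_eq (map tau C) C ->
  energy (A ++ B ++ C) - energy (map tau A ++ B ++ C) =
  \sum_(a <- A) \sum_(a' <- A) err a a' + 2 * \sum_(a <- A) \sum_(z <- C) err a z
  + 2 * \sum_(a <- A) \sum_(b <- B) (w a b - w (tau a) b).
Proof.
move=> tauC; rewrite !energy_cat.
have e1 : \sum_(a <- A) \sum_(a' <- A) err a a' = energy A - energy (map tau A).
  rewrite /energy big_map -sumrB; apply: eq_bigr => a _.
  by rewrite big_map sumrB.
have e2 : \sum_(a <- A) \sum_(z <- C) err a z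
    = \sum_(a <- A) \sum_(z <- C) w a z - \sum_(a <- map tau A) \sum_(z <- C) w a z.
  rewrite big_map -sumrB; apply: eq_bigr => a _.
  rewrite sumrB; congr (_ - _).
  by rewrite -[RHS](perm_big _ tauC) big_map.
have e3 : \sum_(a <- A) \sum_(b <- B) (w a b - w (tau a) b)
    = \sum_(a <- A) \sum_(z <- B) w a z - \sum_(a <- map tau A) \sum_(z <- B) w a z.
  rewrite big_map -sumrB; apply: eq_bigr => a _.
  by rewrite sumrB.
rewrite e1 e2 e3.
have e4 s : \sum_(a <- s) \sum_(y <- B ++ C) w a y
    = \sum_(a <- s) \sum_(y <- B) w a y + \sum_(a <- s) \sum_(y <- C) w a y.
  by rewrite -big_split; apply: eq_bigr => a _; rewrite big_cat.
rewrite !e4; ring.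
Qed.

Variables (S : seq X) (neg : pred X).
Hypotheses (tauK : involutive tau) (uS : uniq S).
Hypothesis minS : forall t, uniq t -> size t = size S -> energy S <= energy t.

(** Moving every point of the negative side whose image is missing from [S]
    replaces [map tau swap_in] by [swap_in]; the remaining points are those of
    the other side whose image is missing, and a part stable under [tau]. *)
Definition swap_in := [seq tau s | s <- S & neg s && (tau s \notin S)].
Definition swap_pos := [seq s <- S | ~~ neg s && (tau s \notin S)].
Definition swap_fix := [seq s <- S | tau s \in S].

Lemma swap_inP x : (x \in swap_in) = [&& x \notin S, tau x \in S & neg (tau x)].
Proof.
apply/mapP/idP => [[s]|/and3P[xS txS nx]].
  by rewrite mem_filter => /andP[/andP[ns nS] sS] ->; rewrite tauK nS sS.
by exists (tau x); rewrite ?tauK // mem_filter tauK xS nx txS.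
Qed.

Lemma swap_split : perm_eq S (map tau swap_in ++ swap_pos ++ swap_fix).
Proof.
rewrite -map_comp map_id_in; last by move=> x _; rewrite /= tauK.
apply: uniq_perm => //.
  rewrite !cat_uniq !filter_uniq //= andbT.
  apply/andP; split; apply/hasPn => x; rewrite ?mem_cat !mem_filter //=.
    by case/orP=> [/andP[/andP[/negPf-> //]]|/andP[->]]; rewrite ?andbF.
  by case/andP=> ->; rewrite andbF.
move=> x; rewrite !mem_cat !mem_filter.
by case: (x \in S); case: (neg x); case: (tau x \in S).
Qed.

Lemma uniq_swap : uniq (swap_in ++ swap_pos ++ swap_fix).
Proof.
have := uS; rewrite (perm_uniq swap_split) !cat_uniq => /and3P[u1 h ->].
rewrite (map_inj_uniq (inv_inj tauK)) in u1; rewrite u1 andbT /=.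
apply/hasPn => x; rewrite mem_cat !mem_filter swap_inP => h'.
have -> // : x \in S by case/orP: h' => /andP[].
Qed.

Lemma swap_fix_inv : perm_eq (map tau swap_fix) swap_fix.
Proof.
apply: uniq_perm; rewrite ?(map_inj_uniq (inv_inj tauK)) ?filter_uniq //.
move=> x; rewrite mem_filter; apply/mapP/andP => [[s]|[txS xS]].
  by rewrite mem_filter => /andP[tS sS] ->; rewrite tauK.
by exists (tau x); rewrite ?tauK // mem_filter tauK xS.
Qed.

(** The polarized set has as many points as [S], hence at least its energy.
    When [tau] is an isometry the right side vanishes; in general it measures
    how far [tau] is from one. *)
Lemma polarization :
  2 * \sum_(a <- swap_in) \sum_(b <- swap_pos) (w (tau a) b - w a b) <=
  \sum_(a <- swap_in) \sum_(a' <- swap_in) err a a'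
  + 2 * \sum_(a <- swap_in) \sum_(z <- swap_fix) err a z.
Proof.
have := @energy_polarize swap_in swap_pos swap_fix swap_fix_inv.
rewrite -(energy_perm swap_split).
have /minS : uniq (swap_in ++ swap_pos ++ swap_fix) by exact: uniq_swap.
rewrite (perm_size swap_split) !size_cat size_map => /(_ erefl) le e.
have -> : \sum_(a <- swap_in) \sum_(b <- swap_pos) (w (tau a) b - w a b) =
   - \sum_(a <- swap_in) \sum_(b <- swap_pos) (w a b - w (tau a) b).
  rewrite -sumrN; apply: eq_bigr => a _; rewrite -sumrN.
  by apply: eq_bigr => b _; rewrite opprB.
lra.
Qed.

End Polarization.

(** * The lattice and its logarithmic energy *)

(** [acoord] and the second coordinate diagonalize four times the norm form of
    [x + y w], where [w ^ 2 = T w - M]. *)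
Definition acoord (T : int) (z : int * int) : int := 2 * z.1 + T * z.2.
Definition Disc (T M : int) : int := 4 * M - T ^+ 2.
Definition dot (T M : int) (z t : int * int) : int :=
  acoord T z * acoord T t + Disc T M * (z.2 * t.2).
Definition Q (T M : int) (z : int * int) : int := dot T M z z.
(** Since [ln 0 = 0], the diagonal contributes nothing to the energy. *)
Definition logQ (R : realType) (T M : int) (x y : int * int) : R :=
  ln (Q T M (x - y))%:~R.

Lemma sum_seq_gt0 (R : numDomainType) (I : eqType) (s : seq I) (F : I -> R) :
  s != [::] -> (forall i, i \in s -> 0 < F i) -> 0 < \sum_(i <- s) F i.
Proof.
elim: s => // i s IH _ H; rewrite big_cons.
have Fi : 0 < F i by apply: H; rewrite mem_head.
have [->|/IH h] := eqVneq s [::]; first by rewrite big_nil addr0.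
by rewrite addr_gt0 // h // => j js; apply: H; rewrite inE js orbT.
Qed.

(** For a reflection [rho c] at level [c], these say that what lies on one side
    of the level is reflected into [S]. *)
Definition refl_down (S : seq (int * int)) (f : int * int -> int)
    (rho : int -> int * int -> int * int) (c : int) : Prop :=
  forall s, s \in S -> c < f s -> rho c s \in S.

Definition refl_up (S : seq (int * int)) (f : int * int -> int)
    (rho : int -> int * int -> int * int) (c : int) : Prop :=
  forall s, s \in S -> f s < c -> rho c s \in S.

Section Center.
Variables (S : seq (int * int)) (f : int * int -> int).
Variables (rho : int -> int * int -> int * int) (e : int * int).
Hypothesis frho : forall c z, f (rho c z) = 2 * c - f z.
Hypothesis fe : forall z j, f (z + e *~ j) = f z + 2 * j.
Hypothesis rho_in : forall c z, rho (c - 1) (rho c z) = z - e.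
Hypothesis rho_out : forall c z, rho c (rho (c - 1) z) = z + e.
Hypothesis rho_line : forall c z, exists j, rho c z = z + e *~ j.
Local Notation P := (refl_down S f rho).
Local Notation N := (refl_up S f rho).
Hypothesis dich : forall c, P c \/ N c.

(** [P c] holds above [S] and fails far below it; at the threshold [P c] holds
    and [P (c - 1)] fails, so that the dichotomy gives [N (c - 1)]. *)
Lemma center_exists : S != [::] -> exists c, P c /\ N (c - 1).
Proof.
move=> S0.
pose B : int := \sum_(s <- S) `|f s| + 1.
have fB s : s \in S -> `|f s| < B.
  move=> sS; rewrite /B (big_rem s) //= ltzD1 lerDl sumr_ge0 //.
have PB : P B by move=> s /fB fs; lia.
have nPB : ~ P (- B).
  have [s sS] : exists s, s \in S.
    by case: (S) S0 => // s S' _; exists s; rewrite mem_head.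
  move=> h; have := h s sS; have := fB s sS => fs.
  have /[swap] /[apply] : - B < f s by lia.
  by move/fB; rewrite frho; lia.
have [k kP] : exists k : nat, P (- B + k%:Z).
  exists `|(2 * B)%R|%N; suff -> : - B + `|(2 * B)%R|%N%:Z = B by [].
  have : 0 <= B by rewrite addr_ge0 // sumr_ge0. lia.
elim: k kP => [|k IH] kP; first by case: nPB; move: kP; rewrite addr0.
have [/IH//|h] := pselect (P (- B + k%:Z)).
exists (- B + k.+1%:Z); split=> //.
have -> : - B + k.+1%:Z - 1 = - B + k%:Z by lia.
by case: (dich (- B + k%:Z)).
Qed.

Variable c : int.
Hypotheses (Pc : P c) (Nc : N (c - 1)).

(** The reflections at [c - 1] and [c] compose to a translation by [e]: points
    move towards the level one step at a time without leaving [S]. *)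
Lemma center_right (s : int * int) (j : nat) :
  s \in S -> c - 1 < f s - 2 * j%:Z -> s - e *+ j \in S.
Proof.
move=> sS; elim: j => [|j IH] h; first by rewrite mulr0n subr0.
have {IH}sj : s - e *+ j \in S by apply: IH; lia.
have fsj : f (s - e *+ j) = f s - 2 * j%:Z.
  by rewrite -mulNrn -[- e *+ j]/((- e) *~ j) mulNrz -mulrNz fe; lia.
rewrite mulrSr opprD addrA -(rho_in c).
apply: Nc; last by rewrite frho fsj; lia.
by apply: Pc => //; rewrite fsj; lia.
Qed.

Lemma center_left (s : int * int) (j : nat) :
  s \in S -> f s + 2 * j%:Z < c -> s + e *+ j \in S.
Proof.
move=> sS; elim: j => [|j IH] h; first by rewrite mulr0n addr0.
have {IH}sj : s + e *+ j \in S by apply: IH; lia.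
have fsj : f (s + e *+ j) = f s + 2 * j%:Z by rewrite -[e *+ j]/(e *~ j) fe.
rewrite mulrSr addrA -(rho_out c).
apply: Pc; last by rewrite frho fsj; lia.
by apply: Nc => //; rewrite fsj; lia.
Qed.

Lemma center_interval (s : int * int) (j : int) : s \in S ->
  `|f s + 2 * j - c| <= `|f s - c| - 2 -> s + e *~ j \in S.
Proof.
have [fs|fs] := leP c (f s).
- move=> sS h.
  have [hj|hj] := leP c (f s + 2 * j).
    have [k jE] : exists k : nat, j = - k%:Z by exists `|j|%N; lia.
    by rewrite jE mulrNz; apply: center_right => //; lia.
  have [i ri] := rho_line c s.
  have rS : s + e *~ i \in S by rewrite -ri; apply: Pc => //; lia.
  have fr : f s + 2 * i = 2 * c - f s by rewrite -fe -ri frho.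
  have [k jE] : exists k : nat, j = i + k%:Z by exists `|j - i|%N; lia.
  rewrite jE mulrzDr addrA; apply: center_left => //.
  rewrite fe; lia.
- move=> sS h.
  have [hj|hj] := ltP (f s + 2 * j) c.
    have [k jE] : exists k : nat, j = k%:Z by exists `|j|%N; lia.
    by rewrite jE; apply: center_left => //; lia.
  have [i ri] := rho_line (c - 1) s.
  have rS : s + e *~ i \in S by rewrite -ri; apply: Nc => //; lia.
  have fr : f s + 2 * i = 2 * (c - 1) - f s by rewrite -fe -ri frho.
  have [k jE] : exists k : nat, j = i - k%:Z by exists `|i - j|%N; lia.
  rewrite jE mulrzBr addrA; apply: center_right => //.
  rewrite fe; lia.
Qed.

End Center.

Section Lattice.
Variables (T M : int).
Hypothesis D0 : 0 < Disc T M.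

Local Notation a := (acoord T).
Local Notation Dl := (Disc T M).
Local Notation "<| x , y |>" := (dot T M x y).
Local Notation Q := (Q T M).

Lemma acoordD x y : a (x + y) = a x + a y.
Proof. rewrite /acoord /=; ring. Qed.

Lemma acoordB x y : a (x - y) = a x - a y.
Proof. rewrite /acoord /=; ring. Qed.

Lemma dotDl x y z : <|x + y, z|> = <|x, z|> + <|y, z|>.
Proof. rewrite /dot /acoord /=; ring. Qed.

Lemma dotBl x y z : <|x - y, z|> = <|x, z|> - <|y, z|>.
Proof. rewrite /dot /acoord /=; ring. Qed.

Lemma QE z : Q z = a z ^+ 2 + Dl * z.2 ^+ 2.
Proof. by rewrite /Q /dot !expr2. Qed.

Lemma QN z : Q (- z) = Q z.
Proof. rewrite !QE /acoord /=; ring. Qed.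

Lemma QD x y : Q (x + y) = Q x + 2 * <|x, y|> + Q y.
Proof. rewrite !QE /dot /acoord /=; ring. Qed.

Lemma Q_ge0 z : 0 <= Q z.
Proof. rewrite QE; have := D0; nia. Qed.

Lemma Q_eq0 z : (Q z == 0) = (z == 0).
Proof.
apply/idP/eqP => [|->]; last by rewrite QE /acoord /= !mulr0.
have h2 : 0 <= Dl * z.2 ^+ 2 by rewrite mulr_ge0 ?sqr_ge0 // ltW.
rewrite QE (paddr_eq0 (sqr_ge0 _) h2) sqrf_eq0 mulf_eq0 (gt_eqF D0) /=.
rewrite {h2} sqrf_eq0 /acoord; case: z => x y /= /andP[ex /eqP y0].
by move: ex; rewrite y0 mulr0 addr0 mulf_eq0 /= => /eqP ->.
Qed.

Lemma Q_gt0 z : z != 0 -> 0 < Q z.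
Proof. by move=> z0; rewrite lt0r Q_eq0 z0 Q_ge0. Qed.

Lemma cauchy_schwarz x y : <|x, y|> ^+ 2 <= Q x * Q y.
Proof.
rewrite !QE /dot -subr_ge0.
set u := a x; set v := a y.
suff -> : (u ^+ 2 + Dl * x.2 ^+ 2) * (v ^+ 2 + Dl * y.2 ^+ 2)
   - (u * v + Dl * (x.2 * y.2)) ^+ 2 = Dl * (u * y.2 - v * x.2) ^+ 2.
  by rewrite mulr_ge0 ?sqr_ge0 // ltW.
ring.
Qed.

Variable R : realType.
Local Notation w := (@logQ R T M).

Lemma logQC x y : w x y = w y x.
Proof. by rewrite /logQ -QN opprB. Qed.

Lemma logQ_lt x y x' y' : x != y -> Q (x - y) < Q (x' - y') -> w x y < w x' y'.
Proof.
move=> xy h; have q0 : 0 < Q (x - y) by rewrite Q_gt0 // subr_eq0.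
by rewrite ltr_ln ?posrE ?ltr_int ?ltr0z // (lt_trans q0).
Qed.

Definition minimal (S : seq (int * int)) :=
  forall t, uniq t -> size t = size S -> energy w S <= energy w t.

Section Reflection.
Variables (S : seq (int * int)) (f : int * int -> int) (tau : int * int -> int * int).
Variable c : int.
Hypotheses (uS : uniq S) (minS : minimal S) (tauK : involutive tau).
Hypotheses (ftau : forall z, f (tau z) = 2 * c - f z).
Hypothesis (tau_iso : forall x y, Q (tau x - tau y) = Q (x - y)).
Hypothesis (tau_fix : forall z, f z = c -> tau z = z).
Hypothesis (tau_far : forall x y, c < f x -> c < f y -> Q (x - y) < Q (tau x - y)).

(** If both sides had a point whose mirror image is missing, polarization would
    be strict: moving a point across the level brings it closer to the points
    of the other side. *)
Lemma reflection_dichotomy :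
  (forall s, s \in S -> c < f s -> tau s \in S) \/
  (forall s, s \in S -> f s < c -> tau s \in S).
Proof.
have := @polarization R _ w logQC tau S (fun s => f s < c) tauK uS minS.
set A := swap_in _ _ _; set B := swap_pos _ _ _ => h.
have err0 s t : \sum_(x <- s) \sum_(y <- t) (w x y - w (tau x) (tau y)) = 0.
  by rewrite big1 // => x _; rewrite big1 // => y _; rewrite /logQ tau_iso subrr.
rewrite !err0 mulr0 addr0 in h.
have [A0|An0] := eqVneq A [::].
  right=> s sS fs; apply: contraT => tsS.
  suff : tau s \in A by rewrite A0.
  by rewrite swap_inP // tauK sS tsS fs.
have [B0|Bn0] := eqVneq B [::].
  left=> s sS fs; apply: contraT => tsS.
  suff : s \in B by rewrite B0.
  by rewrite mem_filter sS tsS -leNgt (ltW fs).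
suff : 0 < 2 * \sum_(x <- A) \sum_(b <- B) (w (tau x) b - w x b).
  by rewrite ltNge h.
rewrite mulr_gt0 // sum_seq_gt0 // => x; rewrite swap_inP // => /and3P[xS txS fx].
rewrite sum_seq_gt0 // => y; rewrite mem_filter => /andP[/andP[fy tyS] yS].
rewrite subr_gt0 logQ_lt //; first by apply: contraNneq xS => ->.
apply: tau_far; first by move: fx; rewrite ftau; lia.
have : f y != c by apply: contraNneq tyS => /tau_fix ->.
lia.
Qed.

End Reflection.

End Lattice.

(** * Minimizers are centered and convex along the axes *)

Definition cong (L : int) (z t : int * int) : bool :=
  (L %| z.1 - t.1)%Z && (L %| z.2 - t.2)%Z.

Lemma count_box (s : seq (int * int)) (g : int * int -> int * int)
    (l1 l2 : int) (n1 n2 : nat) :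
  uniq s -> {in s &, injective g} ->
  (forall z, z \in s -> l1 <= (g z).1 < l1 + n1%:Z /\ l2 <= (g z).2 < l2 + n2%:Z) ->
  (size s <= n1 * n2)%N.
Proof.
move=> us gi gb.
pose box := [seq (l1 + i%:Z, l2 + j%:Z) | i <- iota 0 n1, j <- iota 0 n2].
rewrite -(size_map g) (_ : (n1 * n2 = size box)%N); last first.
  by rewrite size_allpairs !size_iota.
apply: uniq_leq_size; first by rewrite map_inj_in_uniq.
move=> _ /mapP[z /gb [b1 b2] ->]; apply/allpairsP.
exists (`|(g z).1 - l1|%N, `|(g z).2 - l2|%N); rewrite !mem_iota /=.
split; [lia|lia|rewrite [LHS]surjective_pairing; congr pair; lia].
Qed.

Section Steiner.
Variable T : int.
Local Notation a := (acoord T).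

(** The reflections of the coordinates [acoord T] and [snd], written so that
    they preserve the lattice; [e1] and [e2 T] are the corresponding axis
    directions, each changing its coordinate by [2]. *)
Definition row_refl (c : int) (z : int * int) : int * int :=
  (c - z.1 - T * z.2, z.2).
Definition col_refl (c : int) (z : int * int) : int * int :=
  (z.1 + T * (z.2 - c), 2 * c - z.2).
Definition e1 : int * int := (1, 0).
Definition e2 : int * int := (- T, 2).

Lemma acoord_row c z : a (row_refl c z) = 2 * c - a z.
Proof. rewrite /acoord /row_refl /=; ring. Qed.

Lemma acoord_col c z : a (col_refl c z) = a z.
Proof. rewrite /acoord /col_refl /=; ring. Qed.

Lemma pair_mulz (z : int * int) j : z *~ j = (z.1 * j, z.2 * j).
Proof.
case: z => x y /=; have h (n : nat) : (x, y) *+ n = (x * n%:Z, y * n%:Z) :> (int * int)%type.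
  elim: n => [|n IH]; first by rewrite mulr0n !mulr0.
  by rewrite mulrS IH -add1n PoszD !mulrDr !mulr1.
case: j => n; first exact: h.
by rewrite NegzE mulrNz -[_ *~ _]/(_ *+ _) h; congr pair; rewrite /= ?mulrN.
Qed.

Lemma acoord_inj (z t : int * int) : a z = a t -> z.2 = t.2 -> z = t.
Proof.
case: z t => x y [x' y']; rewrite /acoord /= => /[swap] -> h.
by congr pair; lia.
Qed.

(** A finite set need not be symmetric about any level. In each coordinate
    points above the level [c] are reflected in it, points below [c - 1] are
    reflected in [c - 1], and this is all that the dichotomy provides. *)
Record centered (S : seq (int * int)) (ca cb : int) : Prop := Centered {
  row_in : refl_down S a row_refl ca;
  row_out : refl_up S a row_refl (ca - 1);
  col_in : refl_down S snd col_refl cb;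
  col_out : refl_up S snd col_refl (cb - 1)
}.

Section Shape.
Variables (S : seq (int * int)) (ca cb : int).
Hypothesis cS : centered S ca cb.

Lemma row_interval (s : int * int) (j : int) : s \in S ->
  `|a s + 2 * j - ca| <= `|a s - ca| - 2 -> s + e1 *~ j \in S.
Proof.
apply: (@center_interval S a row_refl e1 acoord_row _ _ _ _ ca).
- by move=> z i; rewrite acoordD pair_mulz /acoord /=; ring.
- by move=> c z; case: z => x y; congr pair; rewrite /=; ring.
- by move=> c z; case: z => x y; congr pair; rewrite /=; ring.
- move=> c z; exists (c - a z); rewrite pair_mulz /acoord; case: z => x y.
  by congr pair; rewrite /=; ring.
- exact: row_in cS.
- exact: row_out cS.
Qed.

Lemma col_interval (s : int * int) (j : int) : s \in S ->
  `|s.2 + 2 * j - cb| <= `|s.2 - cb| - 2 -> s + e2 *~ j \in S.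
Proof.
apply: (@center_interval S snd col_refl e2 _ _ _ _ _ cb).
- by [].
- by move=> z i; rewrite pair_mulz /=; ring.
- by move=> c z; case: z => x y; congr pair; rewrite /=; ring.
- by move=> c z; case: z => x y; congr pair; rewrite /=; ring.
- move=> c z; exists (c - z.2); rewrite pair_mulz; case: z => x y.
  by congr pair; rewrite /=; ring.
- exact: col_in cS.
- exact: col_out cS.
Qed.

(** Each axis line meets [S] in an interval around the center, up to the parity
    of the second coordinate, which [e2] preserves. *)
Lemma box_in (s t : int * int) : s \in S -> (2 %| t.2 - s.2)%Z ->
  `|a t - ca| <= `|a s - ca| - 2 -> `|t.2 - cb| <= `|s.2 - cb| - 2 -> t \in S.
Proof.
move=> sS /dvdzP[j' jE'] h1 h2; have [j jE] : exists j : int, t.2 - s.2 = j * 2 by exists j'.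
clear j' jE'.
have -> : t = s + e1 *~ (t.1 - s.1 + T * j) + e2 *~ j.
  rewrite !pair_mulz; case: t s jE {sS h1 h2} => x y [x' y'] /= jE.
  congr pair => /=; [ring|]. lia.
apply: col_interval; last by rewrite pair_mulz /= mul0r addr0; lia.
apply: row_interval => //.
suff -> : a s + 2 * (t.1 - s.1 + T * j) = a t by [].
rewrite /acoord mulrDr mulrCA [2 * j]mulrC -jE; ring.
Qed.

(** A point far from the center would drag along its translate by [L e1] or
    [L e2], a congruent point of [S]. *)
Lemma extent_lt (L : int) : 0 < L -> {in S &, forall s t, cong L s t -> s = t} ->
  forall s : int * int, s \in S -> `|a s - ca| < 2 * L /\ `|s.2 - cb| < 2 * L.
Proof.
move=> L0 inj s sS; split; rewrite ltNge; apply/negP => h.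
- have [j jL hj] : exists2 j : int, j = L \/ j = - L
      & `|a s + 2 * j - ca| <= `|a s - ca| - 2.
    by have [h'|h'] := leP ca (a s); [exists (- L)|exists L]; lia.
  have /(inj _ _ sS (row_interval sS hj)) : cong L s (s + e1 *~ j).
    rewrite /cong pair_mulz /=.
    have -> : s.1 - (s.1 + 1 * j) = - 1 * j by ring.
    have -> : s.2 - (s.2 + 0 * j) = 0 by ring.
    by rewrite dvdz0 dvdz_mull //; case: jL => ->; rewrite ?rpredN dvdzz.
  by move/(congr1 fst); rewrite pair_mulz /=; lia.
- have [j jL hj] : exists2 j : int, j = L \/ j = - L
      & `|s.2 + 2 * j - cb| <= `|s.2 - cb| - 2.
    by have [h'|h'] := leP cb s.2; [exists (- L)|exists L]; lia.
  have /(inj _ _ sS (col_interval sS hj)) : cong L s (s + e2 *~ j).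
    rewrite /cong pair_mulz /=.
    have -> : s.1 - (s.1 + - T * j) = T * j by ring.
    have -> : s.2 - (s.2 + 2 * j) = - 2 * j by ring.
    by rewrite !dvdz_mull //; case: jL => ->; rewrite ?rpredN dvdzz.
  by move/(congr1 snd); rewrite pair_mulz /=; lia.
Qed.

(** Off these four lines the one-sided reflections are available and jointly
    injective. *)
Definition on_axis (z : int * int) : bool :=
  [|| a z == ca, a z == ca - 1, z.2 == cb | z.2 == cb - 1].

(** Central symmetry about the unit square of the center, an injection of [S]
    minus the axes into [S]. *)
Definition antipode (z : int * int) : int * int :=
  let z' := if ca < a z then row_refl ca z else row_refl (ca - 1) z in
  if cb < z'.2 then col_refl cb z' else col_refl (cb - 1) z'.

Lemma antipode_a (z : int * int) : a (antipode z) = 2 * ca - a z - (if ca < a z then 0 else 2).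
Proof.
rewrite /antipode; case: ifP => _; case: ifP => _; rewrite acoord_col acoord_row; lia.
Qed.

Lemma antipode_b (z : int * int) : (antipode z).2 = 2 * cb - z.2 - (if cb < z.2 then 0 else 2).
Proof.
by rewrite /antipode /row_refl /col_refl; case: (ca < a z) => /=; case: ifP => _ /=; lia.
Qed.

Lemma antipode_inj (z t : int * int) : ~~ on_axis z -> ~~ on_axis t -> antipode z = antipode t -> z = t.
Proof.
rewrite /on_axis !negb_or => /and4P[h1 h2 h3 h4] /and4P[h5 h6 h7 h8] e.
apply: acoord_inj.
  have := congr1 a e; rewrite !antipode_a; case: ifP; case: ifP; lia.
have := congr1 snd e; rewrite !antipode_b; case: ifP; case: ifP; lia.
Qed.

Lemma antipode_in (z : int * int) : z \in S -> ~~ on_axis z -> antipode z \in S.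
Proof.
rewrite /on_axis !negb_or => zS /and4P[h1 h2 h3 h4].
rewrite /antipode; set z' := if ca < a z then _ else _.
have z'2 : z'.2 = z.2 by rewrite /z'; case: ifP.
have z'S : z' \in S.
  rewrite /z'; have [h|h] := ltP ca (a z); first exact: (row_in cS).
  by apply: (row_out cS) => //=; lia.
have [h|h] := ltP cb z'.2; first exact: (col_in cS).
by apply: (col_out cS) => //=; lia.
Qed.

Lemma count_antipode (p q : pred (int * int)) : uniq S ->
  (forall z, z \in S -> p z -> ~~ on_axis z -> q (antipode z)) ->
  (count p S <= count q S + count on_axis S)%N.
Proof.
move=> uS h; apply: (@leq_trans (count (predI p (predC on_axis)) S + count on_axis S)).
  rewrite -(count_predUI _ on_axis) (leq_trans _ (leq_addr _ _)) // sub_count // => z /=.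
  by move=> ->; case: on_axis.
rewrite leq_add2r -!size_filter -(size_map antipode).
apply: uniq_leq_size.
  rewrite map_inj_in_uniq ?filter_uniq // => x y.
  rewrite !mem_filter /= => /andP[/andP[_ xa] _] /andP[/andP[_ ya] _].
  exact: antipode_inj.
move=> _ /mapP[x + ->]; rewrite !mem_filter /= => /andP[/andP[px xa] xS].
by rewrite h // antipode_in.
Qed.

End Shape.
End Steiner.

Section Minimal.
Variables (T M : int).
Hypothesis D0 : 0 < Disc T M.
Variable R : realType.
Local Notation a := (acoord T).
Local Notation Dl := (Disc T M).

Lemma row_dichotomy S c : uniq S -> minimal T M R S ->
  refl_down S a (row_refl T) c \/ refl_up S a (row_refl T) c.
Proof.
move=> uS mS; apply: (reflection_dichotomy (c := c) D0 uS mS) => //.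
- by case=> x y; congr pair; rewrite /=; ring.
- exact: acoord_row.
- move=> x y; rewrite !QE !acoordB !acoord_row /=; ring.
- case=> x y; rewrite /acoord /row_refl /= => <-; congr pair; ring.
- move=> x y cx cy; rewrite -subr_gt0 !QE !acoordB !acoord_row /=.
  rewrite (_ : _ - _ = 4 * ((a x - c) * (a y - c))); last by ring.
  by rewrite !mulr_gt0 ?subr_gt0.
Qed.

Lemma col_dichotomy S c : uniq S -> minimal T M R S ->
  refl_down S snd (col_refl T) c \/ refl_up S snd (col_refl T) c.
Proof.
move=> uS mS; apply: (reflection_dichotomy D0 uS mS) => //.
- by case=> x y; congr pair; rewrite /=; ring.
- move=> x y; rewrite !QE !acoordB !acoord_col /=; ring.
- case=> x y; rewrite /col_refl /= => ->; congr pair; ring.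
- move=> x y cx cy; rewrite -subr_gt0 !QE !acoordB !acoord_col /=.
  rewrite (_ : _ - _ = 4 * Dl * ((x.2 - c) * (y.2 - c))); last by ring.
  by rewrite !mulr_gt0 ?D0 // subr_gt0.
Qed.

Lemma minimal_centered S : S != [::] -> uniq S -> minimal T M R S ->
  exists ca cb, centered T S ca cb.
Proof.
move=> S0 uS mS.
have [ca [r1 r2]] := center_exists (@acoord_row T) (fun c => @row_dichotomy S c uS mS) S0.
have [cb [c1 c2]] := @center_exists S snd (col_refl T)
  (fun _ _ => erefl) (fun c => @col_dichotomy S c uS mS) S0.
by exists ca, cb.
Qed.

End Minimal.

(** * Sliding: lattice versions of reflections in arbitrary lines *)

Lemma exists_nat_gt (R : realType) (x : R) : exists n : nat, x < n%:R.
Proof.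
by exists (Num.bound `|x|); rewrite (le_lt_trans (ler_norm x)) // archi_boundP.
Qed.

Section Slide.
Variables (T M : int).
Hypothesis D0 : 0 < Disc T M.
Variable R : realType.
Local Notation a := (acoord T).
Local Notation Dl := (Disc T M).
Local Notation "<| x , y |>" := (dot T M x y).
Local Notation Q := (Q T M).
Local Notation w := (@logQ R T M).

Lemma dot_mulz (z d : int * int) j : <|z + d *~ j, d|> = <|z, d|> + j * Q d.
Proof. rewrite dotDl; congr (_ + _); rewrite QE pair_mulz /dot /acoord /=; ring. Qed.

Lemma Q_mulz (z d : int * int) j :
  Q (z + d *~ j) = Q z + 2 * j * <|z, d|> + j ^+ 2 * Q d.
Proof. rewrite !QE pair_mulz /dot /acoord /=; ring. Qed.

Section Fixed.
Variables (d : int * int) (c : int).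
Hypothesis d0 : d != 0.
Let Qd : 0 < Q d := Q_gt0 D0 d0.

(** The direction [d] cuts the plane into slabs of width [Q d], and [slide]
    translates the slab [k] onto the slab [- k - 1]. It is a lattice
    substitute for the reflection in the line where the dot product with [d]
    is [c]. The two middle slabs stay in place. *)
Definition slab (z : int * int) : int := ((c - <|z, d|>) %/ Q d)%Z.
Definition slide (z : int * int) : int * int :=
  if (slab z == 0) || (slab z == - 1) then z else z + d *~ (2 * slab z + 1).
Definition slab_neg (z : int * int) : bool := slab z <= - 2.

Lemma slabP z : slab z * Q d <= c - <|z, d|> < (slab z + 1) * Q d.
Proof.
rewrite /slab; set n := c - _.
by rewrite lez_floor ?gt_eqF //= ltz_ceil.
Qed.

Lemma slab_shift z j : slab (z + d *~ j) = slab z - j.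
Proof.
rewrite /slab dot_mulz.
have -> : c - (<|z, d|> + j * Q d) = (- j) * Q d + (c - <|z, d|>) by ring.
by rewrite divzMDl ?gt_eqF // addrC.
Qed.

Lemma slab_slide z : slide z != z -> slab (slide z) = - slab z - 1.
Proof. by rewrite /slide; case: ifP => [_ /eqP//|_ _]; rewrite slab_shift; lia. Qed.

Lemma slideK : involutive slide.
Proof.
move=> z; rewrite {2}/slide; case: ifP => [h|/negbT h]; first by rewrite /slide h.
rewrite /slide slab_shift ifN; last by move: h; lia.
rewrite -addrA -mulrzDr.
have -> : 2 * slab z + 1 + (2 * (slab z - (2 * slab z + 1)) + 1) = 0 by ring.
by rewrite mulr0z addr0.
Qed.

(** The exact reflection moves [z] by [2 (c - <z, d>) / Q d] times [d]. *)
Lemma slide_near z : exists2 m : int, slide z = z + d *~ m &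
  `|m * Q d - 2 * (c - <|z, d|>)| <= 2 * Q d.
Proof.
have /andP[h1 h2] := slabP z; rewrite /slide; case: ifP => h.
  exists 0; first by rewrite mulr0z addr0.
  by case/orP: h => /eqP k0; move: h1 h2; rewrite k0; lia.
exists (2 * slab z + 1) => //; move: h1 h2; set n := c - _.
rewrite mulrDl mul1r; set k := slab z; set q := Q d; lia.
Qed.

(** [slide] differs from an isometry by a bounded multiple of [d] at each point,
    so squared distances decrease at most by a term linear in the distance. *)
Lemma Q_slide_sub x y :
  Q (x - y) - Q (slide x - slide y) <= 8 * `|<|x - y, d|>|.
Proof.
have [m1 -> h1] := slide_near x; have [m2 -> h2] := slide_near y.
have -> : x + d *~ m1 - (y + d *~ m2) = (x - y) + d *~ (m1 - m2).
  by rewrite mulrzBr opprD addrACA.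
rewrite Q_mulz; move: h1 h2; have := dotBl T M x y d.
set u := <|x - y, d|>; set p1 := <|x, d|>; set p2 := <|y, d|>; set q := Q d.
move=> uE h1 h2; pose X := (m1 - m2) * q + 2 * u.
have hX : `|X| <= 4 * q by rewrite /X uE; lia.
rewrite -(ler_pM2l Qd) -/q.
have -> : q * (Q (x - y) - (Q (x - y) + 2 * (m1 - m2) * u + (m1 - m2) ^+ 2 * q))
  = 2 * u * X - X ^+ 2 by rewrite /X; ring.
apply: (@le_trans _ _ (2 * `|u| * `|X|)).
  rewrite (le_trans _ (_ : 2 * u * X <= _)) ?gerBl ?sqr_ge0 //.
  by rewrite -!mulrA ler_pM2l // -normrM ler_norm.
rewrite (_ : q * _ = 2 * `|u| * (4 * q)); last by ring.
by rewrite ler_wpM2l.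
Qed.

Lemma Q_slide_gain z b : 0 < slab z -> 0 < slab b ->
  (2 * slab z + 1) * (2 * slab b - 1) * Q d <= Q (slide z - b) - Q (z - b).
Proof.
move=> kz kb; rewrite /slide ifN; last by lia.
have -> : z + d *~ (2 * slab z + 1) - b = (z - b) + d *~ (2 * slab z + 1).
  by rewrite addrAC.
rewrite Q_mulz dotBl.
have /andP[h1 h2] := slabP z; have /andP[h3 h4] := slabP b.
set k := slab z in kz h1 h2 *; set l := slab b in kb h3 h4 *.
set q := Q d in h1 h2 h3 h4 *; set p := <|z, d|> in h1 h2 *; set r := <|b, d|> in h3 h4 *.
set Z := Q (z - b).
rewrite (_ : _ - Z = (2 * k + 1) * (2 * (p - r) + (2 * k + 1) * q)); last by ring.
rewrite -mulrA ler_pM2l; last by lia.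
clearbody k l q p r; move: h1 h2 h3 h4; clear; nia.
Qed.

End Fixed.

Lemma logQ_ge0 x y : 0 <= w x y.
Proof.
rewrite /logQ; have [->|xy] := eqVneq x y.
  by rewrite subrr QE /= /acoord /= !mulr0 ln0.
have : 0 < Q (x - y) by rewrite Q_gt0 // subr_eq0.
by move=> h; rewrite ln_ge0 // ler1z.
Qed.

Lemma near_count (K : nat) (s : seq (int * int)) (x : int * int) : uniq s ->
  (count (fun y => (Q (x - y) < K%:Z)%R) s <= 2 * K * (2 * K))%N.
Proof.
move=> us; rewrite -size_filter.
apply: (@count_box _ (fun y => (a y, y.2)) (a x - K%:Z) (x.2 - K%:Z)).
- exact: filter_uniq.
- by move=> y z _ _ [] h1 h2; exact: acoord_inj h1 h2.
move=> y; rewrite mem_filter QE acoordB /= => /andP[+ _].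
set u := a x; set v := a y; set b := x.2; set b' := y.2 => h.
have D1 : Dl >= 1 by [].
have h1 : (u - v) ^+ 2 < K%:Z.
  by apply: le_lt_trans h; rewrite lerDl mulr_ge0 ?sqr_ge0 // ltW.
have h2 : (b - b') ^+ 2 < K%:Z.
  apply: le_lt_trans h; apply: (@le_trans _ _ (Dl * (b - b') ^+ 2)).
    by rewrite ler_peMl ?sqr_ge0.
  by rewrite lerDr sqr_ge0.
by rewrite !expr2 in h1 h2; split; apply/andP; split; nia.
Qed.

(** By the Cauchy-Schwarz inequality the relative change of [Q (x - y)] in
    [Q_slide_sub] tends to [0] as [x] and [y] move apart. *)
Lemma slide_err (eps : R) (B : int) : 0 < eps -> exists K : nat,
  forall d c x y, d != 0 -> Q d <= B -> K%:Z <= Q (x - y) ->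
  w x y - w (slide d c x) (slide d c y) <= eps.
Proof.
move=> e0; pose th : R := 1 - expR (- eps).
have th0 : 0 < th by rewrite subr_gt0 expR_lt1 oppr_lt0.
have [K hK] : exists K : nat, 64 * B%:~R / th ^+ 2 < K%:R.
  exact: exists_nat_gt.
exists K.+1 => d c x y d0 dB KQ.
have Qu : 0 < Q (x - y) by lia.
set u := x - y in Qu KQ *.
have := Q_slide_sub c d0 x y; rewrite -/u; set u' := slide d c x - slide d c y => h.
have cs := cauchy_schwarz D0 u d.
have key : (8 * `|<|u, d|>|)%:~R <= th * (Q u)%:~R :> R.
  rewrite -(@ler_pXn2r _ 2) ?nnegrE //; last first.
    by apply: mulr_ge0; [exact: ltW|rewrite ler0z ltW].
    rewrite exprMn.
    have : ((8 * `|<|u, d|>|) ^+ 2)%:~R <= (64 * (Q u * B))%:~R :> R.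
      rewrite ler_int exprMn real_normK ?num_real //.
      have := Q_gt0 D0 d0; nia.
    rewrite rmorphXn /= => /le_trans; apply.
    have th2 : 0 < th ^+ 2 by rewrite exprn_gt0.
    rewrite !intrM ltr_pdivrMr // in hK *.
    have hKu : K%:R <= (Q u)%:~R :> R.
      by rewrite -[K%:R]/(K%:Z%:~R) ler_int; lia.
    have Qur : 0 < (Q u)%:~R :> R by rewrite ltr0z.
    nra.
have Qu' : expR (- eps) * (Q u)%:~R <= (Q u')%:~R :> R.
  move: h; rewrite -(ler_int R) rmorphB /=; rewrite /th in key; lra.
rewrite lerBlDr /logQ -/u -/u' -lerBlDl addrC.
have Qur : 0 < (Q u)%:~R :> R by rewrite ltr0z.
have -> : - eps + ln (Q u)%:~R = ln (expR (- eps) * (Q u)%:~R).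
  by rewrite lnM ?posrE ?expR_gt0 // expRK.
by rewrite ler_ln ?posrE ?mulr_gt0 ?expR_gt0 // (lt_le_trans _ Qu') ?mulr_gt0 ?expR_gt0.
Qed.

Definition slide_gain (S : seq (int * int)) (d : int * int) (c : int) : R :=
  \sum_(x <- swap_in (slide d c) S (slab_neg d c))
   \sum_(y <- swap_pos (slide d c) S (slab_neg d c)) (w (slide d c x) y - w x y).

(** In [polarization], distant pairs contribute at most [eps / 3] each, and a
    point has a bounded number of close neighbors, each contributing at most
    [ln K]. So a minimizer leaves no gain of quadratic order. *)
Lemma slide_gain_small (eps : R) (B : int) : 0 < eps -> exists m0 : nat,
  forall S d c, uniq S -> minimal T M R S -> d != 0 -> Q d <= B ->
  (m0 <= size S)%N -> slide_gain S d c <= eps * (size S)%:R ^+ 2.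
Proof.
move=> e0; have e3 : 0 < eps / 3 by rewrite divr_gt0.
have [K hK] := slide_err B e3.
pose NK := (2 * K * (2 * K))%N.
pose lK : R := ln K%:R.
have lK0 : 0 <= lK.
  by rewrite /lK; case: (K) => [|k]; [rewrite ln0|rewrite ln_ge0 // ler1n].
have [m0 hm0] : exists m0 : nat, 3 * NK%:R * lK / eps < m0%:R.
  exact: exists_nat_gt.
exists m0 => S d c uS mS d0 dB hm.
have := polarization (@logQC T M R) (slab_neg d c) (slideK c d0) uS mS.
rewrite -/(slide_gain S d c); set A := swap_in _ _ _; set C := swap_fix _ _.
set m : R := (size S)%:R.
have inner x s : uniq s -> (size s <= size S)%N ->
    \sum_(y <- s) (w x y - w (slide d c x) (slide d c y)) <= eps / 3 * m + NK%:R * lK.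
  move=> us ss.
  apply: (@le_trans _ _ (\sum_(y <- s) (eps / 3 + (Q (x - y) < K%:Z)%R%:R * lK))).
    apply: ler_sum => y _; have [hQ|hQ] := ltP (Q (x - y)) K%:Z; last first.
      by rewrite mul0r addr0 hK.
    rewrite mul1r; apply: (@le_trans _ _ lK); last by rewrite lerDr ltW.
    rewrite lerBlDr (le_trans _ (_ : lK <= _)) ?lerDl ?logQ_ge0 //.
    have [->|xy] := eqVneq x y; first by rewrite /logQ subrr QE /acoord /= !mulr0 ln0.
    have Q0 : 0 < Q (x - y) by rewrite Q_gt0 // subr_eq0.
    rewrite /logQ /lK -[K%:R]/(K%:Z%:~R) ler_ln ?posrE ?ltr0z ?ler_int; lia.
  rewrite big_split /= big_const_seq count_predT iter_addr_0 -mulr_suml.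
  rewrite -[_ *+ size s]mulr_natr lerD //; first by rewrite ler_wpM2l ?ler_nat // ltW.
  rewrite ler_wpM2r // -natr_sum ler_nat.
  have <- : count (fun y => Q (x - y) < K%:Z) s = (\sum_(y <- s) (Q (x - y) < K%:Z)%R)%N.
    by rewrite -sumn_count sumnE big_map.
  exact: near_count.
have outer s t : uniq s -> uniq t -> (size s <= size S)%N -> (size t <= size S)%N ->
    \sum_(x <- s) \sum_(y <- t) (w x y - w (slide d c x) (slide d c y))
    <= m * (eps / 3 * m + NK%:R * lK).
  move=> us ut ss ts; apply: (@le_trans _ _ (\sum_(x <- s) (eps / 3 * m + NK%:R * lK))).
    by apply: ler_sum => x _; exact: inner.
  rewrite big_const_seq count_predT iter_addr_0 -[_ *+ size s]mulr_natl ler_wpM2r ?ler_nat //.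
  by apply: addr_ge0; apply: mulr_ge0 => //; apply: ltW.
have uA : uniq A by have := uniq_swap (slab_neg d c) (slideK c d0) uS;
  rewrite cat_uniq => /andP[].
have sA : (size A <= size S)%N by rewrite size_map size_filter count_size.
have uC : uniq C by rewrite filter_uniq.
have sC : (size C <= size S)%N by rewrite size_filter count_size.
have hAA := outer _ _ uA uA sA sA; have hAC := outer _ _ uA uC sA sC.
have mm0 : m0%:R <= m by rewrite ler_nat.
rewrite ltr_pdivrMr // in hm0.
have m_ge0 : 0 <= m by rewrite ler0n.
have hm1 : 3 * NK%:R * lK <= m * eps.
  by rewrite (le_trans (ltW hm0)) // ler_wpM2r // ltW.
set g := slide_gain S d c => h.
have : 2 * g <= 3 * (m * (eps / 3 * m + NK%:R * lK)) by lra.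
have : m * (3 * NK%:R * lK) <= m * (m * eps) by rewrite ler_wpM2l.
rewrite expr2; set t1 := NK%:R * lK; set t2 := m * (m * eps).
have -> : m * (3 * NK%:R * lK) = 3 * (m * t1) by rewrite /t1; ring.
have -> : m * (eps / 3 * m + t1) = t2 / 3 + m * t1 by rewrite /t2; field.
have -> : eps * (m * m) = t2 by rewrite /t2; ring.
lra.
Qed.

End Slide.

(** * Choice of a direction *)

Lemma sqr_le_abs (x y : int) : 0 <= y -> x ^+ 2 <= y ^+ 2 -> `|x| <= y.
Proof. by move=> y0; rewrite -[x ^+ 2]real_normK ?num_real // ler_pXn2r ?nnegrE. Qed.

Lemma form_le (D x y r : int) : 0 < D -> `|x| <= r -> `|y| <= r ->
  x ^+ 2 + D * y ^+ 2 <= (1 + D) * r ^+ 2.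
Proof.
move=> D0 xr yr; have sq (z : int) : `|z| <= r -> z ^+ 2 <= r ^+ 2.
  by move=> zr; rewrite -[z ^+ 2]real_normK ?num_real // ler_pXn2r ?nnegrE // (le_trans _ zr).
by rewrite mulrDl mul1r lerD ?sq // ler_pM2l ?sq.
Qed.

(** The Cauchy-Schwarz inequality for the form [A ^ 2 + D B ^ 2], in the shape
    in which the transport estimate uses it. *)
Lemma projection_le (D A B e f C q r : int) : 0 < D -> 0 <= r ->
  q = A ^+ 2 + D * B ^+ 2 -> e ^+ 2 + D * f ^+ 2 <= r ^+ 2 -> C ^+ 2 <= q ->
  `|(e * A + D * (f * B)) * C| <= r * q.
Proof.
move=> D0 r0 qE er Cq; have q0 : 0 <= q by rewrite (le_trans _ Cq) ?sqr_ge0.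
apply: sqr_le_abs; first exact: mulr_ge0.
rewrite !exprMn.
have cs : (e * A + D * (f * B)) ^+ 2 <= r ^+ 2 * q.
  apply: (@le_trans _ _ ((e ^+ 2 + D * f ^+ 2) * q)); last by rewrite ler_wpM2r.
  rewrite -subr_ge0 qE.
  rewrite (_ : _ - _ = D * (e * B - f * A) ^+ 2); last by ring.
  by rewrite mulr_ge0 ?sqr_ge0 // ltW.
rewrite (_ : r ^+ 2 * q ^+ 2 = (r ^+ 2 * q) * q); last by ring.
by apply: ler_pM => //; apply: sqr_ge0.
Qed.

(** A point [t1 + u] moved by [n d], where [n] comes from a reflection taking
    [t1] nearly to [s1] and [d] is nearly proportional to [s1 - t1]: one
    coordinate of its difference from [s1], times [K]. The errors come from
    [d], from the reflection ([X]) and from the displacement [u]. *)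
Lemma transport_bound (D L K A B Da Db ua ub n X C Dc uc r W q : int) :
  0 < D -> 0 < K -> 0 < L -> 0 <= r -> 0 < q ->
  q = A ^+ 2 + D * B ^+ 2 -> C ^+ 2 <= q -> `|C| <= W ->
  `|L * A - K * Da| <= 2 * L -> `|L * B - K * Db| <= 2 * L ->
  `|L * C - K * Dc| <= 2 * L -> ua ^+ 2 + D * ub ^+ 2 <= r ^+ 2 -> `|X| <= 2 * q ->
  n * q = Da * A + D * (Db * B) - 2 * (ua * A + D * (ub * B)) + X ->
  K * `|uc - Dc + n * C| <= 2 * L + 2 * L * (1 + D) + K * (`|uc| + 2 * r + 2 * W).
Proof.
move=> D0 K0 L0 r0 q0 qE Cq CW hA hB hC hu hX hn.
set E1 := L * A - K * Da in hA; set E2 := L * B - K * Db in hB.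
set Ec := L * C - K * Dc in hC.
have hE : `|(E1 * A + D * (E2 * B)) * C| <= 2 * L * (1 + D) * q.
  apply: projection_le => //.
    by rewrite mulr_ge0 ?addr_ge0 ?mulr_ge0 // ltW.
  apply: (le_trans (form_le D0 hA hB)); rewrite [leLHS]mulrC.
  by rewrite [X in _ <= X]exprMn ler_wpM2l ?sqr_ge0 // expr2 ler_peMr //; lia.
have hU : `|(ua * A + D * (ub * B)) * C| <= r * q by exact: projection_le.
rewrite -(ler_pM2r q0).
have -> : K * `|uc - Dc + n * C| * q = `|K * ((uc - Dc + n * C) * q)|.
  by rewrite !normrM (gtr0_norm K0) (gtr0_norm q0) mulrA.
set PE := (E1 * A + _) * C in hE; set PU := (ua * A + _) * C in hU.
have -> : K * ((uc - Dc + n * C) * q) = q * Ec - PE + K * (q * uc - 2 * PU + X * C).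
  have -> : (uc - Dc + n * C) * q = (uc - Dc) * q + n * q * C by ring.
  rewrite hn /PE /PU /Ec /E1 /E2 qE; ring.
have hXC : `|X * C| <= 2 * q * W.
  by rewrite normrM ler_pM.
have h1 : `|q * Ec| <= q * (2 * L) by rewrite normrM (gtr0_norm q0) ler_pM2l.
have h2 : `|K * (q * uc - 2 * PU + X * C)| <= K * (q * `|uc| + 2 * (r * q) + 2 * q * W).
  rewrite normrM (gtr0_norm K0) ler_pM2l //.
  have tri (x y z t v u : int) : `|x| <= v -> `|u| <= t -> `|y| = z ->
    `|y - 2 * u + x| <= z + 2 * t + v by clear; lia.
  by apply: tri => //; rewrite normrM (gtr0_norm q0).
have -> : (2 * L + 2 * L * (1 + D) + K * (`|uc| + 2 * r + 2 * W)) * q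
   = q * (2 * L) + 2 * L * (1 + D) * q + K * (q * `|uc| + 2 * (r * q) + 2 * q * W) by ring.
apply: (le_trans (ler_normD _ _)); rewrite lerD //.
by apply: (le_trans (ler_normB _ _)); rewrite lerD.
Qed.

(** [P] is the difference of the squared distances of [s1] and [t1] from the
    center. If it is large, then [d] has a large dot product both with
    [s1 - t1] and with the sum of the two radius vectors: the mirror line
    separates [s1] from [t1], and the center lies on the side of [t1]. *)
Lemma direction_progress (D H G W K L P Fa Fb Da Db A B : int) :
  0 < D -> G = 1 + D -> 0 < H -> 0 < W -> 0 < L ->
  16 * H ^+ 2 * G ^+ 2 * W ^+ 3 <= K ->
  P = Da * Fa + D * (Db * Fb) -> L ^+ 2 <= 2 * H * P ->
  `|Da| <= W * L -> `|Db| <= W * L -> `|Fa| <= W * L -> `|Fb| <= W * L ->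
  `|L * A - K * Da| <= 2 * L -> `|L * B - K * Db| <= 2 * L ->
  2 * G * W * L <= Da * A + D * (Db * B) /\ 2 * G * W * L <= Fa * A + D * (Fb * B).
Proof.
move=> D0 GE H0 W0 L0 hK PE hP hDa hDb hFa hFb hA hB.
have G0 : 0 < G by lia.
set E1 := L * A - K * Da in hA; set E2 := L * B - K * Db in hB.
have cross (x y : int) : `|x| <= W * L -> `|y| <= W * L ->
    - (2 * G * W * L ^+ 2) <= x * E1 + D * (y * E2).
  move=> hx hy.
  have hb (u v : int) : `|u| <= W * L -> `|v| <= 2 * L -> - (2 * W * L ^+ 2) <= u * v.
    move=> hu hv; rewrite lerNl (le_trans (ler_norm _)) // normrN normrM.
    apply: le_trans (ler_pM _ _ hu hv) _ => //; rewrite le_eqVlt; apply/orP; left.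
    by apply/eqP; ring.
  rewrite GE (_ : - _ = - (2 * W * L ^+ 2) + D * - (2 * W * L ^+ 2)); last by ring.
  by rewrite lerD ?hb // ler_pM2l // hb.
have K0 : 0 <= K by apply: le_trans hK; rewrite !mulr_ge0 // ?exprn_ge0 // ltW.
have P0 : 0 < P.
  have : 0 < 2 * H * P by apply: lt_le_trans hP; rewrite exprn_gt0.
  by rewrite pmulr_rgt0 // mulr_gt0.
have big (x : int) : L ^+ 2 <= 4 * H ^+ 2 * G * W ^+ 2 * x -> 4 * G * W * L ^+ 2 <= K * x.
  move=> hx; have x0 : 0 <= x.
    rewrite leNgt; apply/negP => xn; move: hx; rewrite leNgt => /negP; apply.
    rewrite (lt_trans (_ : _ < 0)) ?exprn_gt0 // pmulr_rlt0 // !mulr_gt0 ?exprn_gt0 //.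
  apply: (@le_trans _ _ (16 * H ^+ 2 * G ^+ 2 * W ^+ 3 * x)); last by rewrite ler_wpM2r.
  rewrite (_ : 16 * H ^+ 2 * G ^+ 2 * W ^+ 3 * x
    = 4 * G * W * (4 * H ^+ 2 * G * W ^+ 2 * x)); last by ring.
  by rewrite ler_pM2l // !mulr_gt0.
have fin (x y z : int) : L * x = K * y + z -> 4 * G * W * L ^+ 2 <= K * y ->
    - (2 * G * W * L ^+ 2) <= z -> 2 * G * W * L <= x.
  move=> e h1 h2; rewrite -(ler_pM2l L0) e.
  have -> : L * (2 * G * W * L) = 4 * G * W * L ^+ 2 - 2 * G * W * L ^+ 2 by ring.
  exact: lerD.
split.
- apply: (fin _ (Da ^+ 2 + D * Db ^+ 2) (Da * E1 + D * (Db * E2))); last exact: cross.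
    by rewrite /E1 /E2; ring.
  apply: big; set QD := _ + _.
  have QF : Fa ^+ 2 + D * Fb ^+ 2 <= G * (W * L) ^+ 2.
    by rewrite GE form_le.
  have QD0 : 0 <= QD by rewrite addr_ge0 ?sqr_ge0 // mulr_ge0 ?sqr_ge0 // ltW.
  have cs : P ^+ 2 <= QD * (Fa ^+ 2 + D * Fb ^+ 2).
    rewrite -subr_ge0 PE /QD (_ : _ - _ = D * (Da * Fb - Db * Fa) ^+ 2); last by ring.
    by rewrite mulr_ge0 ?sqr_ge0 // ltW.
  have h4 : (L ^+ 2) ^+ 2 <= (2 * H * P) ^+ 2.
    by rewrite ler_pXn2r ?nnegrE ?mulr_ge0 ?exprn_ge0 // ltW.
  rewrite -(ler_pM2l (_ : 0 < L ^+ 2)) ?exprn_gt0 // -[_ * L ^+ 2]expr2.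
  apply: (le_trans h4).
  rewrite (_ : (2 * H * P) ^+ 2 = 4 * H ^+ 2 * P ^+ 2); last by ring.
  rewrite (_ : L ^+ 2 * _ = 4 * H ^+ 2 * (QD * (G * (W * L) ^+ 2))); last by ring.
  rewrite ler_pM2l ?mulr_gt0 ?exprn_gt0 // (le_trans cs) // ler_wpM2l //.
- apply: (fin _ P (Fa * E1 + D * (Fb * E2))); last exact: cross.
    by rewrite PE /E1 /E2; ring.
  apply: big; apply: (le_trans hP).
  rewrite ler_pM2r //.
  have -> : 4 * H ^+ 2 * G * W ^+ 2 = 2 * H * (2 * H * G * W ^+ 2) by ring.
  rewrite ler_peMr ?mulr_ge0 //; first exact: ltW.
  have : 0 < H * G * W ^+ 2 by rewrite !mulr_gt0 ?exprn_gt0.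
  rewrite -!mulrA; set x := H * _; clearbody x; clear; lia.
Qed.

(** Rounding of [K / L] times a real vector to the lattice, with a prescribed
    parity of the second coordinate. *)
Lemma direction_exists (T L K Da Db : int) : 0 < L ->
  exists d : int * int, [/\ `|L * acoord T d - K * Da| <= 2 * L,
    `|L * d.2 - K * Db| <= 2 * L & (2 %| d.2 - Db)%Z].
Proof.
move=> L0.
have div (n m : int) : 0 < m -> exists q : int, q * m <= n < (q + 1) * m.
  by move=> m0; exists (n %/ m)%Z; rewrite lez_floor ?gt_eqF //= ltz_ceil.
have [q /andP[q1 q2]] := div (K * Db) L L0.
have [y yq yp] : exists2 y : int, q <= y <= q + 1 & (2 %| y - Db)%Z.
  have [h|h] := boolP (2 %| q - Db)%Z; [exists q; lia|exists (q + 1); lia].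
have [x /andP[x1 x2]] := div (K * Da - L * (T * y)) (2 * L) (mulr_gt0 (ltr0Sn _ 1) L0).
exists (x, y); split=> //=; rewrite /acoord /=.
  set n := K * Da in x1 x2 *; set v := L * (T * y) in x1 x2 *.
  have -> : L * (2 * x + T * y) = x * (2 * L) + v by rewrite /v; ring.
  move: x1 x2; rewrite mulrDl mul1r; set xl := x * (2 * L); lia.
have : L * q <= L * y <= L * q + L.
  by rewrite -[X in _ <= _ <= _ + X]mulr1 -mulrDr !ler_pM2l.
move: q1 q2; rewrite mulrDl mul1r [q * L]mulrC.
set n := K * Db; set lq := L * q; set ly := L * y; lia.
Qed.

(** * Estimates for one slide *)

Lemma count_split (X : Type) (p q : pred X) (s : seq X) :
  count p s = (count (predI q p) s + count (predI (predC q) p) s)%N.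
Proof. by rewrite -!count_filter count_predC size_filter. Qed.

Lemma sum_count (R : realDomainType) (X : Type) (p : pred X) (s : seq X) (v : R) :
  \sum_(x <- s) (p x)%:R * v = (count p s)%:R * v.
Proof. by rewrite -mulr_suml -natr_sum -sumn_count sumnE big_map. Qed.

Lemma double_sum_ge (R : realDomainType) (X Y : eqType) (A A0 : seq X) (B : seq Y)
    (p : pred Y) (F : X -> Y -> R) (v : R) :
  uniq A0 -> {subset A0 <= A} -> 0 <= v ->
  (forall x y, x \in A -> y \in B -> 0 <= F x y) ->
  (forall x y, x \in A0 -> y \in B -> p y -> v <= F x y) ->
  (size A0)%:R * (count p B)%:R * v <= \sum_(x <- A) \sum_(y <- B) F x y.
Proof.
move=> u0 sub v0 F0 Fv.
apply: (@le_trans _ _ (\sum_(x <- A) (x \in A0)%:R * ((count p B)%:R * v))).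
  rewrite sum_count mulrA ler_wpM2r // ler_wpM2r ?ler0n // ler_nat.
  rewrite -size_filter uniq_leq_size // => x xA0.
  by rewrite mem_filter xA0 sub.
rewrite big_seq [leRHS]big_seq; apply: ler_sum => x xA.
rewrite -sum_count mulr_sumr big_seq [leRHS]big_seq; apply: ler_sum => y yB.
have [xA0|] := boolP (x \in A0); last by rewrite mul0r F0.
rewrite mul1r; have [py|] := boolP (p y); last by rewrite mul0r F0.
by rewrite mul1r Fv.
Qed.

Section Core.
Variables (T M : int).
Hypothesis D0 : 0 < Disc T M.
Variable R : realType.
Local Notation a := (acoord T).
Local Notation Dl := (Disc T M).
Local Notation "<| x , y |>" := (dot T M x y).
Local Notation slab := (slab T M).
Local Notation slide := (slide T M).
Local Notation slab_neg := (slab_neg T M).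

Section Config.
Variables (S : seq (int * int)) (ca cb : int) (L : nat).
Hypotheses (uS : uniq S) (cS : centered T S ca cb).
Hypothesis ext : forall s : int * int, s \in S ->
  `|a s - ca| < 2 * L%:Z /\ `|s.2 - cb| < 2 * L%:Z.

(** A strip between parallel lines meets the region of [S] in a box of sides
    [4 L] and [n] for one of the coordinates and the dot product with [d]. *)
Lemma strip_count (d : int * int) (c : int) (n : nat) : d != 0 ->
  (count (fun z => (0 <= c - <|z, d|> < n%:Z)%R) S <= 4 * L * n)%N.
Proof.
move=> d0; rewrite -size_filter.
have [ad|ad] := eqVneq (a d) 0.
  apply: (@count_box _ (fun z => (a z, <|z, d|>)) (ca - 2 * L%:Z) (c - n%:Z + 1)).
  - exact: filter_uniq.
  - move=> x y _ _ [] h1; rewrite /dot -/(a x) -/(a y) ad !mulr0 !add0r => h2.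
    apply: acoord_inj h1 _; apply: (mulIf (_ : d.2 != 0)).
      apply: contraNneq d0 => d2; rewrite -(Q_eq0 D0) QE ad d2.
      by rewrite !expr2 !mulr0.
    by apply: (mulfI (_ : Dl != 0)) h2; rewrite gt_eqF.
  - move=> z; rewrite mem_filter => /andP[/= h1 /ext[h2 h3]]; split; clear -h1 h2; lia.
apply: (@count_box _ (fun z => (z.2, <|z, d|>)) (cb - 2 * L%:Z) (c - n%:Z + 1)).
- exact: filter_uniq.
- move=> x y _ _ [] h1; rewrite /dot -/(a x) -/(a y) h1 => /addIr /(mulIf ad) h2.
  exact: acoord_inj h2 h1.
- move=> z; rewrite mem_filter => /andP[/= h1 /ext[h2 h3]]; split; clear -h1 h3; lia.
Qed.

Lemma axis_count : (count (on_axis T ca cb) S <= 16 * L)%N.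
Proof.
have line (f : int * int -> int) (p : int * int -> int * int) (l : int) (v : int) :
    injective p ->
    (forall z, z \in S -> (p z).1 = f z /\ l - 2 * L%:Z < (p z).2 < l + 2 * L%:Z) ->
    (count (fun z => f z == v) S <= 4 * L)%N.
  move=> pI pr; rewrite -size_filter -[(4 * L)%N]mul1n.
  apply: (@count_box _ p v (l - 2 * L%:Z)).
  - exact: filter_uniq.
  - by move=> x y _ _; exact: pI.
  - move=> z; rewrite mem_filter => /andP[/eqP zv zS].
    have [-> /andP[h1 h2]] := pr z zS; rewrite zv; split; clear -h1 h2; lia.
have colA v : (count (fun z => a z == v) S <= 4 * L)%N.
  apply: (line a (fun z => (a z, z.2)) cb); first by move=> x y [] h1 h2; exact: acoord_inj h1 h2.
  by move=> z /ext[_ h]; split=> //=; clear -h; lia.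
have rowB v : (count (fun z => z.2 == v) S <= 4 * L)%N.
  apply: (line snd (fun z => (z.2, a z)) ca); first by move=> x y [] h1 h2; exact: acoord_inj h2 h1.
  by move=> z /ext[h _]; split=> //=; clear -h; lia.
have cU (p q : pred (int * int)) : (count (predU p q) S <= count p S + count q S)%N.
  by rewrite -count_predUI leq_addr.
have -> : (16 * L = 4 * L + (4 * L + (4 * L + 4 * L)))%N by lia.
apply: leq_trans (cU _ _) _; apply: leq_add; first exact: colA.
apply: leq_trans (cU _ _) _; apply: leq_add; first exact: colA.
apply: leq_trans (cU _ _) _; apply: leq_add; exact: rowB.
Qed.

(** [slide] matches the stable parts of both sides, so the comparison of the two
    sides passes to the parts whose images are missing. *)
Lemma swap_in_size (d : int * int) (c : int) : d != 0 ->
  (count (slab_neg d c) S <= count (fun z => (0 < slab d c z)%R) S + 16 * L)%N ->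
  (size (swap_in (slide d c) S (slab_neg d c)) <=
   size (swap_pos (slide d c) S (slab_neg d c)) + 16 * L)%N.
Proof.
move=> d0; set neg := slab_neg d c; set tau := slide d c.
set pos := fun z => _; pose stay (z : int * int) := tau z \in S.
rewrite size_map !size_filter.
have posE z : z \in S -> (~~ neg z && (tau z \notin S)) = (predI (predC stay) pos) z.
  move=> zS /=; rewrite /stay andbC; have [//|ntS] := boolP (tau z \in S).
  rewrite /pos /neg /slab_neg /=.
  suff : (slab d c z != 0) && (slab d c z != -1) by clear; lia.
  rewrite -negb_or; apply: contraNN ntS => h.
  by rewrite /tau /slide h.
rewrite (eq_in_count posE).
rewrite (count_split neg stay) (count_split pos stay).
have le : (count (predI stay pos) S <= count (predI stay neg) S)%N.
  rewrite -!size_filter -(size_map tau) uniq_leq_size //.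
    by rewrite (map_inj_uniq (inv_inj (slideK D0 c d0))) filter_uniq.
  move=> _ /mapP[z + ->]; rewrite !mem_filter /= => /andP[/andP[zs zp] zS].
  have ttz : tau (tau z) = z by exact: slideK.
  rewrite /stay ttz zS (_ : tau z \in S) // andbT /=.
  rewrite /neg /slab_neg; have tz : tau z != z.
    rewrite /tau /slide ifN; last by move: zp; rewrite /pos; clear; lia.
    rewrite -subr_eq0 addrAC subrr add0r pair_mulz.
    have k0 : 2 * slab d c z + 1 != 0 by move: zp; rewrite /pos; clear; lia.
    apply: contraNneq d0 => -[] /eqP h1 /eqP h2.
    move: h1 h2; rewrite !mulf_eq0 (negPf k0) !orbF => /eqP h1 /eqP h2.
    by rewrite [d]surjective_pairing h1 h2.
  by rewrite (slab_slide D0 d0 tz); move: zp; rewrite /pos; clear; lia.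
have -> : count (fun s => neg s && (tau s \notin S)) S = count (predI (predC stay) neg) S.
  by apply: eq_count => z /=; rewrite andbC.
move: le; set x1 := count _ S; set x2 := count _ S; set x3 := count _ S; set x4 := count _ S.
clear; lia.
Qed.

End Config.
End Core.

(** The points around [t] reached by even steps of both coordinates; these are
    the points to which [box_in] applies. *)
Definition grid (T : int) (t : int * int) (i j : int) : int * int :=
  t + e1 *~ i + e2 T *~ j.

Lemma acoord_grid T t i j : acoord T (grid T t i j) = acoord T t + 2 * i.
Proof. rewrite /grid !pair_mulz /acoord /=; ring. Qed.

Lemma snd_grid T t i j : (grid T t i j).2 = t.2 + 2 * j.
Proof. rewrite /grid !pair_mulz /=; ring. Qed.

Section Launch.
Variables (T M : int).
Hypothesis D0 : 0 < Disc T M.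
Local Notation a := (acoord T).
Local Notation Dl := (Disc T M).
Local Notation "<| x , y |>" := (dot T M x y).
Local Notation Q := (Q T M).
Local Notation slab := (slab T M).
Local Notation slide := (slide T M).

(** A small grid around [t1] lies in positive slabs of height of order [L], and
    [slide] carries it into the box of radius [r] around [s1]. *)
Lemma launch (s1 t1 d : int * int) (c L K G W Wd kap r h i j : int) :
  G = 1 + Dl -> 0 < L -> 0 < K -> 1 <= W -> 0 < kap -> d != 0 ->
  `|L * a d - K * (a s1 - a t1)| <= 2 * L ->
  `|L * d.2 - K * (s1.2 - t1.2)| <= 2 * L ->
  (2 %| d.2 - (s1.2 - t1.2))%Z ->
  `|a d| <= Wd -> `|d.2| <= Wd ->
  2 * c <= <|s1 + t1, d|> <= 2 * c + 1 ->
  2 * G * W * L <= (a s1 - a t1) * a d + Dl * ((s1.2 - t1.2) * d.2) ->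
  64 * G * kap <= K -> L <= kap * r -> 24 * G * kap * h <= L -> 4 * h * Wd <= L ->
  3 * Q d < L -> 8 * Wd * kap <= L -> 0 <= i <= h -> 0 <= j <= h ->
  let z := grid T t1 i j in
  [/\ 0 < slab d c z, L <= (2 * slab d c z + 1) * Q d,
      `|a (slide d c z) - a s1| <= r, `|(slide d c z).2 - s1.2| <= r &
      (2 %| (slide d c z).2 - s1.2)%Z].
Proof.
move=> GE L0 K0 W1 kap0 d0 hA hB par hAd hBd /andP[c1 c2] prog hK hr hh1 hh2 hq hL
  /andP[i0 ih] /andP[j0 jh] z.
have G2 : 2 <= G by move: D0; rewrite GE; clear; lia.
have h0 : 0 <= h by apply: le_trans ih.
have q0 : 0 < Q d := Q_gt0 D0 d0.
have az : a z = a t1 + 2 * i by exact: acoord_grid.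
have bz : z.2 = t1.2 + 2 * j by exact: snd_grid.
have /andP[k1 k2] := slabP D0 c d0 z.
set k := slab d c z in k1 k2 *.
set A := a d in hA hAd prog *; set B := d.2 in hB par hBd prog *.
set Da := a s1 - a t1 in hA prog; set Db := s1.2 - t1.2 in hB par prog.
set q := Q d in q0 k1 k2 hq *.
have qE : q = A ^+ 2 + Dl * B ^+ 2 by exact: QE.
pose U := 2 * i * A + Dl * (2 * j * B).
pose V := Da * A + Dl * (Db * B).
pose X := (2 * k + 1) * q - V + 2 * U.
have zE : <|z, d|> = <|t1, d|> + U.
  by rewrite /dot az bz /U; ring.
have sE : <|s1 + t1, d|> = V + 2 * <|t1, d|>.
  by rewrite /dot acoordD /V /Da /Db /=; ring.
have hX : `|X| <= 2 * q.
  move: k1 k2 c1 c2 q0; rewrite zE sE /X.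
  have -> : (k + 1) * q = k * q + q by ring.
  have -> : (2 * k + 1) * q = 2 * (k * q) + q by ring.
  set kq := k * q; clearbody kq V U q; clear; lia.
have hU : `|2 * U| <= G * L.
  have b1 (x y : int) : 0 <= x <= h -> `|y| <= Wd -> `|2 * (2 * x * y)| <= 4 * h * Wd.
    move=> /andP[x0 xh] yW; rewrite !normrM (ger0_norm x0) /= !mulrA.
    have -> : 2 * 2 * x * `|y| = 4 * (x * `|y|) by ring.
    by rewrite -mulrA ler_pM2l // ler_pM.
  have := b1 i A _ hAd; have := b1 j B _ hBd; rewrite i0 ih j0 jh => /(_ isT) u2 /(_ isT) u1.
  have -> : 2 * U = 2 * (2 * i * A) + Dl * (2 * (2 * j * B)) by rewrite /U; ring.
  have -> : G * L = L + Dl * L by rewrite GE; ring.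
  apply: (le_trans (ler_normD _ _)); rewrite lerD ?(le_trans u1) //.
  by rewrite normrM (gtr0_norm D0) ler_pM2l // (le_trans u2).
have hV : G * L <= V - 2 * U.
  have : G * L * 1 <= G * L * W by rewrite ler_pM2l ?mulr_gt0 //; lia.
  rewrite (_ : 2 * G * W * L = 2 * (G * L * W)) in prog; last by ring.
  move: hU prog; rewrite -/V; set gl := G * L; set glw := gl * W; clearbody gl glw V U.
  clear; lia.
have hkq : L <= (2 * k + 1) * q.
  have : 2 * L <= G * L by rewrite ler_pM2r.
  move: hX hV hq; rewrite /X; set n := _ * q; set gl := G * L; clearbody n gl V U q.
  clear; lia.
have k0 : 0 < k.
  rewrite ltNge; apply/negP => kn.
  have : (2 * k + 1) * q <= 1 * q by rewrite ler_pM2r //; move: kn; clearbody k; clear; lia.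
  move: hkq hq q0; set n := _ * q; clearbody n q; clear; lia.
have slE : slide d c z = z + d *~ (2 * k + 1).
  by rewrite /slide -/k ifN //; move: k0; clearbody k; clear; lia.
have asl : a (slide d c z) - a s1 = 2 * i - Da + (2 * k + 1) * A.
  by rewrite slE acoordD az pair_mulz /Da /A /acoord /=; ring.
have bsl : (slide d c z).2 - s1.2 = 2 * j - Db + (2 * k + 1) * B.
  rewrite slE pair_mulz.
  have -> : (z + (d.1 * (2 * k + 1), d.2 * (2 * k + 1))).2 = z.2 + B * (2 * k + 1) by [].
  by rewrite bz /Db; ring.
have hn : (2 * k + 1) * q = Da * A + Dl * (Db * B)
    - 2 * (2 * i * A + Dl * (2 * j * B)) + X.
  by rewrite /X /V /U; ring.
have hu : (2 * i) ^+ 2 + Dl * (2 * j) ^+ 2 <= (2 * h * G) ^+ 2.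
  have sq (x : int) : 0 <= x <= h -> (2 * x) ^+ 2 <= (2 * h) ^+ 2.
    by case/andP=> x0 xh; rewrite ler_pXn2r ?nnegrE ?mulr_ge0 // ler_pM2l.
  have u1 : (2 * i) ^+ 2 <= (2 * h) ^+ 2 by rewrite sq // i0.
  have u2 : (2 * j) ^+ 2 <= (2 * h) ^+ 2 by rewrite sq // j0.
  apply: (@le_trans _ _ ((2 * h) ^+ 2 * G)).
    by rewrite GE mulrDr mulr1 [_ * Dl]mulrC lerD // ler_pM2l.
  rewrite [X in _ <= X]exprMn ler_wpM2l ?sqr_ge0 // expr2 ler_peMr; move: G2; clear; lia.
have close (x C Dc : int) : 0 <= x <= h -> C ^+ 2 <= q -> `|C| <= Wd ->
    `|L * C - K * Dc| <= 2 * L -> `|2 * x - Dc + (2 * k + 1) * C| <= r.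
  move=> /andP[x0 xh] Cq CW hC.
  have hG0 : 0 <= 2 * h * G by rewrite !mulr_ge0 //; move: G2; clear; lia.
  have := transport_bound (2 * x) D0 K0 L0 hG0 q0 qE Cq CW hA hB hC hu hX hn.
  set v := `|_ + _|; rewrite -GE ger0_norm ?mulr_ge0 // => hv.
  rewrite -(ler_pM2l kap0) (le_trans _ hr) // -(ler_pM2l K0).
  have m1 : 64 * G * kap * L <= K * L by rewrite ler_pM2r.
  have m2 : K * (24 * G * kap * h) <= K * L by rewrite ler_pM2l.
  have m3 : K * (8 * Wd * kap) <= K * L by rewrite ler_pM2l.
  have m4 : kap * (K * v) <= kap * (2 * L + 2 * L * G
      + K * (2 * x + 2 * (2 * h * G) + 2 * Wd)) by rewrite ler_pM2l.
  have m5 : 0 <= K * kap * (h * G - x).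
    apply: mulr_ge0; first by apply: mulr_ge0; apply: ltW.
    rewrite subr_ge0 (le_trans xh) // ler_peMr //.
    by move: G2; clear; lia.
  have m6 : 2 * (kap * L) <= G * (kap * L) by rewrite ler_pM2r // mulr_gt0.
  have e5 : K * kap * (h * G - x) = K * (G * kap * h) - K * kap * x by ring.
  have e4 : kap * (2 * L + 2 * L * G + K * (2 * x + 2 * (2 * h * G) + 2 * Wd)) =
    2 * (kap * L) + 2 * (G * (kap * L)) + 2 * (K * kap * x)
      + 4 * (K * (G * kap * h)) + 2 * (K * (Wd * kap)) by ring.
  have e1' : 64 * G * kap * L = 64 * (G * (kap * L)) by ring.
  have e2' : K * (24 * G * kap * h) = 24 * (K * (G * kap * h)) by ring.
  have e3' : K * (8 * Wd * kap) = 8 * (K * (Wd * kap)) by ring.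
  have e6 : K * (kap * v) = kap * (K * v) by ring.
  rewrite e5 in m5; rewrite e4 in m4; rewrite e1' in m1; rewrite e2' in m2.
  rewrite e3' in m3; rewrite e6.
  have m7 : 0 < K * L by rewrite mulr_gt0.
  move: m1 m2 m3 m4 m5 m6 m7.
  set x1 := kap * (K * v); set x2 := kap * L; set x3 := G * x2; set x4 := K * kap * x.
  set x5 := K * (G * kap * h); set x6 := K * (Wd * kap); set x7 := K * L.
  clearbody x1 x2 x3 x4 x5 x6 x7; clear; lia.
have Aq : A ^+ 2 <= q by rewrite qE lerDl mulr_ge0 ?sqr_ge0 // ltW.
have Bq : B ^+ 2 <= q.
  rewrite qE; apply: (@le_trans _ _ (Dl * B ^+ 2)); last by rewrite lerDr sqr_ge0.
  by rewrite ler_peMl ?sqr_ge0.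
split=> //.
- by rewrite asl; apply: close => //; rewrite i0.
- by rewrite bsl; apply: close => //; rewrite j0.
- rewrite bsl (_ : _ + _ = 2 * (j + k * B) + (B - Db)); last by ring.
  by rewrite rpredD // dvdz_mulr.
Qed.

End Launch.

Section Exchange.
Variables (T M : int).
Hypothesis D0 : 0 < Disc T M.
Variable R : realType.
Local Notation a := (acoord T).
Local Notation Dl := (Disc T M).
Local Notation "<| x , y |>" := (dot T M x y).
Local Notation Q := (Q T M).
Local Notation w := (@logQ R T M).
Local Notation slab := (slab T M).
Local Notation slide := (slide T M).
Local Notation slab_neg := (slab_neg T M).

Section Config.
Variables (S : seq (int * int)) (ca cb : int) (L : nat).
Hypotheses (uS : uniq S) (cS : centered T S ca cb).
Hypothesis ext : forall s : int * int, s \in S ->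
  `|a s - ca| < 2 * L%:Z /\ `|s.2 - cb| < 2 * L%:Z.

(** The center lies on the positive side of the line, hence the antipode of a
    point of the negative side is on the positive side. *)
Lemma neg_le_pos (d : int * int) (c Wd : int) : d != 0 ->
  `|a d| <= Wd -> `|d.2| <= Wd ->
  2 * (ca * a d + Dl * (cb * d.2)) + 4 * (1 + Dl) * Wd <= 2 * c ->
  (count (slab_neg d c) S <= count (fun z => (0 < slab d c z)%R) S + 16 * L)%N.
Proof.
move=> d0 hA hB hc.
apply: (@leq_trans (count (fun z => (0 < slab d c z)%R) S + count (on_axis T ca cb) S)).
  apply: (count_antipode cS) => // z zS zn _; rewrite /slab_neg in zn.
  have q0 : 0 < Q d := Q_gt0 D0 d0.
  have /andP[_ h1] := slabP D0 c d0 z; have /andP[_ h2] := slabP D0 c d0 (antipode T ca cb z).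
  set k := slab d c z in zn h1; set l := slab _ _ _ in h2 *.
  have {}h1 : c - <|z, d|> < - Q d.
    have : (k + 1) * Q d <= - 1 * Q d by rewrite ler_pM2r //; move: zn; clearbody k; clear; lia.
    move: h1; set n := _ * Q d; clear; lia.
  have e : <|antipode T ca cb z, d|> = 2 * (ca * a d + Dl * (cb * d.2)) - <|z, d|>
     - ((if ca < a z then 0 else 2) * a d + Dl * ((if cb < z.2 then 0 else 2) * d.2)).
    by rewrite /dot antipode_a antipode_b; ring.
  have h3 : (if ca < a z then 0 else 2) * a d + Dl * ((if cb < z.2 then 0 else 2) * d.2)
     >= - (2 * (1 + Dl) * Wd).
    rewrite (_ : - _ = - (2 * Wd) + Dl * - (2 * Wd)); last by ring.
    have Wd0 : 0 <= Wd by apply: le_trans hA.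
    apply: lerD; last rewrite ler_pM2l //.
      by case: ifP => _; move: hA Wd0; clear; lia.
    by case: ifP => _; move: hB Wd0; clear; lia.
  have v0 : 0 <= 2 * (1 + Dl) * Wd.
    have Wd0 : 0 <= Wd by apply: le_trans hA.
    by rewrite !mulr_ge0 // addr_ge0 // ltW.
  rewrite e in h2; move: v0 hc h2 h3; set u := ca * a d + _; set g := (if _ then _ else _) * _ + _.
  have -> : 4 * (1 + Dl) * Wd = 2 * (2 * (1 + Dl) * Wd) by ring.
  set v' := 2 * (1 + Dl) * Wd => v0 hc h2 h3.
  rewrite ltNge; apply/negP => l0.
  have : (l + 1) * Q d <= 1 * Q d by rewrite ler_pM2r //; move: l0; clearbody l; clear; lia.
  move: h1 h2 h3 hc v0; set n := (l + 1) * Q d; clearbody u g v' n.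
  clear; lia.
by rewrite leq_add2l (axis_count D0 uS ext).
Qed.

Lemma swap_posP (d : int * int) (c : int) z :
  z \in swap_pos (slide d c) S (slab_neg d c) -> z \in S /\ 0 < slab d c z.
Proof.
rewrite mem_filter => /andP[/andP[h1 h2] zS]; split=> //.
have : ~~ ((slab d c z == 0) || (slab d c z == - 1)).
  by apply: contraNN h2 => h; rewrite /slide h.
by move: h1; rewrite /slab_neg; clear; lia.
Qed.

(** Points in the slabs up to [L / nu] fill a strip that is thin compared with
    [S]. *)
Lemma near_line_count (d : int * int) (c : int) (nu Bd : nat) : d != 0 -> (0 < nu)%N ->
  Q d <= Bd%:Z ->
  (count (fun z => ~~ (L%:Z <= nu%:Z * (2 * slab d c z - 1))%R)
     (swap_pos (slide d c) S (slab_neg d c)) <= 4 * L * ((L %/ nu).+1 * Bd))%N.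
Proof.
move=> d0 nu0 hq; apply: leq_trans (strip_count D0 uS ext c _ d0).
have q0 : 0 < Q d := Q_gt0 D0 d0.
rewrite -!size_filter uniq_leq_size ?filter_uniq // => z.
rewrite mem_filter => /andP[h /swap_posP[zS k0]]; rewrite mem_filter zS andbT.
have /andP[h1 h2] := slabP D0 c d0 z; move: h k0 h1 h2; set k := slab d c z => h k0 h1 h2.
have kq0 : 0 < k * Q d by rewrite mulr_gt0.
apply/andP; split; first by apply: le_trans h1; apply: ltW.
have : (`|k| <= L %/ nu)%N.
  rewrite leq_divRL //; move: h; rewrite -ltNge.
  have : nu%:Z * k <= nu%:Z * (2 * k - 1).
    by rewrite ler_pM2l ?ltz_nat //; move: k0; clearbody k; clear; lia.
  have -> : nu%:Z * k = (`|k|%N * nu)%N%:Z.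
    by rewrite PoszM gez0_abs ?ltW // mulrC.
  by set x := _ * (_ - _); clear; lia.
move=> kL; have k1 : k + 1 <= (L %/ nu).+1%:Z.
  by move: k0 kL; clearbody k; set m := (L %/ nu)%N; clear; lia.
apply: (lt_le_trans h2); rewrite PoszM.
apply: (@le_trans _ _ ((L %/ nu).+1%:Z * Q d)); first by rewrite ler_pM2r.
by rewrite ler_pM2l.
Qed.

End Config.

(** The constant is the relative gain [L ^ 2 / nu] over the maximal squared
    distance [49 G ^ 3 L ^ 2]. *)
Lemma logQ_gain (G L nu : nat) (z b z' : int * int) : z != b -> (0 < nu)%N -> (0 < G)%N ->
  (0 < L)%N ->
  Q (z - b) <= 49 * G%:Z ^+ 3 * L%:Z ^+ 2 ->
  L%:Z ^+ 2 <= nu%:Z * (Q (z' - b) - Q (z - b)) ->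
  ln (1 + (49 * G%:R ^+ 3 * nu%:R)^-1) <= w z' b - w z b :> R.
Proof.
move=> zb nu0 G0 L0 h1 h2.
have q0 : 0 < Q (z - b) by rewrite Q_gt0 // subr_eq0.
set qa := Q (z - b) in q0 h1 h2; set qb := Q (z' - b) in h2.
rewrite lerBrDr /logQ -/qa -/qb.
have qr : 0 < qa%:~R :> R by rewrite ltr0z.
pose x : R := 49 * G%:R ^+ 3 * nu%:R.
have x0 : 0 < x by rewrite !mulr_gt0 ?exprn_gt0 ?ltr0n.
have ix0 : 0 < x^-1 by rewrite invr_gt0.
rewrite -lnM ?posrE //; last by rewrite addr_gt0.
have le : (1 + x^-1) * qa%:~R <= qb%:~R :> R.
  rewrite mulrDl mul1r -lerBrDl mulrC ler_pdivrMr // /x.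
  have : (qa * 1 <= 49 * G%:Z ^+ 3 * (nu%:Z * (qb - qa))).
    by rewrite mulr1 (le_trans h1) // ler_pM2l // !mulr_gt0 ?exprn_gt0 ?ltz_nat.
  rewrite -(ler_int R) mulr1 => /le_trans; apply.
  have -> : (49 * G%:Z ^+ 3 * (nu%:Z * (qb - qa)))%:~R
      = 49 * G%:R ^+ 3 * (nu%:R * (qb%:~R - qa%:~R)) :> R.
    by rewrite intrM [(_ * (qb - qa))%:~R]intrM intrB intrM rmorphXn.
  by rewrite le_eqVlt; apply/orP; left; apply/eqP; ring.
rewrite ler_ln ?posrE ?mulr_gt0 ?addr_gt0 //.
by apply: lt_le_trans le; rewrite mulr_gt0 ?addr_gt0.
Qed.

End Exchange.

(** * Minimizers are nearly discs *)

Definition center_dist (T M ca cb : int) (z : int * int) : int :=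
  (acoord T z - ca) ^+ 2 + Disc T M * (z.2 - cb) ^+ 2.

Lemma PoszX (n k : nat) : (n ^ k)%N%:Z = n%:Z ^+ k.
Proof. by rewrite -natz natrX natz. Qed.

Section BallExchange.
Variables (T M : int).
Hypothesis D0 : 0 < Disc T M.
Variable R : realType.
Local Notation a := (acoord T).
Local Notation Dl := (Disc T M).
Local Notation "<| x , y |>" := (dot T M x y).
Local Notation Q := (Q T M).
Local Notation Qc := (center_dist T M).
Local Notation slab := (slab T M).
Local Notation slide := (slide T M).
Local Notation slab_neg := (slab_neg T M).

(** Suppose a box around [s1] is full (up to parity), a box around [t1] empty,
    and [s1] farther from the center than [t1] by a definite amount. Slide in
    the direction [s1 - t1]: a positive proportion of the points near [s1] may
    move to the free places near [t1], and each of these moves brings it closer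
    by a definite factor to a positive proportion of [S]. This gain of order
    [L ^ 4] contradicts [slide_gain_small].
    The auxiliary constants are fixed before [L] and give [d] a bounded
    length. *)
Lemma ball_exchange (H kap p2 : nat) : (0 < H)%N -> (0 < kap)%N ->
  exists L0 : nat, forall S (ca cb : int) (L : nat) (s1 t1 : int * int) (r : int),
  (L0 <= L)%N -> uniq S -> minimal T M R S -> centered T S ca cb ->
  (forall s : int * int, s \in S -> `|a s - ca| < 2 * L%:Z /\ `|s.2 - cb| < 2 * L%:Z) ->
  (size S < L ^ 2)%N -> (L ^ 2 <= p2 * size S)%N ->
  (forall z : int * int, (2 %| z.2 - s1.2)%Z -> `|a z - a s1| <= r -> `|z.2 - s1.2| <= r -> z \in S) ->
  (forall z : int * int, (2 %| z.2 - t1.2)%Z -> `|a z - a t1| <= r -> `|z.2 - t1.2| <= r -> z \notin S) ->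
  L%:Z <= kap%:Z * r ->
  `|a s1 - ca| <= 2 * L%:Z -> `|s1.2 - cb| <= 2 * L%:Z ->
  `|a t1 - ca| <= 3 * (1 + Dl) * L%:Z -> `|t1.2 - cb| <= 3 * (1 + Dl) * L%:Z ->
  L%:Z ^+ 2 <= 2 * H%:Z * (Qc ca cb s1 - Qc ca cb t1) -> False.
Proof.
move=> H0 kap0.
have [G GE] : exists G : nat, G%:Z = 1 + Dl by exists `|(1 + Dl)%R|%N; rewrite gez0_abs //; lia.
have G2 : (2 <= G)%N by move: D0 GE; set x := Dl; clearbody x; clear; lia.
(* [W L] bounds the differences of coordinates, [K / L] is the ratio of [d] to
   [s1 - t1], [Wd] and [Bd] bound [d] and [Q d], [L / k2] is the side of the
   grid of free places and [L / nu] the height of the neglected slabs. *)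
have [W WE] : exists n, n = (5 * G)%N by eexists.
have [K KE] : exists n, n = (16 * H ^ 2 * G ^ 2 * W ^ 3 + 64 * G * kap)%N by eexists.
have [Wd WdE] : exists n, n = (K * W + 2)%N by eexists.
have [Bd BdE] : exists n, n = (G * Wd ^ 2)%N by eexists.
have [k2 k2E] : exists n, n = (24 * G * kap + 4 * Wd)%N by eexists.
have [nu nuE] : exists n, n = (128 * k2 ^ 2 * Bd)%N by eexists.
have G0 : (0 < G)%N by apply: ltnW.
have pos_mul (x y : nat) : (0 < x)%N -> (0 < y)%N -> (0 < x * y)%N.
  by move=> x0 y0; rewrite muln_gt0 x0.
have pos_exp (x n : nat) : (0 < x)%N -> (0 < x ^ n)%N by move=> x0; rewrite expn_gt0 x0.
have W0 : (0 < W)%N by rewrite WE pos_mul.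
have K0 : (0 < K)%N by rewrite KE ltn_addl // !pos_mul.
have Wd0 : (0 < Wd)%N by rewrite WdE ltn_addl.
have Bd0 : (0 < Bd)%N by rewrite BdE pos_mul ?pos_exp.
have k20 : (0 < k2)%N by rewrite k2E ltn_addl // pos_mul.
have nu0 : (0 < nu)%N by rewrite nuE !pos_mul ?pos_exp.
pose v : R := ln (1 + (49 * G%:R ^+ 3 * nu%:R)^-1).
have v0 : 0 < v.
  by rewrite ln_gt0 // ltrDl invr_gt0 !mulr_gt0 ?exprn_gt0 ?ltr0n.
have eps0 : 0 < v / (64 * k2%:R ^+ 4) by rewrite divr_gt0 // mulr_gt0 ?exprn_gt0 ?ltr0n.
have [m0 hm0] := slide_gain_small D0 Bd%:Z eps0.
exists (3 * Bd + 8 * Wd * kap + 2 * k2 + nu + 512 * k2 ^ 2 + 2 * Wd + p2 * m0 + 1)%N.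
move=> S ca cb L s1 t1 r hL uS mS cS ext sL Ls inb outb Lr bs1 bs2 bt1 bt2 gap.
have sum7 (x1 x2 x3 x4 x5 x6 x7 l : nat) : (x1 + x2 + x3 + x4 + x5 + x6 + x7 + 1 <= l)%N ->
    [/\ (x1 < l)%N, (x2 <= l)%N, (x3 <= l)%N & (x4 <= l)%N] /\
    [/\ (x5 <= l)%N, (x6 < l)%N, (x7 < l)%N & (0 < l)%N].
  by clear => h; split; split; move: h; lia.
have [[L1 L2 L3 L4] [L5 L6 L7 L8]] := sum7 _ _ _ _ _ _ _ _ hL; clear sum7.
clear hL.
have Lz0 : 0 < L%:Z by rewrite ltz_nat.
have [d [hA hB par]] := @direction_exists T L%:Z K%:Z (a s1 - a t1) (s1.2 - t1.2) Lz0.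
have sum4 (x y : int) : `|x| <= 2 * L%:Z -> `|y| <= 3 * (1 + Dl) * L%:Z ->
    `|x - y| <= W%:Z * L%:Z /\ `|x + y| <= W%:Z * L%:Z.
  have -> : W%:Z * L%:Z = 2 * (G%:Z * L%:Z) + 3 * (1 + Dl) * L%:Z.
    by rewrite -GE WE PoszM; ring.
  have : 1 * L%:Z <= G%:Z * L%:Z by rewrite ler_pM2r // lez_nat; lia.
  set gl := G%:Z * L%:Z; set y' := 3 * _ * _; clear; lia.
have [bDa bFa] := sum4 _ _ bs1 bt1; have [bDb bFb] := sum4 _ _ bs2 bt2.
have eDa : a s1 - ca - (a t1 - ca) = a s1 - a t1 by ring.
have eDb : s1.2 - cb - (t1.2 - cb) = s1.2 - t1.2 by ring.
rewrite eDa in bDa; rewrite eDb in bDb.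
have hK : 16 * H%:Z ^+ 2 * G%:Z ^+ 2 * W%:Z ^+ 3 <= K%:Z.
  by rewrite KE PoszD !(PoszX, PoszM) lerDl.
have PE : Qc ca cb s1 - Qc ca cb t1 = (a s1 - a t1) * (a s1 - ca + (a t1 - ca))
    + Dl * ((s1.2 - t1.2) * (s1.2 - cb + (t1.2 - cb))).
  by rewrite /center_dist; ring.
have Hz0 : 0 < H%:Z by rewrite ltz_nat.
have Wz0 : 0 < W%:Z by rewrite ltz_nat.
have [prog1 prog2] := direction_progress D0 GE Hz0 Wz0 Lz0 hK PE gap bDa bDb bFa bFb hA hB.
have bnd (x y : int) : `|L%:Z * x - K%:Z * y| <= 2 * L%:Z -> `|y| <= W%:Z * L%:Z -> `|x| <= Wd%:Z.
  move=> h1 h2; rewrite -(ler_pM2l Lz0) -{1}[L%:Z]gtr0_norm // -normrM.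
  have h3 : `|K%:Z * y| <= K%:Z * (W%:Z * L%:Z) by rewrite normrM ler_pM.
  have -> : L%:Z * Wd%:Z = K%:Z * (W%:Z * L%:Z) + 2 * L%:Z by rewrite WdE PoszD PoszM; ring.
  move: h1 h3; set x1 := L%:Z * x; set x2 := K%:Z * y; set x3 := K%:Z * (_ * _); clear; lia.
have bA := bnd _ _ hA bDa; have bB := bnd _ _ hB bDb.
have d0 : d != 0.
  apply/eqP => d0; move: prog1; rewrite d0 /acoord /= !(mulr0, addr0) leNgt => /negP; apply.
  by rewrite !mulr_gt0 // ltz_nat; lia.
have dB : Q d <= Bd%:Z.
  have -> : Bd%:Z = (1 + Dl) * Wd%:Z ^+ 2 by rewrite BdE !(PoszX, PoszM) GE.
  by rewrite QE form_le.
pose c := (<|s1 + t1, d|> %/ 2)%Z.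
have cE : 2 * c <= <|s1 + t1, d|> <= 2 * c + 1 by rewrite /c; set n := <|_, _|>; clear; lia.
have [hn hnE] : exists n, n = (L %/ k2)%N by eexists.
have hn1 : (hn * k2 <= L)%N by rewrite hnE leq_trunc_div.
have hn2 : (L <= 2 * k2 * hn)%N.
  have h1 : (L < hn.+1 * k2)%N by rewrite hnE -ltn_divLR.
  have h2 : (1 <= hn)%N by rewrite hnE leq_divRL //; move: L3; clear; lia.
  have : (k2 <= hn * k2)%N by rewrite leq_pmull.
  by move: h1; rewrite mulSn -mulnA [(k2 * hn)%N]mulnC; set y := (hn * k2)%N; clear; lia.
pose A := swap_in (slide d c) S (slab_neg d c).
pose B := swap_pos (slide d c) S (slab_neg d c).
pose A0 := [seq grid T t1 i%:Z j%:Z | i <- iota 0 hn, j <- iota 0 hn].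
have Wdk : (4 * hn * Wd <= L)%N.
  apply: leq_trans hn1; rewrite -mulnA mulnCA leq_mul2l; apply/orP; right.
  by rewrite k2E leq_addl.
have Gkk : (24 * G * kap * hn <= L)%N.
  by apply: leq_trans hn1; rewrite mulnC leq_mul2l k2E leq_addr orbT.
have launchA (i j : nat) : (i <= hn)%N -> (j <= hn)%N ->
    let z := grid T t1 i%:Z j%:Z in
  [/\ 0 < slab d c z, L%:Z <= (2 * slab d c z + 1) * Q d,
      `|a (slide d c z) - a s1| <= r, `|(slide d c z).2 - s1.2| <= r &
      (2 %| (slide d c z).2 - s1.2)%Z].
  move=> hi hj.
  have hK' : 64 * G%:Z * kap%:Z <= K%:Z by rewrite KE PoszD !PoszM lerDr.
  have hq : 3 * Q d < L%:Z.
    by apply: (@le_lt_trans _ _ (3 * Bd%:Z)); [rewrite ler_pM2l|exact: L1].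
  have Gkz : 24 * G%:Z * kap%:Z * hn%:Z <= L%:Z by exact: Gkk.
  have Wdz : 4 * hn%:Z * Wd%:Z <= L%:Z by exact: Wdk.
  have Lz2 : 8 * Wd%:Z * kap%:Z <= L%:Z by exact: L2.
  have hiz : 0 <= i%:Z <= hn%:Z by exact: hi.
  have hjz : 0 <= j%:Z <= hn%:Z by exact: hj.
  have Kz0 : 0 < K%:Z by [].
  have Wz1 : 1 <= W%:Z by [].
  have kz0 : 0 < kap%:Z by [].
  exact: (launch D0 GE Lz0 Kz0 Wz1 kz0 d0 hA hB par bA bB cE prog1 hK' Lr Gkz Wdz hq Lz2 hiz hjz).
have r_ge : 2 * hn%:Z <= r.
  rewrite -(ler_pM2l (_ : 0 < kap%:Z)) ?ltz_nat // (le_trans _ Lr) //.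
  have : (2 * (kap * hn) <= L)%N.
    apply: leq_trans Gkk; rewrite -!mulnA leq_mul //.
    by rewrite leq_pmull //; move: G2; clear; lia.
  by rewrite mulrCA -!PoszM lez_nat.
have A0A : {subset A0 <= A}.
  move=> _ /allpairsP[[i j] [/= + + ->]]; rewrite !mem_iota !add0n /= => hi hj.
  have [k0 _ ha hb hp] := launchA i j (ltnW hi) (ltnW hj).
  rewrite swap_inP; last exact: slideK.
  apply/and3P; split.
  - apply: outb; rewrite ?acoord_grid ?snd_grid.
    + by rewrite addrAC subrr add0r dvdz_mulr.
    + by rewrite addrAC subrr add0r; move: r_ge hi; clear; lia.
    + by rewrite addrAC subrr add0r; move: r_ge hj; clear; lia.
  - exact: inb.
  - rewrite /slab_neg slab_slide //; first by move: k0; set k := slab _ _ _; clear; lia.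
    apply/eqP => e; have := slab_slide D0 d0 (c := c) (z := grid T t1 i%:Z j%:Z).
    rewrite /slide ifN in e; last by move: k0; set k := slab _ _ _; clear; lia.
    have := congr1 (slab d c) e; rewrite slab_shift //.
    by move: k0; set k := slab _ _ _; clear; lia.
have uA0 : uniq A0.
  apply: allpairs_uniq; rewrite ?iota_uniq // => -[i j] [i' j'] _ _ /= e.
  have := congr1 a e; have := congr1 snd e; rewrite !acoord_grid !snd_grid.
  move=> h1 h2; congr pair; [move: h2|move: h1]; clear; lia.
have sA0 : size A0 = (hn * hn)%N by rewrite size_allpairs !size_iota.
(* [c] exceeds the level of the center by enough to absorb the defect of
   the central symmetry. *)
have mid : 2 * (ca * a d + Dl * (cb * d.2)) + 4 * (1 + Dl) * Wd%:Z <= 2 * c.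
  have : <|s1 + t1, d|> = (a s1 - ca + (a t1 - ca)) * a d +
      Dl * ((s1.2 - cb + (t1.2 - cb)) * d.2) + 2 * (ca * a d + Dl * (cb * d.2)).
    by rewrite /dot acoordD /=; ring.
  move: cE prog2 => /andP[_ cE2]; rewrite -GE.
  have : 4 * G%:Z * Wd%:Z + 1 <= 2 * G%:Z * W%:Z * L%:Z.
    have : (4 * G * Wd + 1 <= 2 * G * W * L)%N.
      apply: (@leq_trans (2 * G * 1 * L)%N); last by rewrite !leq_mul.
      rewrite muln1; have : (2 * G * (2 * Wd + 1) <= 2 * G * L)%N.
        by rewrite leq_mul //; move: L6; clear; lia.
      rewrite mulnDr muln1 mulnA; set x := (2 * G * 2 * Wd)%N.
      have -> : (4 * G * Wd = x)%N by rewrite /x; ring.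
      move: G2; clear; lia.
    by rewrite -lez_nat PoszD !PoszM.
  move: cE2; set x1 := <|_, _|>; set x2 := _ + Dl * (_ * d.2); set x3 := _ + Dl * (_ * d.2).
  set x4 := 2 * _ * _ * _; set x5 := 4 * _ * _; clear; lia.
have sAB : (size A <= size B + 16 * L)%N.
  by apply: (swap_in_size D0 uS d0 (neg_le_pos D0 uS cS ext d0 bA bB mid)).
have A0s : (hn * hn <= size A)%N by rewrite -sA0 uniq_leq_size.
pose far z := L%:Z <= nu%:Z * (2 * slab d c z - 1).
have hfar : (size B <= count far B + 4 * L * ((L %/ nu).+1 * Bd))%N.
  rewrite -(count_predC far B) leq_add2l.
  exact: (near_line_count D0 uS ext).
have count_far : (L ^ 2 <= 8 * k2 ^ 2 * count far B)%N.
  have h1 : (L ^ 2 <= 4 * k2 ^ 2 * (hn * hn))%N.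
    have -> : (4 * k2 ^ 2 * (hn * hn) = (2 * k2 * hn) ^ 2)%N by ring.
    by rewrite leq_exp2r.
  have h2 : (4 * L * (32 * k2 ^ 2 * ((L %/ nu).+1 * Bd)) <= 2 * (L * L))%N.
    have -> : (32 * k2 ^ 2 * ((L %/ nu).+1 * Bd) = 32 * k2 ^ 2 * Bd * (L %/ nu).+1)%N by ring.
    have : (4 * (32 * k2 ^ 2 * Bd * (L %/ nu).+1) <= 2 * L)%N.
      rewrite mulnA (_ : (4 * (32 * k2 ^ 2 * Bd) = nu)%N); last by rewrite nuE; ring.
      rewrite mulnS mul2n -addnn leq_add // mulnC leq_trunc_div //.
    rewrite -(leq_pmul2l L8) => /leq_trans h; apply: leq_trans (h _ _).
      by rewrite leq_eqVlt; apply/orP; left; apply/eqP; ring.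
    by rewrite leq_eqVlt; apply/orP; left; apply/eqP; ring.
  have h3 : (512 * k2 ^ 2 * L <= L * L)%N by rewrite leq_mul.
  have h4 : (32 * k2 ^ 2 * (hn * hn) <= 32 * k2 ^ 2 * (count far B +
       4 * L * ((L %/ nu).+1 * Bd) + 16 * L))%N.
    rewrite leq_mul // (leq_trans A0s) // (leq_trans sAB) // leq_add2r //.
  have e4 : (32 * k2 ^ 2 * (count far B + 4 * L * ((L %/ nu).+1 * Bd) + 16 * L) =
    4 * (8 * k2 ^ 2 * count far B) + 4 * L * (32 * k2 ^ 2 * ((L %/ nu).+1 * Bd))
      + 512 * k2 ^ 2 * L)%N by ring.
  have e1' : (32 * k2 ^ 2 * (hn * hn) = 8 * (4 * k2 ^ 2 * (hn * hn)))%N by ring.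
  have e5 : (L ^ 2 = L * L)%N by ring.
  rewrite e1' e4 in h4; rewrite e5 in h1 *.
  move: h1 h2 h3 h4; set x1 := (L * L)%N; set x2 := (4 * k2 ^ 2 * _)%N.
  set x3 := (8 * k2 ^ 2 * _)%N; set x4 := (4 * L * _)%N; set x5 := (512 * _ * _)%N.
  clear; lia.
have gain_ge : (hn * hn)%:R * (count far B)%:R * v <= slide_gain T M R S d c.
  rewrite -sA0; apply: double_sum_ge => //.
  - exact: ltW.
  - move=> x y; rewrite swap_inP; last exact: slideK.
    case/and3P=> xS txS xn /swap_posP[yS ky].
    have kx : 0 < slab d c x.
      have tx : slide d c x != x by apply: contraNneq xS => <-.
      by move: xn; rewrite /slab_neg slab_slide //; set k := slab _ _ _; clear; lia.
    rewrite subr_ge0 ltW // logQ_lt //; first by apply: contraNneq xS => ->.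
    rewrite -subr_gt0 (lt_le_trans _ (Q_slide_gain D0 d0 kx ky)) // !mulr_gt0 ?Q_gt0 //.
      by move: kx; set k := slab _ _ _; clear; lia.
    by move: ky; set k := slab _ _ _; clear; lia.
  - move=> _ y /allpairsP[[i j] [/= + + ->]] yB fy; rewrite !mem_iota !add0n /= => hi hj.
    have zA : grid T t1 i j \in A by apply: A0A; apply: allpairs_f; rewrite mem_iota.
    set z := grid T t1 i j in zA *.
    have [k0 kL _ _ _] := launchA i j (ltnW hi) (ltnW hj).
    have [yS ky] := swap_posP yB.
    have zS : z \notin S by move: zA; rewrite swap_inP; [case/and3P|exact: slideK].
    apply: (@logQ_gain T M D0 R G L nu z y (slide d c z)) => //.
    + by apply: contraNneq zS => ->.
    + have [y1 y2] := ext y yS.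
      have hnL : (hn <= L)%N by apply: leq_trans hn1; rewrite leq_pmulr.
      have sq (x x' x'' : int) (i' : nat) : `|x| <= 3 * (1 + Dl) * L%:Z -> `|x'| < 2 * L%:Z -> (i' < hn)%N ->
          x'' = x + 2 * i'%:Z - x' ->
          x'' ^+ 2 <= (7 * G%:Z * L%:Z) ^+ 2.
        move=> hx hx' hi' ->; rewrite -[leLHS]real_normK ?num_real //.
        rewrite ler_pXn2r ?nnegrE // -GE in hx *.
        have : 1 * L%:Z <= G%:Z * L%:Z by rewrite ler_pM2r // lez_nat.
        move: hx hx'; rewrite -!mulrA; set gl := G%:Z * L%:Z; move: hi' hnL; clear; lia.
      have -> : 49 * G%:Z ^+ 3 * L%:Z ^+ 2 = (7 * G%:Z * L%:Z) ^+ 2 + Dl * (7 * G%:Z * L%:Z) ^+ 2.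
        have -> : Dl = G%:Z - 1 by rewrite GE; ring.
        ring.
      rewrite QE lerD // ?ler_pM2l //.
        apply: (sq _ _ _ i bt1 y1 hi); rewrite acoordB acoord_grid; ring.
      apply: (sq _ _ _ j bt2 y2 hj); rewrite (_ : (z - y).2 = z.2 - y.2) // snd_grid.
      by ring.
    + apply: (@le_trans _ _ (nu%:Z * ((2 * slab d c z + 1) * (2 * slab d c y - 1) * Q d))).
        rewrite expr2 (_ : nu%:Z * _ = ((2 * slab d c z + 1) * Q d) * (nu%:Z * (2 * slab d c y - 1))); last by ring.
        by rewrite ler_pM.
      by rewrite ler_pM2l ?ltz_nat // Q_slide_gain.
have := hm0 S d c uS mS d0 dB.
have -> : (m0 <= size S)%N.
  rewrite leqNgt; apply/negP => sm.
  have : (p2 * size S <= p2 * m0)%N by rewrite leq_mul // ltnW.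
  have : (L * 1 <= L * L)%N by rewrite leq_mul.
  have : (L ^ 2 = L * L)%N by ring.
  move: Ls L7; set x1 := (p2 * _)%N; set x2 := (p2 * _)%N; set x3 := (L ^ 2)%N; set x4 := (L * L)%N.
  clear; lia.
move=> /(_ isT) gain_le.
have kR : 0 < k2%:R :> R by rewrite ltr0n.
have LR : 0 < L%:R :> R by rewrite ltr0n.
have s2 : (size S)%:R ^+ 2 <= (L%:R ^+ 2) ^+ 2 :> R.
  by rewrite ler_pXn2r ?nnegrE ?exprn_ge0 ?ler0n // -natrX ler_nat ltnW.
have u1 : L%:R ^+ 2 <= 4 * k2%:R ^+ 2 * (hn * hn)%:R :> R.
  have -> : 4 * k2%:R ^+ 2 * (hn * hn)%:R = (2 * k2%:R * hn%:R) ^+ 2 :> R by rewrite natrM; ring.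
  by rewrite ler_pXn2r ?nnegrE ?mulr_ge0 ?ler0n // -!natrM ler_nat.
have u2 : L%:R ^+ 2 <= 8 * k2%:R ^+ 2 * (count far B)%:R :> R.
  by rewrite -!natrX -!natrM ler_nat.
have u3 : (L%:R ^+ 2) ^+ 2 <= 32 * k2%:R ^+ 4 * ((hn * hn)%:R * (count far B)%:R) :> R.
  have -> : 32 * k2%:R ^+ 4 * ((hn * hn)%:R * (count far B)%:R) =
    (4 * k2%:R ^+ 2 * (hn * hn)%:R) * (8 * k2%:R ^+ 2 * (count far B)%:R) :> R by ring.
  by rewrite [leLHS]expr2; apply: ler_pM => //; apply: exprn_ge0; exact: ltW.
have u4 : (hn * hn)%:R * (count far B)%:R * v <= v / (64 * k2%:R ^+ 4) * (L%:R ^+ 2) ^+ 2.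
  by rewrite (le_trans gain_ge) // (le_trans gain_le) // ler_wpM2l // ltW.
have e64 : 0 < 64 * k2%:R ^+ 4 :> R by rewrite mulr_gt0 ?exprn_gt0.
have u5 : (hn * hn)%:R * (count far B)%:R * v * (64 * k2%:R ^+ 4) <= (L%:R ^+ 2) ^+ 2 * v.
  rewrite -ler_pdivlMr //; apply: (le_trans u4).
  by rewrite le_eqVlt; apply/orP; left; apply/eqP; rewrite mulrC mulrA.
have u6 : (L%:R ^+ 2) ^+ 2 * v <= 32 * k2%:R ^+ 4 * ((hn * hn)%:R * (count far B)%:R) * v.
  by rewrite ler_pM2r.
have u7 : 0 < (L%:R ^+ 2) ^+ 2 * v by rewrite mulr_gt0 // !exprn_gt0.
have e7 : (hn * hn)%:R * (count far B)%:R * v * (64 * k2%:R ^+ 4) =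
  2 * (32 * k2%:R ^+ 4 * ((hn * hn)%:R * (count far B)%:R) * v) by ring.
rewrite e7 in u5; move: u5 u6 u7.
set X := 32 * _ * _ * v; set Y := _ * v; clear; lra.
Qed.

End BallExchange.

Section DiscProperty.
Variables (T M : int).
Hypothesis D0 : 0 < Disc T M.
Variable R : realType.
Local Notation a := (acoord T).
Local Notation Dl := (Disc T M).
Local Notation Qc := (center_dist T M).

Lemma abs_sign (x : int) : exists s : int, (s = 1 \/ s = - 1) /\ x = s * `|x|.
Proof. by have [h|h] := leP 0 x; [exists 1|exists (- 1)]; lia. Qed.

(** Moving [s0] towards the center along both axes by a small multiple of
    [L] gives the center [s1] of a box inside [S] by [box_in]; moving [t0]
    outwards gives the center of a box outside [S]. Only a small part of the
    difference of squared distances is lost, and [ball_exchange] applies. *)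
Lemma disc_property (H p2 : nat) : (0 < H)%N ->
  exists L0 : nat, forall S (ca cb : int) (L : nat) (s0 t0 : int * int),
  (L0 <= L)%N -> uniq S -> minimal T M R S -> centered T S ca cb ->
  (forall s : int * int, s \in S -> `|a s - ca| < 2 * L%:Z /\ `|s.2 - cb| < 2 * L%:Z) ->
  (size S < L ^ 2)%N -> (L ^ 2 <= p2 * size S)%N ->
  s0 \in S -> L%:Z <= H%:Z * `|a s0 - ca| -> L%:Z <= H%:Z * `|s0.2 - cb| ->
  t0 \notin S -> H%:Z * (Qc ca cb s0 - Qc ca cb t0) < L%:Z ^+ 2.
Proof.
move=> H0.
have [G GE] : exists G : nat, G%:Z = 1 + Dl by exists `|(1 + Dl)%R|%N; rewrite gez0_abs //; lia.
have G2 : (2 <= G)%N by move: D0 GE; set x := Dl; clearbody x; clear; lia.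
have G0 : (0 < G)%N by apply: ltnW.
have [kap kapE] : exists n, n = (40 * H * G ^ 2)%N by eexists.
have kap0 : (0 < kap)%N by rewrite kapE !muln_gt0 H0 G0.
have [L0 hL0] := @ball_exchange T M D0 R H kap p2 H0 kap0.
exists (L0 + 4 * kap)%N => S ca cb L s0 t0 LL uS mS cS ext sL Ls s0S sa sb t0S.
have LL0 : (L0 <= L)%N by apply: leq_trans LL; rewrite leq_addr.
have L4 : (4 * kap <= L)%N by apply: leq_trans LL; rewrite leq_addl.
rewrite ltNge; apply/negP => gap.
have [h hE] : exists n, n = (L %/ kap)%N by eexists.
have h1 : (kap * h <= L)%N by rewrite hE mulnC leq_trunc_div.
have h2 : (L < kap * h + kap)%N by rewrite -mulnSr hE mulnC -ltn_divLR.
have h3 : (40 * (H * h) * G ^ 2 <= L)%N by apply: leq_trans h1; rewrite kapE leq_eqVlt; apply/orP; left; apply/eqP; ring.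
have h4 : (40 * (H * h) <= L)%N by apply: leq_trans h3; rewrite leq_pmulr // expn_gt0 G0.
have hHh : (h <= H * h)%N by rewrite leq_pmull.
have h5 : (h <= L)%N by apply: leq_trans h1; rewrite leq_pmull.
have far4 (x : int) : L%:Z <= H%:Z * `|x| -> 4 * h%:Z <= `|x|.
  move=> hx; rewrite -(ler_pM2l (_ : 0 < H%:Z)) // (le_trans _ hx) //.
  have -> : H%:Z * (4 * h%:Z) = (4 * (H * h))%N%:Z by rewrite !PoszM; ring.
  by rewrite lez_nat; move: h4; set y := (H * h)%N; clear; lia.
have sa4 := far4 _ sa; have sb4 := far4 _ sb.
have [e1a e2a] := ext s0 s0S.
have Lz0 : 0 < L%:Z by rewrite ltz_nat; move: L4 kap0; clear; lia.
have Gz : 1 <= G%:Z by [].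
have gl : L%:Z <= G%:Z * L%:Z by rewrite ler_peMl // ltW.
have hz0 : 0 <= h%:Z by [].
(* [t0] is closer to the center than [s0], so it obeys similar bounds. *)
have tbound : `|a t0 - ca| <= 2 * (G%:Z * L%:Z) /\ `|t0.2 - cb| <= 2 * (G%:Z * L%:Z).
  have Qs : Qc ca cb s0 <= (2 * (G%:Z * L%:Z)) ^+ 2.
    apply: (@le_trans _ _ (G%:Z * (2 * L%:Z) ^+ 2)); first by rewrite GE form_le // ltW.
    have -> : (2 * (G%:Z * L%:Z)) ^+ 2 = G%:Z * (G%:Z * (2 * L%:Z) ^+ 2) by ring.
    by rewrite ler_peMl // mulr_ge0 ?sqr_ge0.
  have Qt : Qc ca cb t0 <= Qc ca cb s0.
    rewrite -subr_ge0 -(pmulr_rge0 _ (_ : 0 < H%:Z)) // (le_trans _ gap) //.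
  have Q2 := le_trans Qt Qs.
  split; apply: sqr_le_abs; rewrite ?mulr_ge0 //; apply: le_trans Q2.
    by rewrite lerDl mulr_ge0 ?sqr_ge0 // ltW.
  rewrite /center_dist; apply: (@le_trans _ _ (Dl * (t0.2 - cb) ^+ 2)); last by rewrite lerDr sqr_ge0.
  by rewrite ler_peMl ?sqr_ge0.
have [ta tb] := tbound.
have [sga [sga1 sgaE]] := abs_sign (a s0 - ca); have [sgb [sgb1 sgbE]] := abs_sign (s0.2 - cb).
have [tga [tga1 tgaE]] := abs_sign (a t0 - ca); have [tgb [tgb1 tgbE]] := abs_sign (t0.2 - cb).
pose s1 := grid T s0 (- (h%:Z * sga)) (- (h%:Z * sgb)).
pose t1 := grid T t0 (h%:Z * tga) (h%:Z * tgb).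
have as1 : a s1 = a s0 - 2 * (h%:Z * sga) by rewrite acoord_grid; ring.
have bs1 : s1.2 = s0.2 - 2 * (h%:Z * sgb) by rewrite snd_grid; ring.
have at1 : a t1 = a t0 + 2 * (h%:Z * tga) by rewrite acoord_grid.
have bt1 : t1.2 = t0.2 + 2 * (h%:Z * tgb) by rewrite snd_grid.
have shift_in (x c y x' s : int) : s = 1 \/ s = - 1 -> x - c = s * `|x - c| ->
    4 * h%:Z <= `|x - c| -> x' = x - 2 * (h%:Z * s) -> `|y - x'| <= 2 * h%:Z - 2 ->
    `|y - c| <= `|x - c| - 2.
  by move=> hs; clear -hs; case: hs => ->; lia.
have shift_out (x c y x' s : int) : s = 1 \/ s = - 1 -> x - c = s * `|x - c| ->
    x' = x + 2 * (h%:Z * s) -> `|y - x'| <= 2 * h%:Z - 2 ->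
    `|x - c| <= `|y - c| - 2.
  by move=> hs; clear -hs; case: hs => ->; lia.
have abs_in (x c x' s : int) : s = 1 \/ s = - 1 -> x - c = s * `|x - c| ->
    4 * h%:Z <= `|x - c| -> x' = x - 2 * (h%:Z * s) -> `|x' - c| = `|x - c| - 2 * h%:Z.
  by move=> hs; clear -hs; case: hs => ->; lia.
have abs_out (x c x' s : int) : s = 1 \/ s = - 1 -> x - c = s * `|x - c| ->
    x' = x + 2 * (h%:Z * s) -> `|x' - c| = `|x - c| + 2 * h%:Z.
  by move=> hs; clear -hs; case: hs => ->; lia.
have As1 := abs_in _ _ _ _ sga1 sgaE sa4 as1; have Bs1 := abs_in _ _ _ _ sgb1 sgbE sb4 bs1.
have At1 := abs_out _ _ _ _ tga1 tgaE at1; have Bt1 := abs_out _ _ _ _ tgb1 tgbE bt1.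
apply: (hL0 S ca cb L s1 t1 (2 * h%:Z - 2) LL0 uS mS cS ext sL Ls).
- move=> z zp za zb; apply: (box_in cS s0S).
  + have -> : z.2 - s0.2 = (z.2 - s1.2) - 2 * (h%:Z * sgb) by rewrite bs1; ring.
    by rewrite rpredB // dvdz_mulr.
  + exact: shift_in sga1 sgaE sa4 as1 za.
  + exact: shift_in sgb1 sgbE sb4 bs1 zb.
- move=> z zp za zb; apply: contra t0S => zS; apply: (box_in cS zS).
  + have -> : t0.2 - z.2 = - ((z.2 - t1.2) + 2 * (h%:Z * tgb)) by rewrite bt1; ring.
    by rewrite rpredN rpredD // dvdz_mulr.
  + exact: shift_out tga1 tgaE at1 za.
  + exact: shift_out tgb1 tgbE bt1 zb.
- have -> : kap%:Z * (2 * h%:Z - 2) = 2 * (kap * h)%N%:Z - 2 * kap%:Z by rewrite PoszM; ring.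
  by move: h2 L4; set x := (kap * h)%N; clear; lia.
- by rewrite As1; move: e1a hz0; clear; lia.
- by rewrite Bs1; move: e2a hz0; clear; lia.
- rewrite At1 -GE -mulrA; move: ta gl h4 hHh.
  set x := (H * h)%N; set y := G%:Z * _; clear; lia.
- rewrite Bt1 -GE -mulrA; move: tb gl h4 hHh.
  set x := (H * h)%N; set y := G%:Z * _; clear; lia.
have QcE z : Qc ca cb z = `|a z - ca| ^+ 2 + Dl * `|z.2 - cb| ^+ 2.
  by rewrite !real_normK ?num_real.
have inner (x : int) : 0 <= x < 2 * L%:Z -> - (8 * (h%:Z * L%:Z)) <= (x - 2 * h%:Z) ^+ 2 - x ^+ 2.
  case/andP=> x0 xL; have -> : (x - 2 * h%:Z) ^+ 2 - x ^+ 2 = 4 * h%:Z ^+ 2 - 4 * (h%:Z * x) by ring.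
  have : h%:Z * x <= h%:Z * (2 * L%:Z) by rewrite ler_wpM2l // ltW.
  have : 0 <= h%:Z ^+ 2 by rewrite sqr_ge0.
  rewrite mulrCA; set x1 := h%:Z * x; set x2 := h%:Z * L%:Z; set x3 := h%:Z ^+ 2; clear; lia.
have outer (x : int) : 0 <= x <= 2 * (G%:Z * L%:Z) ->
    (x + 2 * h%:Z) ^+ 2 - x ^+ 2 <= 12 * (h%:Z * (G%:Z * L%:Z)).
  case/andP=> x0 xL; have -> : (x + 2 * h%:Z) ^+ 2 - x ^+ 2 = 4 * (h%:Z * h%:Z) + 4 * (h%:Z * x) by ring.
  have m1 : h%:Z * x <= h%:Z * (2 * (G%:Z * L%:Z)) by rewrite ler_wpM2l.
  have m2 : h%:Z * h%:Z <= h%:Z * (G%:Z * L%:Z) by rewrite ler_wpM2l // (le_trans _ gl).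
  move: m1 m2; rewrite mulrCA; set x1 := h%:Z * x; set x2 := h%:Z * _; set x3 := h%:Z * h%:Z; clear; lia.
have i1 := inner _ (introT andP (conj (normr_ge0 _) e1a)).
have i2 := inner _ (introT andP (conj (normr_ge0 _) e2a)).
have o1 := outer _ (introT andP (conj (normr_ge0 _) ta)).
have o2 := outer _ (introT andP (conj (normr_ge0 _) tb)).
have diff : Qc ca cb s0 - Qc ca cb t0 - 20 * (h%:Z * (G%:Z ^+ 2 * L%:Z)) <= Qc ca cb s1 - Qc ca cb t1.
  rewrite !QcE As1 Bs1 At1 Bt1.
  have D1 : 0 <= Dl by apply: ltW.
  have i2' : - (Dl * (8 * (h%:Z * L%:Z))) <=
      Dl * (`|s0.2 - cb| - 2 * h%:Z) ^+ 2 - Dl * `|s0.2 - cb| ^+ 2.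
    by rewrite -mulrN -mulrBr ler_wpM2l.
  have o2' : Dl * (`|t0.2 - cb| + 2 * h%:Z) ^+ 2 - Dl * `|t0.2 - cb| ^+ 2 <=
      Dl * (12 * (h%:Z * (G%:Z * L%:Z))) by rewrite -mulrBr ler_wpM2l.
  have -> : 20 * (h%:Z * (G%:Z ^+ 2 * L%:Z)) = 8 * (h%:Z * (G%:Z * L%:Z)) * G%:Z + 12 * (h%:Z * (G%:Z * L%:Z)) * G%:Z by ring.
  have g1 : 8 * (h%:Z * L%:Z) * G%:Z <= 8 * (h%:Z * (G%:Z * L%:Z)) * G%:Z.
    by rewrite ler_pM2r // ler_pM2l // ler_wpM2l.
  have g2 : 8 * (h%:Z * L%:Z) * G%:Z = 8 * (h%:Z * L%:Z) + Dl * (8 * (h%:Z * L%:Z)) by rewrite GE; ring.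
  have g3 : 12 * (h%:Z * (G%:Z * L%:Z)) * G%:Z = 12 * (h%:Z * (G%:Z * L%:Z)) + Dl * (12 * (h%:Z * (G%:Z * L%:Z))).
    by rewrite {2}GE; ring.
  have lin (x1 x2 x3 x4 y1 y2 y3 y4 z1 z2 z3 z4 z5 z6 : int) :
    - z1 <= x1 - x2 -> y1 - y2 <= z2 -> - z3 <= x3 - x4 -> y3 - y4 <= z4 ->
    z1 + z3 <= z5 -> z6 = z2 + z4 ->
    x2 + x4 - (y2 + y4) - (z5 + z6) <= x1 + x3 - (y1 + y3) by clear; lia.
  by apply: lin i1 o1 i2' o2' _ g3; rewrite -g2.
rewrite -(ler_pM2l (_ : 0 < 2 * H%:Z)) ?mulr_gt0 // in diff.
apply: le_trans diff.
have small : 40 * (H%:Z * h%:Z) * G%:Z ^+ 2 * L%:Z <= L%:Z * L%:Z.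
  by rewrite ler_pM2r // -PoszX -!PoszM.
have -> : 2 * H%:Z * (Qc ca cb s0 - Qc ca cb t0 - 20 * (h%:Z * (G%:Z ^+ 2 * L%:Z))) =
  2 * (H%:Z * (Qc ca cb s0 - Qc ca cb t0)) - 40 * (H%:Z * h%:Z) * G%:Z ^+ 2 * L%:Z by ring.
move: gap small; rewrite expr2; set x1 := H%:Z * _; set x2 := _ * L%:Z; set x3 := _ * L%:Z.
clear; lia.
Qed.

End DiscProperty.

(** * Two discs whose numbers of lattice points differ by two *)

Section TwoPoint.
Variable R : realType.

Lemma common_radius (I : eqType) (s : seq I) (P : I -> R -> Prop) :
  (forall i, exists2 e0 : R, 0 < e0 & forall e, 0 < e -> e < e0 -> P i e) ->
  exists2 e0 : R, 0 < e0 & forall e i, i \in s -> 0 < e -> e < e0 -> P i e.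
Proof.
move=> H; elim: s => [|i s [e1 e10 IH]]; first by exists 1.
have [e2 e20 h] := H i; exists (Num.min e1 e2); first by rewrite lt_min e10.
move=> e j; rewrite inE lt_min => /orP[/eqP -> e0 /andP[_ le]|js e0 /andP[le _]].
  exact: h.
exact: IH.
Qed.

(** As [e] tends to [0] from above the sign of a quadratic is that of its
    constant term, and if this vanishes that of its linear term. *)
Lemma quadratic_sign (c l k : R) : 0 < k -> exists2 e0 : R, 0 < e0 &
  forall e, 0 < e -> e < e0 -> c - 2 * e * l + e ^+ 2 * k != 0 /\
    (c - 2 * e * l + e ^+ 2 * k < 0 <-> c < 0 \/ c = 0 /\ 0 < l).
Proof.
move=> k0; have [->|c0] := eqVneq c 0.
  have [l0|l0] := ltP 0 l.
    exists (l / k); first by rewrite divr_gt0.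
    move=> e e0; rewrite ltr_pdivlMr // => h.
    have h2 : 0 - 2 * e * l + e ^+ 2 * k < 0.
      have -> : 0 - 2 * e * l + e ^+ 2 * k = e * (e * k - 2 * l) by ring.
      by rewrite pmulr_rlt0 //; lra.
    by split; [rewrite lt_eqF|split=> // _; right].
  exists 1 => // e e0 _.
  have h2 : 0 < 0 - 2 * e * l + e ^+ 2 * k.
    have -> : 0 - 2 * e * l + e ^+ 2 * k = e * (e * k - 2 * l) by ring.
    by rewrite mulr_gt0 // subr_gt0 (le_lt_trans (_ : _ <= 0)) ?mulr_gt0 //; lra.
  split; first by rewrite gt_eqF.
  split=> [h|[|[_ h]]]; first by move: (lt_trans h2 h); rewrite ltxx.
    by rewrite ltxx.
  by [].
pose m := 2 * `|l| + k; have m0 : 0 < m by rewrite ltr_wpDl // mulr_ge0.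
have c0' : 0 < `|c| by rewrite normr_gt0.
exists (Num.min 1 (`|c| / m)); first by rewrite lt_min ltr01 divr_gt0.
move=> e e0; rewrite lt_min => /andP[e1]; rewrite ltr_pdivlMr // => h.
have small : `|- 2 * e * l + e ^+ 2 * k| < `|c|.
  apply: le_lt_trans h; apply: (le_trans (ler_normD _ _)).
  rewrite !normrM (gtr0_norm e0) (gtr0_norm k0) normrN (@ger0_norm _ 2) //.
  have : e * (e * k) <= 1 * (e * k) by rewrite ler_pM2r ?mulr_gt0 // ltW.
  by rewrite /m; move: `|l| => x; lra.
move: small; have -> : c - 2 * e * l + e ^+ 2 * k = c + (- 2 * e * l + e ^+ 2 * k) by ring.
set x := _ + _ * k; rewrite ltr_norml => /andP[h1 h2].
have [cn|cp] := ltP c 0.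
  rewrite ltr0_norm // in h1 h2; have xn : c + x < 0 by lra.
  by split; [rewrite lt_eqF|split=> // _; left].
have cp' : 0 < c by rewrite lt_neqAle eq_sym c0.
rewrite gtr0_norm // in h1 h2; have xp : 0 < c + x by lra.
split; first by rewrite gt_eqF.
split=> [/(lt_trans xp)|[|[e']]]; rewrite ?ltxx //.
by move: cp'; rewrite e' ltxx.
Qed.

Lemma linear_nonzero (x k : R) : 0 < k -> exists2 e0 : R, 0 < e0 &
  forall e, 0 < e -> e < e0 -> x + k * e != 0 /\ x - k * e != 0.
Proof.
move=> k0; have [->|x0] := eqVneq x 0.
  exists 1 => // e e0 _; rewrite add0r sub0r oppr_eq0.
  by rewrite mulf_neq0 // gt_eqF.
have x0' : 0 < `|x| by rewrite normr_gt0.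
exists (`|x| / k); first by rewrite divr_gt0.
move=> e e0; rewrite ltr_pdivlMr // mulrC => h; have ke : 0 < k * e by rewrite mulr_gt0.
split; apply/eqP => e'.
  by move: h; rewrite (_ : x = - (k * e)) ?normrN ?gtr0_norm ?ltxx //; lra.
by move: h; rewrite (_ : x = k * e) ?gtr0_norm ?ltxx //; lra.
Qed.

Variable D : R.
Hypothesis D1 : 1 <= D.
Let D0 : 0 < D. Proof. exact: lt_le_trans D1. Qed.

(** The circle of squared radius [X] centered at [(g, height X g)] passes through
    the lattice points [(0, 0)] and [(2 g, 0)]. *)
Definition height (X : R) (g : R) : R := Num.sqrt ((X - g ^+ 2) / D).

Lemma heightE X g : g ^+ 2 <= X -> D * height X g ^+ 2 = X - g ^+ 2.
Proof.
move=> h; rewrite sqr_sqrtr; last by rewrite divr_ge0 ?subr_ge0 // ltW.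
by rewrite mulrCA divff ?mulr1 // gt_eqF.
Qed.

Lemma height_ge0 X g : 0 <= height X g. Proof. exact: sqrtr_ge0. Qed.

(** No lattice point lies on the arc of that circle opposite to the chord. *)
Definition opposite_free (X : R) (g : int) : Prop := forall U b : int,
  `|U| <= g -> height X g%:~R < b%:~R ->
  U%:~R ^+ 2 + D * (b%:~R - height X g%:~R) ^+ 2 != X.

(** Witnesses [b1] and [b2] for [g = 1] and [g = 2] would be integers with
    [b2 < b1 < b2 + 1]: the arcs opposite to the two chords lie at different
    but very close heights once [25 <= X]. *)
Lemma opposite_free_exists (X : R) : 25 <= X ->
  opposite_free X 1 \/ opposite_free X 2.
Proof.
move=> X25.
have wit (g : int) : ~ opposite_free X g -> exists U b : int, [/\ `|U| <= g,
    height X g%:~R < b%:~R & U%:~R ^+ 2 + D * (b%:~R - height X g%:~R) ^+ 2 = X].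
  move=> /existsNP[U /existsNP[b /not_implyP[h1 /not_implyP[h2 /negP h3]]]].
  by exists U, b; split=> //; apply/eqP; move: h3; rewrite negbK.
have [|/wit[U1 [b1 [hU1 hb1 e1]]]] := pselect (opposite_free X 1); first by left.
have [|/wit[U2 [b2 [hU2 hb2 e2]]]] := pselect (opposite_free X 2); first by right.
exfalso.
pose rho := height X 0.
have y1E : D * height X 1 ^+ 2 = X - 1 by rewrite heightE ?expr1n //; lra.
have y2E : D * height X 2 ^+ 2 = X - 4 by rewrite heightE; [ring|lra].
have rE : D * rho ^+ 2 = X by rewrite heightE; [ring|rewrite expr2 mulr0; lra].
have y1p := height_ge0 X 1; have y2p := height_ge0 X 2; have rp := height_ge0 X 0.
rewrite -/rho in rp.
change (1%:~R : R) with (1 : R) in *; change (2%:~R : R) with (2 : R) in *.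
set y1 := height X 1 in hb1 e1 y1E y1p; set y2 := height X 2 in hb2 e2 y2E y2p.
have uge (U : int) : 0 <= U%:~R ^+ 2 :> R by exact: sqr_ge0.
have ule (U g : int) : `|U| <= g -> U%:~R ^+ 2 <= g%:~R ^+ 2 :> R.
  move=> h; rewrite -!rmorphXn /= ler_int -[U ^+ 2]real_normK ?num_real //.
  by rewrite ler_pXn2r ?nnegrE // (le_trans _ h).
have := ule _ _ hU1; have := ule _ _ hU2; have := uge U1; have := uge U2.
change (1%:~R : R) with (1 : R) in *; change (2%:~R : R) with (2 : R) in *.
rewrite expr1n; move: e1 e2; set u1 := U1%:~R ^+ 2; set u2 := U2%:~R ^+ 2.
set x1 : R := b1%:~R; set x2 : R := b2%:~R.
move=> e1 e2 u20 u10 u2l u1l.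
have mono (x y : R) : 0 <= x -> 0 <= y -> D * x ^+ 2 <= D * y ^+ 2 -> x <= y.
  by move=> x0 y0; rewrite ler_pM2l // ler_pXn2r ?nnegrE.
have b1lo : y1 <= x1 - y1 by apply: mono; lra.
have b1hi : x1 - y1 <= rho by apply: mono; lra.
have b2lo : y2 <= x2 - y2 by apply: mono; lra.
have b2hi : x2 - y2 <= rho by apply: mono; lra.
have gap : y2 + rho < 2 * y1.
  rewrite ltNge; apply/negP => h.
  have : D * (2 * y1) ^+ 2 <= D * (y2 + rho) ^+ 2.
    by rewrite ler_pM2l // ler_pXn2r ?nnegrE ?addr_ge0 ?mulr_ge0.
  have : 0 <= D * (y2 - rho) ^+ 2 by rewrite mulr_ge0 ?sqr_ge0 // ltW.
  have -> : D * (2 * y1) ^+ 2 = 4 * (D * y1 ^+ 2) by ring.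
  have -> : D * (y2 + rho) ^+ 2 = D * y2 ^+ 2 + D * rho ^+ 2 + 2 * (D * (y2 * rho)) by ring.
  have -> : D * (y2 - rho) ^+ 2 = D * y2 ^+ 2 + D * rho ^+ 2 - 2 * (D * (y2 * rho)) by ring.
  rewrite y1E y2E rE; lra.
have width : 2 * (rho - y2) < 1.
  have Dr : 5 <= D * rho.
    rewrite -(@ler_pXn2r _ 2) ?nnegrE ?mulr_ge0 // ?(ltW D0) //.
    have -> : (D * rho) ^+ 2 = D * X by rewrite -rE; ring.
    by rewrite (le_trans (_ : _ <= 1 * X)) ?ler_wpM2r //; lra.
  have Dy : 4 <= D * y2.
    rewrite -(@ler_pXn2r _ 2) ?nnegrE ?mulr_ge0 // ?(ltW D0) //.
    have -> : (D * y2) ^+ 2 = D * (X - 4) by rewrite -y2E; ring.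
    by rewrite (le_trans (_ : _ <= 1 * (X - 4))) ?ler_wpM2r //; lra.
  have e4 : (rho - y2) * (D * rho + D * y2) = 4.
    have -> : (rho - y2) * (D * rho + D * y2) = D * rho ^+ 2 - D * y2 ^+ 2 by ring.
    by rewrite rE y2E; ring.
  rewrite ltNge; apply/negP => h.
  have : 2^-1 * 9 <= (rho - y2) * (D * rho + D * y2) by apply: ler_pM; lra.
  rewrite e4; lra.
have lt1 : x2 < x1 by lra.
have lt2 : x1 < x2 + 1 by lra.
have {}lt1 : b2 < b1 by rewrite -(ltr_int R).
have {}lt2 : b1 < b2 + 1 by rewrite -(ltr_int R) intrD.
by move: lt1 lt2; clear; lia.
Qed.

End TwoPoint.

Section Chord.
Variables (R : realType) (D : R).
Hypothesis D1 : 1 <= D.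
Let D0 : 0 < D. Proof. exact: lt_le_trans D1. Qed.

Definition qdist (c : R * R) (m n : int) : R :=
  (m%:~R - c.1) ^+ 2 + D * (n%:~R - c.2) ^+ 2.

(** The disc around [c1] contains all lattice points of the disc around [c2],
    and also [(0, 0)] and [(2 g, 0)], which are outside the disc around [c2].
    The margin [eps] leaves room for errors of approximation. *)
Record chord (X eps : R) (g : int) (c1 c2 : R * R) : Prop := Chord {
  chord_g : g = 1 \/ g = 2;
  chord_off : forall (c : R * R) (m n : int), c = c1 \/ c = c2 ->
    [/\ eps <= `|m%:~R - c.1|, eps <= `|n%:~R - c.2| & eps <= `|qdist c m n - X|];
  chord_sub : forall m n : int, qdist c2 m n < X -> qdist c1 m n < X;
  chord_in : forall m : int, m = 0 \/ m = 2 * g -> qdist c1 m 0 < X;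
  chord_out : forall m : int, m = 0 \/ m = 2 * g -> X < qdist c2 m 0
}.

(** Perturb the center of the circle of [height] to [(g + e, y -/+ kap e)]. For
    small [e] only the lattice points on the circle matter. The slope [lam]
    makes the linear term prefer the first disc over the second for all of
    them: this is clear for points below the center, and points above it have
    [|U| > g], where the sign of [U] decides equally for both discs. The shift
    by [e] to the right keeps the lattice off the vertical axis. *)
Lemma chord_locally (X : R) : 25 <= X -> exists2 eps : R, 0 < eps &
  exists g c1 c2, forall X' eps', `|X' - X| <= eps -> eps' <= eps ->
  chord X' eps' g c1 c2.
Proof.
move=> X25.
have [g g12 opp] : exists2 g : int, g = 1 \/ g = 2 & opposite_free D X g.
  by case: (opposite_free_exists D1 X25) => h; [exists 1|exists 2] => //; [left|right].
have gR : 1 <= g%:~R :> R /\ g%:~R <= 2 :> R.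
  by case: g12 => ->; split; rewrite ?ler1z // -[2]/(2%:~R) ler_int.
have [g1R g2R] := gR.
pose y := height D X g%:~R.
have gX : g%:~R ^+ 2 <= X :> R.
  by apply: le_trans X25; rewrite expr2; nra.
have yE : D * y ^+ 2 = X - g%:~R ^+ 2 by rewrite (heightE D1).
have y0 : 0 < y.
  rewrite lt_neqAle height_ge0 andbT eq_sym; apply/eqP => ye.
  move: yE; rewrite ye expr2 !mulr0; nra.
(* [lam * y] lies strictly between [g] and [g + 1]. *)
pose lam := (g%:~R + 2^-1) / y.
have lam0 : 0 < lam by rewrite divr_gt0 //; lra.
have lamy : lam * y = g%:~R + 2^-1 by rewrite divfK // gt_eqF.
pose kap := lam / D; have kap0 : 0 < kap by rewrite divr_gt0.
have kapD : D * kap = lam by rewrite mulrC divfK // gt_eqF.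
pose k := 1 + D * kap ^+ 2; have k0 : 0 < k by rewrite addr_gt0 // mulr_gt0 // exprn_gt0.
pose U (m : int) : R := m%:~R - g%:~R.
pose b (n : int) : R := n%:~R - y.
pose cc m n := U m ^+ 2 + D * b n ^+ 2 - X.
pose C1 e : R * R := (g%:~R + e, y - kap * e).
pose C2 e : R * R := (g%:~R + e, y + kap * e).
have q1E e m n : qdist (C1 e) m n - X =
    cc m n - 2 * e * (U m - lam * b n) + e ^+ 2 * k.
  by rewrite /qdist /cc /U /b /k /= -kapD; ring.
have q2E e m n : qdist (C2 e) m n - X =
    cc m n - 2 * e * (U m + lam * b n) + e ^+ 2 * k.
  by rewrite /qdist /cc /U /b /k /= -kapD; ring.
pose P (i : int * int) (e : R) :=
  [/\ qdist (C1 e) i.1 i.2 - X != 0, qdist (C2 e) i.1 i.2 - X != 0,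
    qdist (C1 e) i.1 i.2 - X < 0 <-> cc i.1 i.2 < 0 \/ cc i.1 i.2 = 0 /\ 0 < U i.1 - lam * b i.2,
    qdist (C2 e) i.1 i.2 - X < 0 <-> cc i.1 i.2 < 0 \/ cc i.1 i.2 = 0 /\ 0 < U i.1 + lam * b i.2 &
    (b i.2 + kap * e != 0) /\ (b i.2 - kap * e != 0)].
have Pex i : exists2 e0 : R, 0 < e0 & forall e, 0 < e -> e < e0 -> P i e.
  have [ea ea0 ha] := quadratic_sign (cc i.1 i.2) (U i.1 - lam * b i.2) k0.
  have [eb eb0 hb] := quadratic_sign (cc i.1 i.2) (U i.1 + lam * b i.2) k0.
  have [ec ec0 hc] := linear_nonzero (b i.2) kap0.
  exists (Num.min ea (Num.min eb ec)); first by rewrite !lt_min ea0 eb0.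
  move=> e e0; rewrite !lt_min => /and3P[h1 h2 h3].
  have [a1 a2] := ha e e0 h1; have [b1 b2] := hb e e0 h2.
  by split; rewrite ?q1E ?q2E //; exact: hc.
have [N hN] := exists_nat_gt (X + y + 6).
pose box := [seq (i%:Z - N%:Z, j%:Z - N%:Z) | i <- iota 0 (2 * N).+1, j <- iota 0 (2 * N).+1].
have inbox (m n : int) : `|m| <= N%:Z -> `|n| <= N%:Z -> (m, n) \in box.
  move=> hm hn; apply/allpairsP; exists (`|(m + N%:Z)%R|%N, `|(n + N%:Z)%R|%N).
  by rewrite !mem_iota /=; split; [clear -hm; lia|clear -hn; lia|congr pair; clear -hm hn; lia].
have [e0 e00 Pbox] := common_radius box Pex.
pose e := Num.min (e0 / 2) (Num.min 2^-1 kap^-1).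
have e_gt0 : 0 < e by rewrite !lt_min divr_gt0 //= invr_gt0 ?invr_gt0 ltr0Sn.
have e_half : e <= 2^-1 by rewrite ge_min ge_min lexx orbT.
have e_kap : kap * e <= 1.
  have : e <= kap^-1 by rewrite !ge_min lexx !orbT.
  by rewrite -(ler_pM2l kap0) divff // gt_eqF.
have e_lt : e < e0 by rewrite gt_min; apply/orP; left; lra.
have PB m n : `|m| <= N%:Z -> `|n| <= N%:Z -> P (m, n) e by move=> hm hn; apply: Pbox => //; exact: inbox.
have ke0 : 0 < kap * e by rewrite mulr_gt0.
have far_sqr (x z : R) (m : int) : N%:Z < `|m| -> `|z| <= y + 3 -> X + 1 <= (m%:~R - z) ^+ 2.
  move=> hm hz.
  have hm' : N%:R <= `|m%:~R| :> R.
    by rewrite -intr_norm -[N%:R]/(N%:Z%:~R) ler_int ltW.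
  have h : X + 3 <= `|m%:~R - z|.
    by have := lerB_dist m%:~R z; lra.
  rewrite -[leRHS]real_normK ?num_real //.
  apply: (@le_trans _ _ ((X + 3) ^+ 2)); first by rewrite expr2; nra.
  by rewrite ler_pXn2r ?nnegrE //; lra.
pose isc (c : R * R) := c = C1 e \/ c = C2 e.
have cbound c : isc c -> `|c.1| <= y + 3 /\ `|c.2| <= y + 3.
  by case=> -> /=; split; rewrite ler_norml; move: g1R g2R y0 e_gt0 e_half e_kap ke0; clear; lra.
have far c m n : isc c -> N%:Z < `|m| \/ N%:Z < `|n| -> X + 1 <= qdist c m n.
  move=> /cbound[b1 b2] [h|h].
    by apply: (le_trans (far_sqr 0 c.1 m h b1)); rewrite lerDl mulr_ge0 ?sqr_ge0 // ltW.
  apply: (le_trans (far_sqr 0 c.2 n h b2)).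
  apply: (@le_trans _ _ (D * (n%:~R - c.2) ^+ 2)); last by rewrite lerDr sqr_ge0.
  by rewrite ler_peMl ?sqr_ge0.
have boxP (m n : int) : (`|m| <= N%:Z /\ `|n| <= N%:Z) \/ (N%:Z < `|m| \/ N%:Z < `|n|).
  by clear; lia.
pose V c (i : int * int) (d : R) := d <= `|i.2%:~R - c.2| /\ d <= `|qdist c i.1 i.2 - X|.
have [d d0 hd] : exists2 d : R, 0 < d & forall i, i \in box -> V (C1 e) i d /\ V (C2 e) i d.
  pose nz (x : R) := if x == 0 then 1 else `|x|.
  have nz0 x : 0 < nz x by rewrite /nz; case: eqP => // /eqP h; rewrite normr_gt0.
  pose W (i : int * int) (d : R) := [/\ d <= nz (i.2%:~R - (C1 e).2),
    d <= nz (qdist (C1 e) i.1 i.2 - X), d <= nz (i.2%:~R - (C2 e).2) &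
    d <= nz (qdist (C2 e) i.1 i.2 - X)].
  have Wex i : exists2 d0 : R, 0 < d0 & forall d, 0 < d -> d < d0 -> W i d.
    exists (Num.min (nz (i.2%:~R - (C1 e).2)) (Num.min (nz (qdist (C1 e) i.1 i.2 - X))
      (Num.min (nz (i.2%:~R - (C2 e).2)) (nz (qdist (C2 e) i.1 i.2 - X))))).
      by rewrite !lt_min !nz0.
    by move=> d _; rewrite !lt_min => /and4P[h1 h2 h3 h4]; split; apply: ltW.
  have [d0 d00 hd] := common_radius box Wex.
  exists (d0 / 2); first by rewrite divr_gt0.
  move=> i ib; have [h1 h2 h3 h4] : W i (d0 / 2) by apply: hd => //; lra.
  have [p1 p2 _ _ [p3 p4]] := Pbox e i ib e_gt0 e_lt.
  have z1 : i.2%:~R - (C1 e).2 != 0 by rewrite /= opprB addrCA addrC; move: p3; rewrite /b.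
  have z2 : i.2%:~R - (C2 e).2 != 0 by rewrite /= opprD addrA.
  rewrite /nz (negPf p1) (negPf p2) (negPf z1) (negPf z2) in h1 h2 h3 h4.
  by rewrite /V.
pose eps := Num.min e (Num.min 1 d) / 2.
have eps0 : 0 < eps by apply: divr_gt0 => //; rewrite lt_min e_gt0 lt_min ltr01.
have eps2 : 2 * eps = Num.min e (Num.min 1 d) by rewrite /eps mulrC divfK ?pnatr_eq0.
have min3 (x1 x2 x3 : R) : [/\ Num.min x1 (Num.min x2 x3) <= x1,
    Num.min x1 (Num.min x2 x3) <= x2 & Num.min x1 (Num.min x2 x3) <= x3].
  by rewrite !ge_min !lexx ?orbT.
have [eps_e eps_1 eps_d] := min3 e 1 d; rewrite -eps2 in eps_e eps_1 eps_d.
clearbody eps.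
have off c m n : isc c -> [/\ eps <= `|m%:~R - c.1|, eps <= `|n%:~R - c.2| &
    2 * eps <= `|qdist c m n - X|].
  move=> hc; split.
  - have -> : c.1 = g%:~R + e by case: hc => ->.
    rewrite opprD addrA -intrB; have [->|mg] := eqVneq (m - g) 0.
      by rewrite sub0r normrN gtr0_norm //; move: eps0 eps_e; clear; lra.
    have : 1 <= `|(m - g)%:~R| :> R by rewrite -intr_norm ler1z -gtz0_ge1 normr_gt0.
    by have := lerB_dist (m - g)%:~R e; rewrite (gtr0_norm e_gt0); move: eps_1 eps0 e_half; clear; lra.
  - have [[hm hn]|[h'|h']] := boxP 0 n.
    + have [[v1 _] [v2 _]] := hd _ (inbox _ _ hm hn).
      by case: hc => ->; [move: v1|move: v2] => /=; move: eps0 eps_d; clear; lra.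
    + by move: h'; rewrite normr0.
    + have := far_sqr 0 c.2 n h' (cbound _ hc).2.
      rewrite -[X in _ <= X]real_normK ?num_real // => h2.
      rewrite leNgt; apply/negP => h3.
      have := normr_ge0 (n%:~R - c.2); move: h2 h3; set z := `|_|; rewrite expr2; nra.
  - have [[hm hn]|h] := boxP m n.
      have [[_ v1] [_ v2]] := hd _ (inbox _ _ hm hn).
      by case: hc => ->; [move: v1|move: v2] => /=; move: eps0 eps_d; clear; lra.
    by have := far c m n hc h; rewrite ler_normr; move: eps0 eps_1; clear; lra.
have subX m n : qdist (C2 e) m n < X -> qdist (C1 e) m n < X.
  move=> q2; have [[hm hn]|h] := boxP m n; last first.
    by have := far (C2 e) m n (or_intror erefl) h; move: q2; clear; lra.
  have [_ _ i1 i2 _] := PB m n hm hn; rewrite /= in i1 i2.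
  rewrite -subr_lt0; apply/i1; move: q2; rewrite -subr_lt0 => /i2[h|[h h']]; first by left.
  right; split=> //; have [bn|bn] := leP (b n) 0.
    have : 0 <= lam * - b n by rewrite mulr_ge0 ?oppr_ge0 // ltW.
    by rewrite mulrN; move: h'; clear; lra.
  have cX : U m ^+ 2 + D * b n ^+ 2 = X by move: h; rewrite /cc; clear; lra.
  have [gm|gm] := leP `|m - g| g.
    have := opp (m - g) n gm; rewrite -subr_gt0 => /(_ bn).
    by rewrite intrB -/(U m) -/(b n) cX eqxx.
  have UU : g%:~R + 1 <= `|U m|.
    by rewrite /U -intrB -intr_norm -[1]/(1%:~R) -intrD ler_int; clear -gm; lia.
  have by_ : b n < y.
    rewrite -(@ltr_pXn2r _ 2) ?nnegrE ?ltW // -(ltr_pM2l D0) yE -cX.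
    rewrite -subr_gt0 (_ : _ - _ = U m ^+ 2 - g%:~R ^+ 2); last by ring.
    rewrite -[U m ^+ 2]real_normK ?num_real // subr_gt0 ltr_pXn2r ?nnegrE //; lra.
  have lb : lam * b n < g%:~R + 2^-1 by rewrite -lamy ltr_pM2l.
  have [Up|Un] := leP 0 (U m); first by rewrite ger0_norm // in UU; move: UU lb h'; clear; lra.
  by rewrite ltr0_norm // in UU; move: UU lb h'; clear; lra.
have g0N (m : int) : m = 0 \/ m = 2 * g -> `|m| <= N%:Z /\ U m ^+ 2 = g%:~R ^+ 2.
  have N6 : (6 <= N)%N by rewrite -(ler_nat R); move: hN y0 X25; clear; lra.
  move=> hm; split.
    by case: hm => ->; [rewrite normr0|case: g12 => ->; clear -N6; lia].
  by rewrite /U; case: hm => ->; rewrite ?intrM; ring.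
have cc0 m : m = 0 \/ m = 2 * g -> cc m 0 = 0.
  by move=> /g0N[_ h]; rewrite /cc h /b sub0r sqrrN yE; ring.
have Ule m : m = 0 \/ m = 2 * g -> - g%:~R <= U m <= g%:~R.
  by rewrite /U; case=> ->; rewrite ?intrM; move: g1R; clear -D1; lra.
have inX m : m = 0 \/ m = 2 * g -> qdist (C1 e) m 0 < X.
  move=> hm; have [_ _ i1 _ _] := PB m 0 (g0N m hm).1 isT.
  rewrite -subr_lt0; apply/i1; right; split; first exact: cc0.
  by have := Ule m hm; rewrite /= /b sub0r mulrN opprK lamy => /andP[]; clear -D1; lra.
have outX m : m = 0 \/ m = 2 * g -> X <= qdist (C2 e) m 0.
  move=> hm; have [_ _ _ i2 _] := PB m 0 (g0N m hm).1 isT.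
  rewrite leNgt; apply/negP; rewrite -subr_lt0 => /i2[|[_]]; first by rewrite cc0 // ltxx.
  by have := Ule m hm; rewrite /= /b sub0r mulrN lamy => /andP[]; clear -D1; lra.
exists eps => //; exists g, (C1 e), (C2 e) => X' eps' hX he.
move: hX; rewrite ler_norml => /andP[x1 x2].
split=> //.
- move=> c m n hc; have [o1 o2 o3] := off c m n hc; split.
  + exact: le_trans o1.
  + exact: le_trans o2.
  + move: o3 he x1 x2 eps0; rewrite !ler_normr; clear; lra.
- move=> m n q2; have [_ _ o2] := off (C2 e) m n (or_intror erefl).
  have [_ _ o1] := off (C1 e) m n (or_introl erefl).
  have q2X : qdist (C2 e) m n < X by move: o2 q2 x1 x2 eps0; rewrite ler_normr; clear; lra.
  by have := subX m n q2X; move: o1 x1 x2 eps0; rewrite ler_normr; clear; lra.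
- move=> m hm; have [_ _ o1] := off (C1 e) m 0 (or_introl erefl).
  by have := inX m hm; move: o1 x1 x2 eps0; rewrite ler_normr; clear; lra.
- move=> m hm; have [_ _ o1] := off (C2 e) m 0 (or_intror erefl).
  by have := outX m hm; move: o1 x1 x2 eps0; rewrite ler_normr; clear; lra.
Qed.

End Chord.

Section ChordUniform.
Import numFieldNormedType.Exports.

(** Compactness of the interval turns the local margins into a uniform one. *)
Lemma chord_uniform (R : realType) (D : R) (D1 : 1 <= D) (B : R) : exists2 eps : R, 0 < eps &
  forall X, 25 <= X <= B -> exists g c1 c2, chord D X eps g c1 c2.
Proof.
have := @segment_compact R 25 B; rewrite compact_near_coveringP => nc.
pose Pr (i : nat) (X : R) := exists g c1 c2, chord D X (i.+1%:R^-1) g c1 c2.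
have [|i _ hi] := nc nat \oo%classic Pr _.
  move=> X; rewrite /= in_itv /= => /andP[X25 _].
  have [eps eps0 [g [c1 [c2 h]]]] := chord_locally D1 X25.
  have [n hn] := exists_nat_gt eps^-1.
  exists ([set X' | `|X' - X| <= eps]%classic, [set i | (n <= i)%N]%classic) => /=.
    split; last by exists n.
    apply/(@nbhs_ballP R R); exists eps => //= z; rewrite /ball /= distrC; exact: ltW.
  move=> [X' i] /= [hX hi]; exists g, c1, c2; apply: h => //.
  rewrite -[leRHS]invrK lef_pV2 ?posrE ?invr_gt0 // (le_trans (ltW hn)) // ler_nat.
  by rewrite leqW.
exists (i.+1%:R^-1) => [|X hX]; first by rewrite invr_gt0 ltr0Sn.
by apply: (hi i) => //=; rewrite in_itv.
Qed.


End ChordUniform.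

(** * Equidistribution modulo powers of a ramified prime *)

Definition nrm (T M : int) (z : int * int) : int :=
  z.1 ^+ 2 + T * (z.1 * z.2) + M * z.2 ^+ 2.

Lemma Q_nrm T M z : Q T M z = 4 * nrm T M z.
Proof. rewrite QE /nrm /acoord /Disc; ring. Qed.

Definition norm_product (T M : int) (s : seq (int * int)) : nat :=
  (\prod_(x <- s) \prod_(y <- s | y != x) `|nrm T M (x - y)%R|)%N.

(** For an Eisenstein pair [(T, M)] the powers of the ramified prime ideal are
    given by alternating divisibility of the two coordinates. *)
Definition level (p k : nat) (z : int * int) : bool :=
  ((p ^ uphalf k)%N%:Z %| z.1)%Z && ((p ^ k./2)%N%:Z %| z.2)%Z.

(** If [p] divides the form it divides [x]; writing [x = p x1] and dividing by
    [p] exchanges the roles of [x1] and [y]. *)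
Lemma eisenstein_dvd (p : nat) (k : nat) (u m n x y : int) : prime p ->
  ~~ (p%:Z %| u)%Z -> ~~ (p%:Z %| n)%Z ->
  ((p ^ k)%N%:Z %| u * x ^+ 2 + p%:Z * m * (x * y) + p%:Z * n * y ^+ 2)%Z
  = level p k (x, y).
Proof.
move=> pp; have p0 : p%:Z != 0 by have := prime_gt0 pp; case: (p).
elim: k u n x y => [|k IH] u n x y pu pn; first by rewrite /level !dvd1z.
have [px|px] := boolP (p%:Z %| x)%Z; last first.
  rewrite /level /=; apply/idP/idP => [h|/andP[h _]]; last first.
    by rewrite (dvdz_trans _ h) // expnS PoszM dvdz_mulr in px.
  have : (p%:Z %| u * x ^+ 2 + p%:Z * m * (x * y) + p%:Z * n * y ^+ 2)%Z.
    by apply: dvdz_trans h; rewrite expnS PoszM dvdz_mulr.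
  rewrite -!mulrA -addrA -mulrDr rpredDr; last by rewrite dvdz_mulr.
  by move: pu px; rewrite !dvdzE abszM abszX Euclid_dvdM // Euclid_dvdX // andbT => /negPf -> /negPf ->.
have [x1 ->] := dvdzP px.
have -> : u * (x1 * p%:Z) ^+ 2 + p%:Z * m * (x1 * p%:Z * y) + p%:Z * n * y ^+ 2
  = p%:Z * (n * y ^+ 2 + p%:Z * m * (y * x1) + p%:Z * u * x1 ^+ 2) by ring.
rewrite expnS PoszM dvdz_mul2l // IH // /level /= andbC; congr andb.
by rewrite expnS PoszM [x1 * _]mulrC dvdz_mul2l.
Qed.

Lemma nrm_level (T M : int) (p k : nat) (z : int * int) : prime p ->
  (p%:Z %| T)%Z -> (p%:Z %| M)%Z -> ~~ ((p ^ 2)%N%:Z %| M)%Z ->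
  (p ^ k %| `|nrm T M z|)%N = level p k z.
Proof.
move=> pp /dvdzP[m ->] /dvdzP[n ->] pM.
have p0 : p%:Z != 0 by have := prime_gt0 pp; case: (p).
rewrite -[LHS]/((p ^ k)%N%:Z %| nrm _ _ z)%Z /nrm -[z.1 ^+ 2]mul1r [m * _]mulrC [n * _]mulrC.
case: z => x y; apply: eisenstein_dvd => //.
  by rewrite dvdzE /= dvdn1 neq_ltn prime_gt1 // orbT.
by apply: contra pM; rewrite expnS expn1 PoszM dvdz_mul2r.
Qed.

Lemma seq_count_sum (I : Type) (F : finType) (f : I -> F) (s : seq I) :
  (\sum_(c : F) count (fun x => f x == c) s = size s)%N.
Proof.
elim: s => [|x s IH] /=; first by rewrite big1.
rewrite big_split /= IH -[in RHS]add1n; congr addn.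
rewrite (bigD1 (f x)) //= eqxx big1 // => c /negPf h; by rewrite eq_sym h.
Qed.

Lemma pair_count_sqr (I : Type) (F : finType) (f : I -> F) (s : seq I) :
  (\sum_(x <- s) \sum_(y <- s) (f x == f y) = \sum_(c : F) count (fun x => f x == c) s ^ 2)%N.
Proof.
have -> : (\sum_(x <- s) \sum_(y <- s) (f x == f y) =
   \sum_(x <- s) count (fun y => f y == f x) s)%N.
  by apply: eq_bigr => x _; rewrite -sumn_count sumnE big_map; apply: eq_bigr => y _; rewrite eq_sym.
have gen (r : seq I) : (\sum_(x <- r) count (fun y => f y == f x) s =
    \sum_(c : F) count (fun x => f x == c) r * count (fun x => f x == c) s)%N.
  elim: r => [|x r IH]; first by rewrite big_nil big1.
  rewrite big_cons IH /=; under [RHS]eq_bigr do rewrite mulnDl.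
  rewrite big_split /=; congr addn.
  rewrite (bigD1 (f x)) //= eqxx mul1n big1 ?addn0 // => c /negPf h.
  by rewrite eq_sym h.
by rewrite gen; apply: eq_bigr => c _; rewrite -mulnn.
Qed.

(** The number of pairs in a common class for [m] elements distributed as evenly
    as possible over [q] classes; see [excess_sum] for why it is minimal. *)
Definition min_pairs (m q : nat) : int :=
  (2 * (m %/ q)%N%:Z + 1) * m%:Z - (m %/ q)%N%:Z * ((m %/ q)%N%:Z + 1) * q%:Z.

(** The summands on the left are nonnegative, and vanish only for classes of
    [al] or [al + 1] elements: even distributions minimize the pair count. *)
Lemma excess_sum (I : Type) (F : finType) (f : I -> F) (s : seq I) :
  let al := ((size s) %/ #|F|)%N%:Z in
  \sum_(c : F) ((count (fun x => f x == c) s)%:Z - al) * ((count (fun x => f x == c) s)%:Z - al - 1)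
  = (\sum_(x <- s) \sum_(y <- s) (f x == f y))%N%:Z - min_pairs (size s) #|F|.
Proof.
move=> al; rewrite pair_count_sqr /min_pairs -/al.
rewrite -{1}(seq_count_sum f s).
have cast (g : F -> nat) : (\sum_(c : F) g c)%N%:Z = \sum_(c : F) (g c)%:Z.
  by rewrite -!natz natr_sum; apply: eq_bigr => c _; rewrite natz.
rewrite !cast.
have -> : al * (al + 1) * #|F|%:Z = \sum_(c : F) al * (al + 1).
  by rewrite sumr_const -mulr_natr natz.
rewrite mulr_sumr -!sumrB; apply: eq_bigr => c _.
by rewrite -mulnn PoszM; ring.
Qed.

Lemma consecutive_product_ge0 (x al : int) : 0 <= (x - al) * (x - al - 1).
Proof.
have [h|h] := leP x al; first by rewrite mulr_le0 //; lia.
by rewrite mulr_ge0 //; lia.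
Qed.

Lemma min_pairs_le (I : Type) (F : finType) (f : I -> F) (s : seq I) :
  min_pairs (size s) #|F| <= (\sum_(x <- s) \sum_(y <- s) (f x == f y))%N%:Z.
Proof.
by rewrite -subr_ge0 -excess_sum sumr_ge0 // => c _; exact: consecutive_product_ge0.
Qed.

Lemma balanced_of_min (I : Type) (F : finType) (f : I -> F) (s : seq I) :
  (\sum_(x <- s) \sum_(y <- s) (f x == f y))%N%:Z <= min_pairs (size s) #|F| ->
  forall c, ((size s) %/ #|F| <= count (fun x => f x == c) s <= ((size s) %/ #|F|).+1)%N.
Proof.
rewrite -subr_le0 -excess_sum => le c.
set al := (size s %/ #|F|)%N in le *.
have : \sum_(c : F) ((count (fun x => f x == c) s)%:Z - al%:Z) *
   ((count (fun x => f x == c) s)%:Z - al%:Z - 1) == 0.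
  by rewrite eq_le le sumr_ge0 // => d _; exact: consecutive_product_ge0.
rewrite psumr_eq0; last by move=> d _; exact: consecutive_product_ge0.
move=> /allP /(_ c (mem_index_enum _)) /=; rewrite mulf_eq0.
by case/orP => /eqP; lia.
Qed.

Lemma count_iota_mod (q m c : nat) : (0 < q)%N -> (c < q)%N ->
  count (fun i => i %% q == c)%N (iota 0 m) = (m %/ q + (c < m %% q))%N.
Proof.
move=> q0 cq; elim: m => [|m IH]; first by rewrite div0n mod0n.
rewrite -addn1 iotaD count_cat IH /= add0n addn0 addn1 divnS // modnS.
case: ifP => [qd|qd]; last first.
  rewrite add0n -addnA; congr addn; rewrite ltnS [_ == c]eq_sym.
  by case: (ltngtP c (m %% q)%N).
have mq : (m %% q).+1 = q.
  have := qd; rewrite /dvdn -addn1 -modnDml addn1 => /eqP h.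
  apply/eqP; rewrite eqn_leq ltn_pmod //=; rewrite leqNgt; apply/negP => lt.
  by move: h; rewrite modn_small.
rewrite ltn0 addn0 -addnA [RHS]addnC; congr addn; rewrite -mq in cq.
by move: cq; rewrite ltnS [_ == c]eq_sym; case: (ltngtP c (m %% q)%N).
Qed.

Lemma iota_mod_min_pairs (q m : nat) : (0 < q)%N ->
  (\sum_(i <- iota 0 m) \sum_(j <- iota 0 m) (i %% q == j %% q))%N%:Z = min_pairs m q.
Proof.
move=> q0; pose f (i : nat) := Ordinal (ltn_pmod i q0).
have -> : (\sum_(i <- iota 0 m) \sum_(j <- iota 0 m) (i %% q == j %% q) =
  \sum_(i <- iota 0 m) \sum_(j <- iota 0 m) (f i == f j))%N by [].
have := excess_sum f (iota 0 m); rewrite card_ord size_iota => /= e.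
apply/eqP; rewrite -subr_eq0 -e; apply/eqP; apply: big1 => c _.
have -> : count (fun i => f i == c) (iota 0 m) = count (fun i => i %% q == c)%N (iota 0 m) by [].
rewrite count_iota_mod //; case: (_ < _)%N; rewrite ?addn0 ?addn1.
  set al := (m %/ q)%N; have -> : al.+1%:Z - al%:Z - 1 = 0 by lia.
  by rewrite mulr0.
by rewrite subrr mul0r.
Qed.

(** The expansion of [i] in base [p], read as an expansion in powers of a formal
    square root of [p], which plays the role of a uniformizer. *)
Fixpoint digits (p f i : nat) : int * int :=
  if f is f'.+1 then
    let z := digits p f' (i %/ p)%N in ((i %% p)%N%:Z + p%:Z * z.2, z.1)
  else (0, 0).

Lemma digits_level (p f k i j : nat) : prime p -> (i < p ^ f)%N -> (j < p ^ f)%N ->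
  level p k (digits p f i - digits p f j) = (i == j %[mod p ^ k]).
Proof.
move=> pp; have p0 := prime_gt0 pp.
elim: f k i j => [|f IH] [|k] i j.
- by rewrite /level !dvd1z !modn1.
- by rewrite expn0 !ltnS !leqn0 => /eqP -> /eqP ->; rewrite subrr /level !dvdz0 eqxx.
- by rewrite /level !dvd1z !modn1.
move=> ip jp /=; have ip' : (i %/ p < p ^ f)%N by rewrite ltn_divLR // -expnSr.
have jp' : (j %/ p < p ^ f)%N by rewrite ltn_divLR // -expnSr.
set zi := digits p f _; set zj := digits p f _.
have IHk := IH k _ _ ip' jp'; rewrite -/zi -/zj in IHk.
have pz : p%:Z != 0 by case: (p) p0.
have -> : level p k.+1 (((i %% p)%N%:Z + p%:Z * zi.2, zi.1) - ((j %% p)%N%:Z + p%:Z * zj.2, zj.1))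
   = (i %% p == j %% p)%N && level p k (zi - zj).
  rewrite /level /= expnS PoszM.
  have -> : (i %% p)%N%:Z + p%:Z * zi.2 - ((j %% p)%N%:Z + p%:Z * zj.2)
    = ((i %% p)%N%:Z - (j %% p)%N%:Z) + p%:Z * (zi.2 - zj.2) by ring.
  have [e|ne] := eqVneq (i %% p)%N (j %% p)%N.
    by rewrite e subrr add0r dvdz_mul2l // andbC.
  apply/negP => /andP[h _].
  have : (p%:Z %| (i %% p)%N%:Z - (j %% p)%N%:Z)%Z.
    by rewrite -(rpredDr _ (dvdz_mulr (zi.2 - zj.2) (dvdzz p%:Z))) (dvdz_trans _ h) // dvdz_mulr.
  by rewrite -eqz_mod_dvd !modz_nat !modn_mod eqz_nat (negPf ne).
rewrite IHk expnS.
apply/andP/eqP => [[/eqP e1 /eqP e2]|e].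
  rewrite {1}(divn_eq i p) {1}(divn_eq j p) e1 mulnC [(j %/ p * p)%N]mulnC.
  by apply/eqP; rewrite eqn_modDr -!muln_modr e2.
split; apply/eqP.
  have := congr1 (modn^~ p) e; rewrite !modn_dvdm ?dvdn_mulr //.
have /= := congr1 (divn^~ p) e; rewrite -expnS expnSr -!modn_divl => ->.
by [].
Qed.

Lemma residue_eq (n : nat) (a b : int) : (0 < n)%N ->
  (`|(a %% n%:Z)%Z| %% n == `|(b %% n%:Z)%Z| %% n)%N = (n%:Z %| a - b)%Z.
Proof.
move=> n_gt0; have nz : n%:Z != 0 by case: (n) n_gt0.
have h (c : int) : (`|(c %% n%:Z)%Z| %% n)%N%:Z = (c %% n%:Z)%Z.
  have c0 : 0 <= (c %% n%:Z)%Z by rewrite modz_ge0.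
  rewrite modn_small; first by rewrite gez0_abs.
  by rewrite -ltz_nat gez0_abs // ltz_pmod.
by rewrite -eqz_nat !h eqz_mod_dvd.
Qed.

Section Equidistribution.
Variables (T M : int) (p : nat).
Hypotheses (pp : prime p) (pT : (p%:Z %| T)%Z) (pM : (p%:Z %| M)%Z)
  (pM2 : ~~ ((p ^ 2)%N%:Z %| M)%Z).
Hypothesis nrm_pos : forall z : int * int, z != 0 -> (0 < `|nrm T M z|)%N.

Lemma logn_sum_levels (B n : nat) : (0 < n)%N -> (n <= B)%N ->
  logn p n = (\sum_(1 <= k < B) (p ^ k %| n))%N.
Proof.
move=> n0 nB; rewrite logn_count_dvd // [RHS](big_cat_nat n0 nB) /=.
rewrite [X in (_ + X)%N]big_nat_cond [X in (_ + X)%N]big1 ?addn0 // => k.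
rewrite andbT => /andP[nk _]; apply/eqP; rewrite eqb0.
by apply/negP => /(dvdn_leq n0); rewrite leqNgt (leq_ltn_trans nk) // ltn_expl // prime_gt1.
Qed.

Definition level_pairs (k : nat) (s : seq (int * int)) : nat :=
  (\sum_(x <- s) \sum_(y <- s) level p k (x - y)%R)%N.

(** The [p]-adic valuation of the norm product counts, over all levels, the
    ordered pairs of congruent points; the second term on the left removes the
    pairs on the diagonal. *)
Lemma logn_norm_product (B : nat) (s : seq (int * int)) : uniq s ->
  (forall x y, x \in s -> y \in s -> (`|nrm T M (x - y)%R| <= B)%N) ->
  (logn p (norm_product T M s) + \sum_(1 <= k < B) size s
   = \sum_(1 <= k < B) level_pairs k s)%N.
Proof.
move=> us hB.
have prod0 x : (0 < \prod_(y <- s | y != x) `|nrm T M (x - y)%R|)%N.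
  by apply: prodn_cond_gt0 => y yx; rewrite nrm_pos // subr_eq0 eq_sym.
have lprod (I : Type) (r : seq I) (P : pred I) (F : I -> nat) : (forall i, P i -> (0 < F i)%N) ->
    logn p (\prod_(i <- r | P i) F i) = (\sum_(i <- r | P i) logn p (F i))%N.
  move=> F0; elim: r => [|i r IH]; first by rewrite !big_nil logn1.
  rewrite !big_cons; case: ifP => // Pi.
  by rewrite lognM ?IH ?F0 // prodn_cond_gt0.
rewrite /norm_product lprod //.
have -> : (\sum_(1 <= k < B) size s = \sum_(x <- s) \sum_(1 <= k < B) 1)%N.
  rewrite exchange_big; apply: eq_bigr => k _.
  by rewrite sum1_size.
have -> : (\sum_(1 <= k < B) level_pairs k s =
    \sum_(x <- s) \sum_(1 <= k < B) \sum_(y <- s) level p k (x - y)%R)%N.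
  by rewrite exchange_big.
rewrite -big_split /= big_seq [RHS]big_seq; apply: eq_bigr => x xs.
have -> : (\sum_(1 <= k < B) \sum_(y <- s) level p k (x - y)%R =
    \sum_(1 <= k < B) (1 + \sum_(y <- s | y != x) level p k (x - y)%R))%N.
  apply: eq_bigr => k _; rewrite (bigD1_seq x) //= subrr /level !dvdz0.
  by [].
rewrite lprod; last by move=> y yx; rewrite nrm_pos // subr_eq0 eq_sym.
rewrite big_split /= addnC; congr addn; rewrite exchange_big /=.
rewrite big_seq_cond [RHS]big_seq_cond; apply: eq_bigr => y /andP[ys yx].
rewrite (@logn_sum_levels B) ?hB ?nrm_pos // ?subr_eq0 1?eq_sym //.
by apply: eq_bigr => k _; rewrite nrm_level.
Qed.

Lemma level_min_pairs (k : nat) (s : seq (int * int)) :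
  min_pairs (size s) (p ^ k) <= (level_pairs k s)%:Z.
Proof.
have p0 := prime_gt0 pp.
have n0 (i : nat) : (0 < p ^ i)%N by rewrite expn_gt0 p0.
pose lab (z : int * int) := (Ordinal (ltn_pmod `|(z.1 %% (p ^ uphalf k)%N%:Z)%Z| (n0 (uphalf k))),
   Ordinal (ltn_pmod `|(z.2 %% (p ^ k./2)%N%:Z)%Z| (n0 k./2))).
have := min_pairs_le lab s.
rewrite card_prod !card_ord -expnD (_ : (uphalf k + k./2 = k)%N); last first.
  by rewrite uphalf_half -addnA addnn odd_double_half.
suff -> : (\sum_(x <- s) \sum_(y <- s) (lab x == lab y))%N = level_pairs k s by [].
apply: eq_bigr => x _; apply: eq_bigr => y _; congr nat_of_bool.
by rewrite xpair_eqE -!val_eqE /= !residue_eq.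
Qed.

Lemma digits_min_pairs (k m : nat) :
  (level_pairs k [seq digits p m i | i <- iota 0 m])%:Z = min_pairs m (p ^ k).
Proof.
rewrite -iota_mod_min_pairs ?expn_gt0 ?prime_gt0 //; congr Posz.
rewrite /level_pairs big_map big_seq [RHS]big_seq; apply: eq_bigr => i.
rewrite mem_iota => /= im; rewrite big_map big_seq [RHS]big_seq; apply: eq_bigr => j.
rewrite mem_iota => /= jm; rewrite digits_level //.
- exact: leq_trans im (ltnW (ltn_expl m (prime_gt1 pp))).
- exact: leq_trans jm (ltnW (ltn_expl m (prime_gt1 pp))).
Qed.

Lemma uniq_digits m : uniq [seq digits p m i | i <- iota 0 m].
Proof.
rewrite map_inj_in_uniq ?iota_uniq // => i j; rewrite !mem_iota /= => im jm e.
have lt x : (x < m)%N -> (x < p ^ m)%N.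
  by move=> xm; apply: leq_trans xm (ltnW (ltn_expl m (prime_gt1 pp))).
have := digits_level m pp (lt _ im) (lt _ jm).
rewrite e subrr /level !dvdz0 /= => /esym; rewrite !modn_small ?lt // => /eqP.
by [].
Qed.

(** The digit sequence attains the minimal number of congruent pairs for every
    level at once, so a set whose norm product divides that of the digit
    sequence attains it too. The level [2 j] is congruence modulo [p ^ j]. *)
Lemma classes_balanced (s : seq (int * int)) : uniq s ->
  (forall t, uniq t -> size t = size s -> (norm_product T M s %| norm_product T M t)%N) ->
  forall (j : nat) (z : int * int),
  (size s %/ p ^ j.*2 <= count (fun x => cong (p ^ j)%N x z) s <= (size s %/ p ^ j.*2).+1)%N.
Proof.
move=> us hs j z; have p0 := prime_gt0 pp.
have [j0|j0] := posnP j.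
  rewrite j0 expn0 divn1 (eq_count (a2 := predT)) ?count_predT ?leqnn ?leqnSn //.
  by move=> x; rewrite /cong !dvd1z.
have n0 (i : nat) : (0 < p ^ i)%N by rewrite expn_gt0 p0.
pose m := size s; pose t := [seq digits p m i | i <- iota 0 m].
have ut : uniq t by exact: uniq_digits.
have st : size t = m by rewrite size_map size_iota.
pose B := (\sum_(x <- s ++ t) \sum_(y <- s ++ t) `|nrm T M (x - y)%R| + (j.*2).+2)%N.
have hB x y : x \in s ++ t -> y \in s ++ t -> (`|nrm T M (x - y)%R| <= B)%N.
  move=> xs ys; rewrite /B (big_rem x) //= (big_rem y) //=.
  by rewrite -!addnA leq_addr.
have np0 (r : seq (int * int)) : (0 < norm_product T M r)%N.
  apply: prodn_gt0 => x; apply: prodn_cond_gt0 => y yx.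
  by rewrite nrm_pos // subr_eq0 eq_sym.
have le : (\sum_(1 <= k < B) level_pairs k s <= \sum_(1 <= k < B) level_pairs k t)%N.
  rewrite -!logn_norm_product //; last first.
  - by move=> x y xs ys; rewrite hB // mem_cat ?xs ?ys.
  - by move=> x y xs ys; rewrite hB // mem_cat ?xs ?ys orbT.
  by rewrite st leq_add2r dvdn_leq_log // hs.
have ge k : (level_pairs k t <= level_pairs k s)%N.
  by rewrite -lez_nat digits_min_pairs level_min_pairs.
have eqk (k : nat) : (0 < k)%N -> (k < B)%N -> (level_pairs k s)%:Z <= min_pairs m (p ^ k).
  move=> k0 kB; rewrite -digits_min_pairs lez_nat.
  move: le; rewrite (bigD1_seq k) ?mem_index_iota ?k0 ?iota_uniq //=.
  rewrite [leqRHS](bigD1_seq k) ?mem_index_iota ?k0 ?iota_uniq //=.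
  have : (\sum_(1 <= i < B | i != k) level_pairs i t <= \sum_(1 <= i < B | i != k) level_pairs i s)%N.
    exact: leq_sum.
  by move=> h1 h2; rewrite -/m -/t; move: h1 h2; set a1 := level_pairs k s;
    set a2 := level_pairs k t; set a3 := bigop _ _ _; set a4 := bigop _ _ _; clear; lia.
pose lab (x : int * int) := (Ordinal (ltn_pmod `|(x.1 %% (p ^ j)%N%:Z)%Z| (n0 j)),
   Ordinal (ltn_pmod `|(x.2 %% (p ^ j)%N%:Z)%Z| (n0 j))).
have labE x y : (lab x == lab y) = cong (p ^ j)%N x y.
  by rewrite xpair_eqE -!val_eqE /= !residue_eq.
have -> : count (fun x => cong (p ^ j)%N x z) s = count (fun x => lab x == lab z) s.
  by apply: eq_count => x; rewrite labE.
have cardE : #|{: 'I_(p ^ j) * 'I_(p ^ j)}| = (p ^ j.*2)%N.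
  by rewrite card_prod !card_ord -expnD addnn.
have bal := @balanced_of_min _ _ lab s; rewrite cardE in bal; apply: bal.
have lev x y : (lab x == lab y) = level p j.*2 (x - y).
  by rewrite labE /level doubleK uphalf_double.
apply: le_trans (eqk j.*2 _ _).
- rewrite lez_nat leq_eqVlt; apply/orP; left; apply/eqP.
  by apply: eq_bigr => x _; apply: eq_bigr => y _; rewrite lev.
- by rewrite double_gt0.
- by rewrite /B; lia.
Qed.

End Equidistribution.

(** * Unbalanced residue classes of a disc *)

Section ClassGap.
Variables (T M : int).
Hypothesis D0 : 0 < Disc T M.
Variable R : realType.
Local Notation a := (acoord T).
Local Notation Dl := (Disc T M).
Local Notation Qc := (center_dist T M).
Local Notation DR := (Dl%:~R : R).

(** For a given second coordinate the values of [acoord T] are spaced by [2],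
    which explains the tolerance. *)
Lemma lattice_rounding (ca cb : int) (u v : R) : exists z : int * int,
  `|(a z - ca)%:~R - u| <= 2 /\ `|(z.2 - cb)%:~R - v| <= 2.
Proof.
pose y := Num.floor (cb%:~R + v); pose x := Num.floor ((ca%:~R + u - (T * y)%:~R) / 2).
exists (x, y); rewrite /acoord /=.
have /andP[y1 y2] := mem_rg1_floor (cb%:~R + v).
have /andP[x1 x2] := mem_rg1_floor ((ca%:~R + u - (T * y)%:~R) / 2).
move: y1 y2 x1 x2; rewrite -/x -/y !ler_norml !intrD !intrM !rmorphN /=.
set X := x%:~R; set Y := y%:~R; set t := T%:~R; set A := ca%:~R; set B := cb%:~R.
by move=> *; split; lra.
Qed.

Lemma center_distR (ca cb : int) (z : int * int) :
  (Qc ca cb z)%:~R = (a z - ca)%:~R ^+ 2 + DR * (z.2 - cb)%:~R ^+ 2.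
Proof. by rewrite /center_dist [LHS]intrD intrM !rmorphXn. Qed.

Lemma sqr_perturb (l W u d : R) : 0 <= l -> 0 <= W -> `|u| <= W -> `|d| <= 2 ->
  `|(l * u + d) ^+ 2 - l ^+ 2 * u ^+ 2| <= 4 * l * W + 4.
Proof.
move=> l0 W0 uW d2.
have -> : (l * u + d) ^+ 2 - l ^+ 2 * u ^+ 2 = 2 * l * (u * d) + d ^+ 2 by ring.
have h1 : `|u * d| <= W * 2 by rewrite normrM ler_pM.
have h2 : `|d ^+ 2| <= 4.
  by rewrite normrX (_ : 4 = 2 ^+ 2) ?lerXn2r ?nnegrE //; ring.
apply: (le_trans (ler_normD _ _)); apply: lerD => //.
rewrite normrM ger0_norm ?mulr_ge0 //.
have -> : 4 * l * W = 2 * l * (W * 2) by ring.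
by rewrite ler_wpM2l // mulr_ge0.
Qed.

(** Scaled down by [l], the points of a residue class modulo [l] lie in the
    lattice of [qdist], with a center that can be prescribed up to [2 / l]. Take
    the classes that realize the two discs of [chord]: every point of [S] in
    the second class has a translate in the first, which in addition contains
    two points that are not such translates. The threshold [rho] keeps away
    from the axes, where the shape of [S] is not controlled. *)
Lemma class_count_gap (S : seq (int * int)) (ca cb g : int) (l : nat)
    (W eps X rho : R) (c1 c2 : R * R) :
  uniq S -> (0 < l)%N -> 0 < eps -> 0 <= W -> X <= W ^+ 2 -> chord DR X eps g c1 c2 ->
  (forall z : int * int, z \in S ->
     `|a z - ca|%:~R + 2 <= l%:R * W /\ `|z.2 - cb|%:~R + 2 <= l%:R * W) ->
  (1 + DR) * (4 * l%:R * W + 4) <= eps / 2 * l%:R ^+ 2 ->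
  rho <= eps * l%:R - 2 ->
  (forall z : int * int, z \in S -> rho <= `|a z - ca|%:~R -> rho <= `|z.2 - cb|%:~R ->
     (Qc ca cb z)%:~R <= X * l%:R ^+ 2) ->
  (forall z : int * int, (Qc ca cb z)%:~R <= (X - eps / 2) * l%:R ^+ 2 -> z \in S) ->
  exists z1 z2 : int * int,
    (count (fun z => cong l z z2) S + 2 <= count (fun z => cong l z z1) S)%N.
Proof.
move=> uS l0 e0 W0 XW ch ext small rob outer inner.
have lR : 0 < l%:R :> R by rewrite ltr0n.
have D1 : 1 <= DR by rewrite -[1]/(1%:~R) ler_int; lia.
have [z1 [az1 bz1]] := lattice_rounding ca cb (- (l%:R * c1.1)) (- (l%:R * c1.2)).
have [z2 [az2 bz2]] := lattice_rounding ca cb (- (l%:R * c2.1)) (- (l%:R * c2.2)).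
exists z1, z2.
pose pt (z : int * int) (m n : int) : int * int := (z.1 + l%:Z * m, z.2 + l%:Z * n).
have acE z m n : a (pt z m n) - ca = (a z - ca) + l%:Z * (2 * m + T * n).
  by rewrite /acoord /pt /=; ring.
have bcE z m n : (pt z m n).2 - cb = (z.2 - cb) + l%:Z * n.
  by rewrite /pt /=; ring.
have coordR (x c : R) (k : int) : `|x + l%:R * c| <= 2 ->
    exists2 d, `|d| <= 2 & x + (l%:Z * k)%:~R = l%:R * (k%:~R - c) + d.
  move=> h; exists (x + l%:R * c) => //; rewrite intrM -[l%:Z%:~R]/(l%:R); ring.
have modelA z (c : R * R) m n : `|(a z - ca)%:~R - - (l%:R * c.1)| <= 2 ->
    exists2 d, `|d| <= 2 & (a (pt z m n) - ca)%:~R = l%:R * ((2 * m + T * n)%:~R - c.1) + d.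
  by rewrite opprK acE [(_ + l%:Z * _)%:~R]intrD => /coordR; apply.
have modelB z (c : R * R) m n : `|(z.2 - cb)%:~R - - (l%:R * c.2)| <= 2 ->
    exists2 d, `|d| <= 2 & ((pt z m n).2 - cb)%:~R = l%:R * (n%:~R - c.2) + d.
  by rewrite opprK bcE [(_ + l%:Z * _)%:~R]intrD => /coordR; apply.
have modelQ z (c : R * R) m n :
    `|(a z - ca)%:~R - - (l%:R * c.1)| <= 2 -> `|(z.2 - cb)%:~R - - (l%:R * c.2)| <= 2 ->
    `|(2 * m + T * n)%:~R - c.1| <= W -> `|n%:~R - c.2| <= W ->
    `|(Qc ca cb (pt z m n))%:~R - l%:R ^+ 2 * qdist DR c (2 * m + T * n) n| <= eps / 2 * l%:R ^+ 2.
  move=> /(modelA _ _ m n)[d1 d1le e1] /(modelB _ _ m n)[d2 d2le e2] w1 w2.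
  apply: le_trans small; rewrite center_distR e1 e2 /qdist.
  have p1 := sqr_perturb (ltW lR) W0 w1 d1le; have p2 := sqr_perturb (ltW lR) W0 w2 d2le.
  move: p1 p2; set u1 := _ - c.1; set u2 := _ - c.2 => p1 p2.
  have -> : (l%:R * u1 + d1) ^+ 2 + DR * (l%:R * u2 + d2) ^+ 2 -
      l%:R ^+ 2 * (u1 ^+ 2 + DR * u2 ^+ 2) =
     ((l%:R * u1 + d1) ^+ 2 - l%:R ^+ 2 * u1 ^+ 2) +
     DR * ((l%:R * u2 + d2) ^+ 2 - l%:R ^+ 2 * u2 ^+ 2) by ring.
  apply: (le_trans (ler_normD _ _)); rewrite mulrDl mul1r normrM.
  by rewrite (ger0_norm (le_trans ler01 D1)) lerD // ler_wpM2l // (le_trans ler01).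
have boundS z (c : R * R) m n :
    `|(a z - ca)%:~R - - (l%:R * c.1)| <= 2 -> `|(z.2 - cb)%:~R - - (l%:R * c.2)| <= 2 ->
    pt z m n \in S -> `|(2 * m + T * n)%:~R - c.1| <= W /\ `|n%:~R - c.2| <= W.
  move=> /(modelA _ _ m n)[d1 d1le e1] /(modelB _ _ m n)[d2 d2le e2] /ext.
  rewrite !intr_norm e1 e2 => -[h1 h2].
  have gen (u d : R) : `|d| <= 2 -> `|l%:R * u + d| + 2 <= l%:R * W -> `|u| <= W.
    move=> dle h; rewrite -(ler_pM2l lR) -{1}(ger0_norm (ltW lR)) -normrM.
    have -> : l%:R * u = (l%:R * u + d) - d by ring.
    by apply: (le_trans (ler_normB _ _)); move: h dle; clear -D0; lra.
  by split; [apply: gen h1|apply: gen h2].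
have bound1 (c : R * R) m n : qdist DR c m n < X ->
    `|m%:~R - c.1| <= W /\ `|n%:~R - c.2| <= W.
  rewrite /qdist => h.
  have gen (u : R) : u ^+ 2 <= W ^+ 2 -> `|u| <= W.
    by rewrite -[u ^+ 2]real_normK ?num_real // ler_sqr ?nnegrE.
  have s1 := sqr_ge0 (m%:~R - c.1); have s2 := sqr_ge0 (n%:~R - c.2).
  split; apply: gen; nra.
have robust z (c : R * R) m n : c = c1 \/ c = c2 ->
    `|(a z - ca)%:~R - - (l%:R * c.1)| <= 2 -> `|(z.2 - cb)%:~R - - (l%:R * c.2)| <= 2 ->
    rho <= `|a (pt z m n) - ca|%:~R /\ rho <= `|(pt z m n).2 - cb|%:~R.
  move=> hc /(modelA _ _ m n)[d1 d1le e1] /(modelB _ _ m n)[d2 d2le e2].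
  rewrite !intr_norm e1 e2.
  have [o1 o2 _] := chord_off ch (2 * m + T * n) n hc.
  have gen (u d : R) : `|d| <= 2 -> eps <= `|u| -> rho <= `|l%:R * u + d|.
    move=> dle eu; apply: (le_trans rob).
    have h : l%:R * eps <= `|l%:R * u|.
      by rewrite normrM (ger0_norm (ltW lR)) ler_wpM2l // ltW.
    have : `|l%:R * u| <= `|l%:R * u + d| + `|d|.
      have {1}-> : l%:R * u = (l%:R * u + d) - d by ring.
      exact: ler_normB.
    by rewrite [eps * _]mulrC; lra.
  by split; apply: gen.
(* A point of the second class outside the second disc is outside by the
   margin [eps], against [outer]. *)
have out2 m n : pt z2 m n \in S -> qdist DR c2 (2 * m + T * n) n < X.
  move=> zS; have [w1 w2] := boundS _ _ _ _ az2 bz2 zS.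
  have [r1 r2] := robust _ _ m n (or_intror erefl) az2 bz2.
  have le := outer _ zS r1 r2.
  have := modelQ _ _ _ _ az2 bz2 w1 w2; rewrite ler_norml => /andP[lo _].
  have [_ _] := chord_off ch (2 * m + T * n) n (or_intror erefl).
  rewrite ltNge => off; apply/negP => ge; move: off.
  rewrite ger0_norm ?subr_ge0 // => off.
  have l2 : 0 < l%:R ^+ 2 :> R by rewrite exprn_gt0.
  have : l%:R ^+ 2 * (X + eps) <= l%:R ^+ 2 * qdist DR c2 (2 * m + T * n) n.
    by rewrite ler_pM2l //; move: off; clear -D0; lra.
  have : 0 < eps * l%:R ^+ 2 by rewrite mulr_gt0.
  by move: lo le; set q := l%:R ^+ 2; clear -D0; lra.
have in1 m n : qdist DR c1 (2 * m + T * n) n < X -> pt z1 m n \in S.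
  move=> h; have [w1 w2] := bound1 _ _ _ h; apply: inner.
  have := modelQ _ _ _ _ az1 bz1 w1 w2; rewrite ler_norml => /andP[_ up].
  have [_ _] := chord_off ch (2 * m + T * n) n (or_introl erefl).
  rewrite ltr0_norm ?subr_lt0 // => off.
  have : l%:R ^+ 2 * qdist DR c1 (2 * m + T * n) n <= l%:R ^+ 2 * (X - eps).
    by rewrite ler_wpM2l ?sqr_ge0 //; move: off; clear -D0; lra.
  by move: up; set q := l%:R ^+ 2; clear -D0; lra.
pose shift (z : int * int) := z - z2 + z1.
have shift_inj : injective shift by move=> x y /addIr /addIr.
pose extra := [:: pt z1 0 0; pt z1 g 0].
have g0 : g != 0 by case: (chord_g ch) => ->.
have classP z z' : cong l z z' -> exists m n, z = pt z' m n.
  case/andP=> /dvdzP[m mE] /dvdzP[n nE]; exists m, n.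
  by rewrite /pt ![l%:Z * _]mulrC -mE -nE !subrKC; case: (z).
have pt_cong z m n : cong l (pt z m n) z.
  by rewrite /cong /pt /= ![_ + l%:Z * _ - _]addrAC !subrr !add0r !dvdz_mulr.
have not2 m : m = 0 \/ m = g -> pt z2 m 0 \notin S.
  move=> hm; apply/negP => /out2; rewrite [T * 0]mulr0 addr0 ltNge => /negP; apply.
  by apply/ltW/(chord_out ch); case: hm => ->; [left; rewrite mulr0|right].
have shift_pt m n : shift (pt z2 m n) = pt z1 m n.
  rewrite /shift /pt; case: (z1) (z2) => x1 y1 [x2 y2]; congr pair => /=; ring.
rewrite -!size_filter -(size_map shift) -[2%N]/(size extra) -size_cat.
apply: uniq_leq_size.
- rewrite cat_uniq map_inj_uniq ?filter_uniq //=; apply/and3P; split => //.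
    rewrite orbF negb_or; apply/andP; split; apply/mapP => -[z]; rewrite mem_filter => /andP[_ zS].
      rewrite -shift_pt => /shift_inj e; move: zS; rewrite -e.
      by apply/negP/not2; left.
    rewrite -shift_pt => /shift_inj e; move: zS; rewrite -e.
    by apply/negP/not2; right.
  rewrite inE xpair_eqE /=; apply/negP => /andP[/eqP + _].
  move/addrI/(mulfI _) => /(_ _)/esym/eqP; rewrite (negPf g0) => h.
  by suff : false by []; apply: h; case: (l) l0.
- move=> z; rewrite mem_cat => /orP[/mapP[z' + ->]|].
    rewrite mem_filter => /andP[/classP[m [n ->]]] zS.
    by rewrite shift_pt mem_filter pt_cong in1 // (chord_sub ch) // out2.
  rewrite !inE => /orP[] /eqP ->; rewrite mem_filter pt_cong in1 // !mulr0 addr0 (chord_in ch) //.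
    by left.
  by right.
Qed.

End ClassGap.

(** * No large set has a minimal norm product *)

Section Assembly.
Variables (T M : int).
Hypothesis D0 : 0 < Disc T M.
Variable R : realType.
Local Notation a := (acoord T).
Local Notation Dl := (Disc T M).
Local Notation Qc := (center_dist T M).
Local Notation DR := (Dl%:~R : R).

Lemma nrm_gt0 (z : int * int) : z != 0 -> 0 < nrm T M z.
Proof. by move=> /(Q_gt0 D0); rewrite Q_nrm pmulr_rgt0. Qed.

Lemma ln_prod (I : Type) (r : seq I) (P : pred I) (F : I -> nat) :
  (forall i, P i -> 0 < F i)%N ->
  ln (\prod_(i <- r | P i) F i)%N%:R = \sum_(i <- r | P i) ln (F i)%:R :> R.
Proof.
move=> F0; elim: r => [|i r IH]; first by rewrite !big_nil ln1.
rewrite !big_cons; case: ifP => // Pi.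
by rewrite natrM lnM ?IH // posrE ltr0n ?F0 // prodn_cond_gt0.
Qed.

(** The factors [4] come from [Q = 4 nrm]; their number depends on the size of
    [s] alone. *)
Lemma energy_norm_product (s : seq (int * int)) : uniq s ->
  energy (@logQ R T M) s = ln ((4 ^ (size s).-1) ^ size s * norm_product T M s)%N%:R.
Proof.
move=> us.
have pos (x y : int * int) : x != y -> (0 < 4 * `|nrm T M (x - y)%R|)%N.
  by rewrite -subr_eq0 => /nrm_gt0 h; rewrite muln_gt0 absz_gt0 gt_eqF.
have -> : ((4 ^ (size s).-1) ^ size s * norm_product T M s =
   \prod_(x <- s) \prod_(y <- s | y != x) (4 * `|nrm T M (x - y)%R|))%N.
  rewrite -[X in (_ ^ X)%N]sum1_size /norm_product expn_sum -big_split /=.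
  rewrite big_seq [RHS]big_seq; apply: eq_bigr => x xs.
  rewrite expn1 big_split /= big_const_seq iter_muln_1; congr (_ ^ _ * _)%N.
  have := count_predC (pred1 x) s; rewrite count_uniq_mem // xs add1n => <-.
  exact: eq_count.
rewrite ln_prod; last by move=> x _; apply: prodn_cond_gt0 => y; rewrite eq_sym => /pos.
rewrite /energy; rewrite big_seq [RHS]big_seq; apply: eq_bigr => x xs.
rewrite (bigD1_seq x) //= {1}/logQ subrr (eqP (_ : Q T M 0 == 0)) ?Q_eq0 // ln0 //.
rewrite add0r ln_prod; last by move=> y; rewrite eq_sym => /pos.
apply: eq_bigr => y; rewrite eq_sym -subr_eq0 => /nrm_gt0 h.
by rewrite /logQ Q_nrm -{1}(gtz0_abs h) natrM intrM.
Qed.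

Lemma minimal_of_dvd (s : seq (int * int)) : uniq s ->
  (forall t, uniq t -> size t = size s -> (norm_product T M s %| norm_product T M t)%N) ->
  minimal T M R s.
Proof.
move=> us h t ut st; rewrite !energy_norm_product // st.
have pos (r : seq (int * int)) : (0 < norm_product T M r)%N.
  apply: prodn_gt0 => x; apply: prodn_cond_gt0 => y.
  by rewrite eq_sym -subr_eq0 => /nrm_gt0 h'; rewrite absz_gt0 gt_eqF.
have pos2 r : (0 < (4 ^ (size s).-1) ^ size s * norm_product T M r)%N.
  by rewrite muln_gt0 pos !expn_gt0.
rewrite ler_ln ?posrE ?ltr0n // ler_nat leq_mul2l.
by rewrite (dvdn_leq (pos t)) ?orbT // h.
Qed.

Lemma seq_argmax (s : seq (int * int)) (f : int * int -> int) : s != [::] ->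
  exists2 x, x \in s & forall y, y \in s -> f y <= f x.
Proof.
elim: s => // x s IH _; have [->|/IH[y ys hy]] := eqVneq s [::].
  by exists x; rewrite ?mem_head // => y; rewrite inE => /eqP ->.
have [h|h] := leP (f x) (f y).
  exists y; first by rewrite inE ys orbT.
  by move=> z; rewrite inE => /orP[/eqP ->|/hy].
exists x; first by rewrite mem_head.
by move=> z; rewrite inE => /orP[/eqP ->|/hy /le_trans ->] //; exact: ltW.
Qed.

Lemma count_window (S : seq (int * int)) (ca cb : int) (n1 n2 : nat) : uniq S ->
  (count (fun z : int * int => (`|a z - ca| <= n1%:Z)%R && (`|z.2 - cb| <= n2%:Z)%R) S
   <= (2 * n1).+1 * (2 * n2).+1)%N.
Proof.
move=> uS; rewrite -size_filter.
apply: (@count_box _ (fun z => (a z, z.2)) (ca - n1%:Z) (cb - n2%:Z)).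
- exact: filter_uniq.
- by move=> x y _ _ [h1 h2]; exact: acoord_inj h1 h2.
- by move=> z; rewrite mem_filter => /andP[/andP[h1 h2] _] /=; lia.
Qed.

(** Otherwise [S] would be covered by two thin strips along the axes and a box of
    side [10 l], too few points. *)
Lemma far_point (S : seq (int * int)) (ca cb : int) (H p l Y : nat) : uniq S ->
  (0 < p)%N -> (0 < l)%N -> (120 * p ^ 2 <= H)%N -> (16 * p <= Y)%N -> (160 * p ^ 2 <= Y * l)%N ->
  (forall z : int * int, z \in S -> `|a z - ca| < 2 * (Y * l)%N%:Z /\ `|z.2 - cb| < 2 * (Y * l)%N%:Z) ->
  ((Y * l) ^ 2 <= p ^ 2 * size S)%N ->
  exists z : int * int, [/\ z \in S, (Y * l)%N%:Z <= H%:Z * `|a z - ca|,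
    (Y * l)%N%:Z <= H%:Z * `|z.2 - cb| & 25 * l%:Z ^+ 2 <= Qc ca cb z].
Proof.
move=> uS p0 l0 Hp Yp Lp ext big.
set L := (Y * l)%N in Lp ext big *.
pose ok (z : int * int) := [&& L%:Z <= H%:Z * `|a z - ca|,
    L%:Z <= H%:Z * `|z.2 - cb| & 25 * l%:Z ^+ 2 <= Qc ca cb z].
have [/hasP[z zS /and3P[h1 h2 h3]]|/hasPn none] := boolP (has ok S); first by exists z.
exfalso.
have H0 : (0 < H)%N by apply: leq_trans Hp; rewrite muln_gt0 expn_gt0 p0.
pose h := (L %/ H)%N.
pose p1 (z : int * int) := (`|a z - ca| <= h%:Z) && (`|z.2 - cb| <= (2 * L)%N%:Z).
pose p2 (z : int * int) := (`|a z - ca| <= (2 * L)%N%:Z) && (`|z.2 - cb| <= h%:Z).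
pose p3 (z : int * int) := (`|a z - ca| <= (5 * l)%N%:Z) && (`|z.2 - cb| <= (5 * l)%N%:Z).
have small (x : int) : 0 <= x -> H%:Z * x < L%:Z -> x <= h%:Z.
  case: x => // x _; rewrite -PoszM ltz_nat lez_nat => lt.
  by rewrite /h leq_divRL // mulnC ltnW.
have cover z : z \in S -> predU p1 (predU p2 p3) z.
  move=> zS; have [e1 e2] := ext z zS; have := none z zS.
  rewrite /= /ok !negb_and -!ltNge => /or3P[/small h1|/small h1|h1].
  - by apply/orP; left; rewrite /p1 h1 //= PoszM ltW.
  - by apply/orP; right; apply/orP; left; rewrite /p2 h1 // PoszM ltW.
  apply/orP; right; apply/orP; right.
  have lq (x : int) : x ^+ 2 < 25 * l%:Z ^+ 2 -> `|x| <= (5 * l)%N%:Z.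
    rewrite -[x ^+ 2]real_normK ?num_real // (_ : 25 * _ = (5 * l)%N%:Z ^+ 2); last first.
      by rewrite PoszM; ring.
    by rewrite ltr_sqr ?nnegrE // => /ltW.
  have q1 := sqr_ge0 (a z - ca); have q2 := sqr_ge0 (z.2 - cb).
  have h2 : (a z - ca) ^+ 2 + Dl * (z.2 - cb) ^+ 2 < 25 * l%:Z ^+ 2 by [].
  have q3 : (z.2 - cb) ^+ 2 <= Dl * (z.2 - cb) ^+ 2 by rewrite ler_peMl //; lia.
  have q4 : 0 <= Dl * (z.2 - cb) ^+ 2 by rewrite mulr_ge0 // ltW.
  by rewrite /p3 !lq // (le_lt_trans _ h2) // ?lerDl // (le_trans q3) // lerDr.
have countU (P1 P2 : pred (int * int)) : (count (predU P1 P2) S <= count P1 S + count P2 S)%N.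
  by rewrite -count_predUI leq_addr.
have total : (size S <= 2 * ((2 * h).+1 * (4 * L).+1) + (10 * l).+1 ^ 2)%N.
  have c1 := count_window ca cb h (2 * L) uS; have c2 := count_window ca cb (2 * L) h uS.
  have c3 := count_window ca cb (5 * l) (5 * l) uS.
  have /allP : forall z, z \in S -> predU p1 (predU p2 p3) z by [].
  rewrite all_count => /eqP <-; apply: (leq_trans (countU _ _)).
  rewrite mul2n -addnn -addnA leq_add //; first by rewrite (leq_trans c1) // mulnA.
  apply: (leq_trans (countU _ _)); rewrite leq_add //.
    by rewrite (leq_trans c2) // mulnA mulnC.
  by rewrite (leq_trans c3) // mulnA -mulnn.
have hL : (h * H <= L)%N by rewrite leq_trunc_div.
have lL : (16 * p * l <= L)%N by rewrite leq_mul2r Yp orbT.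
have hL' : (120 * p ^ 2 * h <= L)%N by rewrite (leq_trans _ hL) // mulnC leq_mul2l Hp orbT.
have L0 : (0 < L)%N by rewrite (leq_trans _ Lp) // muln_gt0 expn_gt0 p0.
have bound : (p ^ 2 * size S <= p ^ 2 * (2 * ((2 * h).+1 * (5 * L)) + (11 * l) ^ 2))%N.
  rewrite leq_mul2l (leq_trans total) ?orbT // leq_add //.
    by rewrite !leq_mul2l; apply/orP; right; move: L0; clear; lia.
  by rewrite leq_exp2r //; move: l0; clear; lia.
have := leq_trans big bound.
have s1 : (p ^ 2 * (2 * ((2 * h).+1 * (5 * L))) = 20 * (p ^ 2 * h) * L + 10 * p ^ 2 * L)%N.
  by move: (p ^ 2)%N; clear => q; lia.
have s2 : (120 * p ^ 2 * h * L <= L * L)%N by rewrite leq_mul2r hL' orbT.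
have s3 : (160 * p ^ 2 * L <= L * L)%N by rewrite leq_mul2r Lp orbT.
have s4 : ((16 * p * l) ^ 2 <= L ^ 2)%N by rewrite leq_exp2r.
have L2 : (0 < L * L)%N by rewrite muln_gt0 L0.
move: s1 s2 s3 s4 L2; rewrite mulnDr => ->; rewrite -[(L ^ 2)%N]mulnn !expnMn.
rewrite -[(120 * _ * h)%N]mulnA -[(120 * _ * L)%N]mulnA -[(160 * _ * L)%N]mulnA -[(10 * _ * L)%N]mulnA
  -[(20 * _ * L)%N]mulnA -[(16 ^ 2 * _ * _)%N]mulnA [(p ^ 2 * (11 ^ 2 * _))%N]mulnCA.
move: (p ^ 2 * h * L)%N (p ^ 2 * L)%N (L * L)%N (p ^ 2 * l ^ 2)%N; clear => x1 x2 x3 x4.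
have -> : (16 ^ 2 = 256)%N by [].
have -> : (11 ^ 2 = 121)%N by [].
lia.
Qed.

(** [L = p ^ k] is the smallest scale with more classes than points, so that
    a class contains at most one point; it controls the diameter of [S]. At the scale
    [l = L / Y], with [Y] fixed, [S] looks like a disc of squared radius [X]
    between [25] and [B], up to an error that is small compared with the margin
    of [chord_uniform]. *)
Lemma no_norm_optimal (p : nat) : prime p -> (p%:Z %| T)%Z -> (p%:Z %| M)%Z ->
  ~~ ((p ^ 2)%N%:Z %| M)%Z ->
  exists N : nat, forall s : seq (int * int), uniq s -> (N <= size s)%N ->
  ~ forall t, uniq t -> size t = size s -> (norm_product T M s %| norm_product T M t)%N.
Proof.
move=> pp pT pM pM2; have p1 := prime_gt1 pp; have p0 := ltnW p1.
have D1 : 1 <= DR by rewrite -[1]/(1%:~R) ler_int; lia.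
pose Y := (p ^ 5)%N; have Y0 : (0 < Y)%N by rewrite expn_gt0 p0.
have Yp : (16 * p <= Y)%N.
  rewrite /Y expnSr leq_mul2r; apply/orP; right.
  by rewrite (@leq_trans (2 ^ 4)) // leq_exp2r.
pose B : R := 4 * (1 + DR) * Y%:R ^+ 2; pose W : R := 4 * (1 + DR) * Y%:R.
have [eps e0 chordH] := chord_uniform D1 B.
(* The strips of relative width [1 / H] along the axes are neglected; they have
   to be thin for [far_point] and compared with the margin [eps]. *)
have [H HE] := exists_nat_gt (4 * Y%:R ^+ 2 / eps + (120 * p ^ 2)%:R).
have YR : 1 <= Y%:R :> R by rewrite ler1n.
have W1 : 1 <= W by rewrite /W; nra.
have eH : 4 * Y%:R ^+ 2 <= eps * H%:R.
  by rewrite [eps * _]mulrC -ler_pdivrMr // ltW // (le_lt_trans _ HE) // lerDl ler0n.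
have Hp : (120 * p ^ 2 <= H)%N.
  rewrite -(ler_nat R) ltW // (le_lt_trans _ HE) // lerDr divr_ge0 ?mulr_ge0 ?sqr_ge0 //.
  exact: ltW.
have H0 : (0 < H)%N by apply: leq_trans Hp; rewrite muln_gt0 expn_gt0 p0.
have [L0 disc] := @disc_property T M D0 R H (p ^ 2) H0.
have [l0 l0E] := exists_nat_gt (16 * (1 + DR) * (W + 1) / eps).
pose L1 := (L0 + Y * l0 + 160 * p ^ 2 + Y)%N.
have [L01 l01 p21 Y1] : [/\ L0 <= L1, Y * l0 <= L1, 160 * p ^ 2 <= L1 & Y <= L1]%N.
  have parts (u v x y : nat) :
      [/\ u <= u + v + x + y, v <= u + v + x + y, x <= u + v + x + y & y <= u + v + x + y]%N.
    by clear; split; lia.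
  exact: parts.
exists (L1 ^ 2)%N => s us big dvd.
have mS := minimal_of_dvd us dvd.
have [k kE kmin] : exists2 k, (size s < (p ^ k) ^ 2)%N &
    forall j, (size s < (p ^ j) ^ 2)%N -> (k <= j)%N.
  have ex : exists k, (size s < (p ^ k) ^ 2)%N.
    exists (size s); apply: (leq_trans (ltn_expl _ p1)).
    by rewrite -mulnn leq_pmulr // expn_gt0 p0.
  by case: (ex_minnP ex) => k; exists k.
pose L := (p ^ k)%N.
have L1L : (L1 < L)%N by rewrite -(ltn_exp2r _ _ (isT : 0 < 2)%N) (leq_ltn_trans big).
have k5 : (5 < k)%N.
  by rewrite -(ltn_exp2l _ _ p1) (leq_trans _ L1L) // ltnS.
pose l := (p ^ (k - 5))%N; have lpos : (0 < l)%N by rewrite expn_gt0 p0.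
have LE : L = (Y * l)%N by rewrite /L /Y /l -expnD subnKC // ltnW.
have l0l : (l0 <= l)%N.
  by rewrite -(leq_pmul2l Y0) -LE (leq_trans l01) // ltnW.
have Lbig : (L ^ 2 <= p ^ 2 * size s)%N.
  have k0 : (0 < k)%N by apply: leq_trans k5.
  have : ~~ (size s < (p ^ k.-1) ^ 2)%N.
    by apply/negP => /kmin; rewrite leqNgt prednK ?leqnn.
  have LS : L = (p * p ^ k.-1)%N by rewrite -expnS prednK.
  by rewrite -leqNgt LS expnMn => ?; rewrite leq_mul2l; apply/orP; right.
have npos (z : int * int) : z != 0 -> (0 < `|nrm T M z|)%N.
  by move=> z0; rewrite absz_gt0 gt_eqF // nrm_gt0.
have bal := classes_balanced pp pT pM pM2 npos us dvd.
have inj : {in s &, forall x y, cong L x y -> x = y}.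
  move=> x y xs ys xy; apply/eqP/contraT => ne.
  have /andP[_] := bal k y; rewrite -[X in (X <= _)%N]size_filter.
  rewrite divn_small; last by rewrite -muln2 expnM.
  rewrite leqNgt => /negP[]; apply: (@uniq_leq_size _ [:: x; y]).
    by rewrite /= inE ne.
  move=> z; rewrite !inE mem_filter => /orP[] /eqP -> //.
    by rewrite xs andbT.
  by rewrite ys /cong !subrr !dvdz0.
have s0 : s != [::].
  by apply/eqP => s0; move: Lbig; rewrite s0 muln0 leqNgt /L !expn_gt0 p0.
have [ca [cb cS]] := minimal_centered D0 s0 us mS.
have ext := extent_lt cS (_ : 0 < L%:Z) inj.
have {}ext : forall z : int * int, z \in s -> `|a z - ca| < 2 * L%:Z /\ `|z.2 - cb| < 2 * L%:Z.
  by apply: ext; rewrite ltz_nat /L expn_gt0 p0.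
have [z0 [z0s z0a z0b z0Q]] : exists z : int * int, [/\ z \in s, L%:Z <= H%:Z * `|a z - ca|,
    L%:Z <= H%:Z * `|z.2 - cb| & 25 * l%:Z ^+ 2 <= Qc ca cb z].
  rewrite LE; apply: (@far_point s ca cb H p l Y) => //.
  - by rewrite -LE (leq_trans p21) // ltnW.
  - by move=> z; rewrite -LE; exact: ext.
  - by rewrite -LE.
pose robust (z : int * int) := (L%:Z <= H%:Z * `|a z - ca|) && (L%:Z <= H%:Z * `|z.2 - cb|).
have [|s1 + s1max] := @seq_argmax [seq z <- s | robust z] (Qc ca cb).
  have : z0 \in [seq z <- s | robust z] by rewrite mem_filter z0s /robust z0a z0b.
  by case: (seq.filter _ _).
rewrite mem_filter => /andP[/andP[s1a s1b] s1s].
have lR : 0 < l%:R :> R by rewrite ltr0n.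
pose X : R := (Qc ca cb s1)%:~R / l%:R ^+ 2.
have XE : X * l%:R ^+ 2 = (Qc ca cb s1)%:~R by rewrite divfK // expf_neq0 // gt_eqF.
have LR : (L%:Z)%:~R = Y%:R * l%:R :> R by rewrite LE -natrM.
have l2 : 0 < l%:R ^+ 2 :> R by rewrite exprn_gt0.
have X25 : 25 <= X.
  rewrite ler_pdivlMr // -[25]/(25%:~R) -[l%:R]/((l%:Z)%:~R) -rmorphXn -intrM ler_int.
  by apply: le_trans z0Q (s1max _ _); rewrite mem_filter z0s /robust z0a z0b.
have extR (z : int * int) : z \in s ->
    `|(a z - ca)%:~R| <= 2 * (Y%:R * l%:R) :> R /\ `|(z.2 - cb)%:~R| <= 2 * (Y%:R * l%:R) :> R.
  move=> /ext[h1 h2]; rewrite -!intr_norm -LR.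
  by split; [have := h1|have := h2]; rewrite -(ltr_int R) intrM => /ltW.
have XB : X <= B.
  rewrite ler_pdivrMr // center_distR; have [h1 h2] := extR _ s1s.
  have sq (u : R) : `|u| <= 2 * (Y%:R * l%:R) -> u ^+ 2 <= 4 * Y%:R ^+ 2 * l%:R ^+ 2.
    rewrite -[u ^+ 2]real_normK ?num_real // (_ : 4 * _ * _ = (2 * (Y%:R * l%:R)) ^+ 2); last by ring.
    by move=> h; rewrite ler_sqr ?nnegrE // (le_trans _ h).
  have -> : B * l%:R ^+ 2 = 4 * Y%:R ^+ 2 * l%:R ^+ 2 + DR * (4 * Y%:R ^+ 2 * l%:R ^+ 2).
    by rewrite /B; ring.
  by rewrite lerD ?sq // ler_wpM2l ?sq // (le_trans ler01).
have [g [c1 [c2 ch]]] := chordH X (introT andP (conj X25 XB)).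
have lgt : 16 * (1 + DR) * (W + 1) < eps * l%:R.
  rewrite [eps * _]mulrC -ltr_pdivrMr //; apply: (lt_le_trans l0E).
  by rewrite ler_nat.
have margin : (1 + DR) * (4 * l%:R * W + 4) <= eps / 2 * l%:R ^+ 2.
  have gen (d w e x : R) : 1 <= d -> 1 <= w -> 1 <= x -> 16 * (1 + d) * (w + 1) < e * x ->
      (1 + d) * (4 * x * w + 4) <= e / 2 * x ^+ 2.
    clear=> d1 w1 x1 lt; rewrite [e / 2 * _](_ : _ = 2^-1 * (e * x) * x); last by ring.
    apply: (@le_trans _ _ ((1 + d) * (4 * (w + 1)) * x)).
      by rewrite -[leRHS]mulrA ler_wpM2l; lra.
    have pos : 0 <= (1 + d) * (w + 1) by rewrite mulr_ge0; lra.
    by rewrite ler_wpM2r; lra.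
  by apply: gen; rewrite ?ler1n.
have l1 : 1 <= l%:R :> R by rewrite ler1n.
have HR : 0 < H%:R :> R by rewrite ltr0n.
have [] := @class_count_gap T M D0 R s ca cb g l W eps X (Y%:R * l%:R / H%:R) c1 c2 us lpos e0 _ _ ch.
- exact: le_trans W1.
- apply: (le_trans XB); rewrite /B /W.
  have -> : (4 * (1 + DR) * Y%:R) ^+ 2 = 4 * (1 + DR) * (4 * (1 + DR) * Y%:R ^+ 2) by ring.
  have D0' : 0 <= DR := le_trans ler01 D1.
  apply: ler_peMl; first by rewrite mulr_ge0 ?sqr_ge0 // mulr_ge0 // addr_ge0.
  by rewrite mulr_ege1 ?ler1n // lerDl.
- move=> z /extR; rewrite !intr_norm => -[h1 h2].
  have big2 : 2 * (Y%:R * l%:R) + 2 <= l%:R * W :> R.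
    have -> : l%:R * W = 4 * (1 + DR) * (Y%:R * l%:R) by rewrite /W; ring.
    have : 1 <= Y%:R * l%:R :> R by rewrite mulr_ege1.
    by move: D1; move: (Y%:R * l%:R : R) DR; clear => u v; nra.
  by split; apply: le_trans big2; rewrite lerD2r.
- exact: margin.
- rewrite ler_pdivrMr //.
  have h1 : (Y%:R * l%:R) * 4 <= eps * l%:R * H%:R.
    have h2 : 4 * Y%:R * l%:R <= 4 * Y%:R ^+ 2 * l%:R :> R.
      by rewrite ler_wpM2r ?ler0n // ler_wpM2l // expr2 ler_peMr // (le_trans ler01).
    have -> : Y%:R * l%:R * 4 = 4 * Y%:R * l%:R :> R by ring.
    by rewrite (le_trans h2) // [leRHS]mulrAC ler_wpM2r ?ler0n.
  have h3 : 4 * H%:R <= eps * l%:R * H%:R.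
    rewrite ler_wpM2r ?ler0n //; move: lgt.
    have : 16 <= 16 * (1 + DR) * (W + 1) by rewrite -mulrA ler_peMr // mulr_ege1 ?lerDl ?lerDr ?(le_trans ler01).
    by clear -D0; lra.
  by rewrite mulrBl; move: h1 h3 HR; clear -D0; lra.
- move=> z zs h1 h2; rewrite XE ler_int; apply: s1max; rewrite mem_filter zs /robust.
  by move: h1 h2; rewrite !ler_pdivrMr // -LR ![_ * H%:R]mulrC -[H%:R]/((H%:Z)%:~R) -!intrM !ler_int => -> ->.
- move=> z zQ; apply/negPn/negP => zs.
  have := disc s ca cb L s1 z (leq_trans L01 (ltnW L1L)) us mS cS ext kE Lbig s1s s1a s1b zs.
  apply/negP; rewrite -leNgt -(ler_int R) intrM rmorphXn /= LR intrB -XE.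
  have h1 : eps / 2 * l%:R ^+ 2 <= X * l%:R ^+ 2 - (Qc ca cb z)%:~R.
    by move: zQ; rewrite mulrBl; clear -D0; lra.
  have h2 : (Y%:R * l%:R) ^+ 2 <= H%:R * (eps / 2 * l%:R ^+ 2).
    have -> : H%:R * (eps / 2 * l%:R ^+ 2) = 2^-1 * (eps * H%:R) * l%:R ^+ 2 by ring.
    rewrite exprMn ler_wpM2r ?sqr_ge0 //.
    by have := sqr_ge0 (Y%:R : R); move: eH; clear -D0; lra.
  by rewrite (le_trans h2) // ler_wpM2l // ltW.
move=> z1 [z2]; have /andP[+ _] := bal (k - 5)%N z2; have /andP[_] := bal (k - 5)%N z1.
rewrite -/l; move: (count _ _) (count _ _) => x y.
by move: (_ %/ _)%N; clear => q; lia.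
Qed.

End Assembly.

(** * The ring of integers of an imaginary quadratic field *)

Section Quadratic.
Variable K : fieldExtType rat.
Hypothesis dimK : \dim {:K} = 2%N.

Definition irrational (x : K) : Prop := forall r : rat, x <> r%:A.

Lemma irrationalP (x : K) : irrational x <-> x \notin 1%VS.
Proof.
split=> [h|h r e]; first by apply/negP => /vlineP[r]; exact: h.
by move: h; rewrite e; apply/negP/negPn/vlineP; exists r.
Qed.

Lemma irrational_exists : exists x : K, irrational x.
Proof.
have : ~~ ({:K} <= 1)%VS.
  by apply/negP => /dimvS; rewrite dimK dimv1.
by case/subvPn => x _ x1; exists x; apply/irrationalP.
Qed.

Lemma quadratic_basis (th : K) : irrational th ->
  forall x : K, exists r s : rat, x = r%:A + s *: th.
Proof.
move=> /irrationalP th1 x.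
have full : (1%VS + <[th]>)%VS = fullv.
  apply/eqP; rewrite eqEdim subvf dimK /= ltn_neqAle.
  have [le eq] := dimv_leqif_eq (addvSl 1%VS <[th]>%VS).
  rewrite dimv1 in le eq; rewrite eq le andbT; apply: contra th1 => /eqP ->.
  by apply: (subvP (addvSr _ _)); exact: memv_line.
have : x \in (1%VS + <[th]>)%VS by rewrite full memvf.
by case/memv_addP => _ /vlineP[r ->] [_ /vlineP[s ->] ->]; exists r, s.
Qed.

Lemma quadratic_unique (th : K) (r s r' s' : rat) : irrational th ->
  r%:A + s *: th = r'%:A + s' *: th -> r = r' /\ s = s'.
Proof.
move=> ith e; have h : (s - s') *: th = (r' - r)%:A.
  by rewrite !scalerBl -[_ *: th](addrK (r%:A)) [_ + r%:A]addrC e addrAC addrK addrC.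
have [ss|ss] := eqVneq s s'.
  by split=> //; apply: (fmorph_inj (in_alg K)); move: e; rewrite ss => /addIr.
case: (ith ((s - s')^-1 * (r' - r))).
by rewrite -scalerA -h scalerA mulVf ?scale1r // subr_eq0.
Qed.

Lemma square_root_exists : exists (de : K) (D : int), irrational de /\ de ^+ 2 = D%:~R.
Proof.
have [th ith] := irrational_exists.
have [c [b thE]] := quadratic_basis ith (th ^+ 2).
pose de1 := th - (b / 2)%:A; pose e := c + (b / 2) ^+ 2.
have de1E : de1 ^+ 2 = e%:A.
  have bth : b *: th = th * (b / 2)%:A *+ 2.
    by rewrite mulr_algr scalerMnl -mulr_natr divfK.
  by rewrite /de1 sqrrB thE -bth addrK /e scalerDl exprZn expr1n.
exists ((denq e)%:~R *: de1), (numq e * denq e); split.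
  move=> r h; apply: (ith ((denq e)%:~R^-1 * r + b / 2)).
  rewrite scalerDl -[(_^-1 * r) *: _]scalerA -h scalerA mulVf ?intr_eq0 ?denq_eq0 // scale1r.
  by rewrite /de1 subrK.
rewrite exprZn de1E scalerA -[LHS]/(in_alg K _) -[RHS](rmorph_int (in_alg K)); congr (in_alg K _).
by rewrite intrM numqE; ring.
Qed.

(** Among the irrational square roots of integers take one whose square has
    minimal absolute value: if [q ^ 2] divided the square, dividing the root
    by [q] would make it smaller. *)
Lemma squarefree_root_exists : exists (de : K) (D : int),
  [/\ irrational de, de ^+ 2 = D%:~R, D != 0 & forall q : nat, ((q ^ 2)%N%:Z %| D)%Z -> q = 1%N].
Proof.
pose P (n : nat) := `[< exists (de : K) (D : int), [/\ irrational de, de ^+ 2 = D%:~R & `|D|%N = n] >].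
have ex : exists n, P n.
  have [de [D [h1 h2]]] := square_root_exists.
  by exists `|D|%N; apply/asboolP; exists de, D.
case: (ex_minnP ex) => n /asboolP[de [D [ide deE Dn]]] nmin.
have D0 : D != 0.
  apply/eqP => D0; move/eqP: deE; rewrite D0 expf_eq0 /= => /eqP de0.
  by apply: (ide 0); rewrite de0 scale0r.
exists de, D; split=> // q /dvdzP[D' DE].
have q0 : q != 0%N by apply: contra D0 => /eqP q0; rewrite DE q0 mulr0.
have D'0 : (0 < `|D'|)%N by rewrite absz_gt0; apply: contra D0 => /eqP e; rewrite DE e mul0r.
have qQ : q%:R != 0 :> rat by rewrite pnatr_eq0.
have : P `|D'|%N.
  apply/asboolP; exists (q%:R^-1 *: de), D'; split=> // [r h|].
    by apply: (ide (q%:R * r)); rewrite -scalerA -h scalerA mulfV // scale1r.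
  rewrite exprZn deE DE PoszX [X in _ *: X]rmorphM rmorphXn /= scalerAr.
  have -> : (q%:R^-1 ^+ 2) *: ((q%:Z)%:~R ^+ 2) = 1 :> K.
    by rewrite -exprZn -[(q%:Z)%:~R]/(q%:R : K) -(scaler_nat q (1 : K)) scalerA mulVf // scale1r expr1n.
  by rewrite mulr1.
move/nmin; rewrite -Dn DE abszM /= -[leqRHS]muln1 leq_pmul2l //.
by case: q q0 {DE qQ} => [|[|q]].
Qed.

Variables (de : K) (D : int) (z : algC).
Hypotheses (ide : irrational de) (deE : de ^+ 2 = D%:~R) (zE : z ^+ 2 = D%:~R).

Lemma quadratic_embedding : exists iota : {rmorphism K -> algC},
  forall r s : rat, iota (r%:A + s *: de) = ratr r + ratr s * z.
Proof.
have /choice[co coP] : forall x : K, exists p : rat * rat, x = p.1%:A + p.2 *: de.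
  move=> x; have [r [s ->]] := quadratic_basis ide x; exists (r, s); reflexivity.
pose f x : algC := ratr (co x).1 + ratr (co x).2 * z.
have fE r s : f (r%:A + s *: de) = ratr r + ratr s * z.
  by rewrite /f; have [<- <-] := quadratic_unique ide (coP (r%:A + s *: de)).
have fB : zmod_morphism f.
  move=> x y; rewrite (coP x) (coP y) opprD addrACA -!scalerBl !fE !rmorphB /=; ring.
have gen (L : comNzRingType) (a b a' b' d : L) :
    (a + b * d) * (a' + b' * d) = (a * a' + b * b' * d ^+ 2) + (a * b' + b * a') * d by ring.
have fM : monoid_morphism f.
  split; first by have := fE 1 0; rewrite scale1r scale0r addr0 rmorph1 rmorph0 mul0r addr0.
  move=> x y; rewrite (coP x) (coP y) !fE.
  move: (co x).1 (co x).2 (co y).1 (co y).2 => r s r' s'.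
  have -> : (r%:A + s *: de) * (r'%:A + s' *: de) =
      (r * r' + s * s' * D%:~R)%:A + (r * s' + s * r') *: de.
    rewrite -!(mulr_algl _ de) -![_%:A]/(in_alg K _) !(rmorphD, rmorphM) rmorph_int -deE.
    exact: gen.
  rewrite fE !(rmorphD, rmorphM) /= ratr_int -zE gen.
  reflexivity.
pose F : {rmorphism K -> algC} := HB.pack f
  (GRing.isZmodMorphism.Build _ _ f fB) (GRing.isMonoidMorphism.Build _ _ f fM).
by exists F.
Qed.
End Quadratic.

Lemma imaginary_conj (d : nat) (r s : rat) :
  (ratr r + ratr s * ('i * sqrtC d%:R))^* = ratr r - ratr s * ('i * sqrtC d%:R) :> algC.
Proof.
have sq : (sqrtC d%:R)^* = sqrtC d%:R :> algC.
  by rewrite conj_Creal // ger0_real // sqrtC_ge0 ler0n.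
have ci : ('i : algC)^* = - 'i by rewrite conjCi.
rewrite [LHS]rmorphD /= [(ratr s * _)^*]rmorphM /= [('i * _)^*]rmorphM /= ci sq.
by rewrite !conj_Crat ?Crat_rat // mulNr mulrN.
Qed.

Lemma imaginary_sqr (d : nat) : ('i * sqrtC d%:R) ^+ 2 = (- d%:Z)%:~R :> algC.
Proof. by rewrite exprMn sqrCi sqrtCK mulN1r rmorphN. Qed.

Lemma imaginary_norm (d : nat) (r s : rat) :
  `|ratr r + ratr s * ('i * sqrtC d%:R)| ^+ 2 = ratr (r ^+ 2 + d%:R * s ^+ 2) :> algC.
Proof.
rewrite normCK imaginary_conj [LHS]mulrC -subr_sqr [(ratr s * _) ^+ 2]exprMn imaginary_sqr.
rewrite rmorphN mulrN opprK [_ * d%:R in LHS]mulrC.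
by apply/esym; rewrite [LHS]rmorphD /= [X in _ + X]rmorphM /= !rmorphXn /= rmorph_nat.
Qed.

(** The trace [2 r] and the norm [r ^ 2 + d s ^ 2] are integers, hence so is
    [d (2 s) ^ 2]; as [d] is squarefree, [2 s] is an integer. *)
Lemma integral_half_integers (K : fieldExtType rat) (iota : {rmorphism K -> algC})
    (de : K) (d : nat) (r s : rat) :
  (forall q : nat, ((q ^ 2)%N %| d)%N -> q = 1%N) ->
  (forall r s : rat, iota (r%:A + s *: de) = ratr r + ratr s * ('i * sqrtC d%:R)) ->
  integralOver (intr : int -> K) (r%:A + s *: de) ->
  exists u v : int, [/\ r = u%:~R / 2, s = v%:~R / 2 & (4 %| u ^+ 2 + d%:Z * v ^+ 2)%Z].
Proof.
move=> sqf iE [P mP rP]; set x := r%:A + s *: de in rP.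
have Ai : iota x \in Aint.
  apply: (@root_monic_Aint (map_poly intr P)).
  - have -> : map_poly intr P = map_poly iota (map_poly intr P) :> {poly algC}.
      by rewrite -map_poly_comp; apply: eq_map_poly => n /=; rewrite rmorph_int.
    by rewrite rmorph_root.
  - by rewrite monic_map.
  - by apply/polyOverP => i; rewrite coef_map /= rpred_int.
have cE : (iota x)^* = ratr r - ratr s * ('i * sqrtC d%:R) by rewrite iE imaginary_conj.
have Ac : (iota x)^* \in Aint by rewrite (Aint_aut Num.conj).
have rat_int (y : rat) : ratr y \in Aint -> exists n : int, y = n%:~R.
  move=> /Cint_rat_Aint-/(_ (Crat_rat y))/intrP[n nE]; exists n.
  by rewrite -[n%:~R](ratr_int algC) in nE; exact: fmorph_inj nE.
have [u uE] : exists u : int, 2 * r = u%:~R.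
  apply: rat_int; have -> : ratr (2 * r) = iota x + (iota x)^* :> algC.
    by rewrite cE iE rmorphM /= rmorph_nat; ring.
  exact: rpredD.
have [n nE] : exists n : int, r ^+ 2 + d%:R * s ^+ 2 = n%:~R.
  apply: rat_int; have -> : ratr (r ^+ 2 + d%:R * s ^+ 2) = iota x * (iota x)^* :> algC.
    by rewrite -normCK iE imaginary_norm.
  exact: rpredM.
have tE : d%:R * (2 * s) ^+ 2 = (4 * n - u ^+ 2)%:~R.
  rewrite rmorphB rmorphM rmorphXn /= -uE -nE; ring.
have [v vE] : exists v : int, 2 * s = v%:~R.
  exists (numq (2 * s)); move: tE; set t := 2 * s => tE.
  have cop := coprime_num_den t; have den0 := denq_gt0 t.
  have e : d%:Z * numq t ^+ 2 = (4 * n - u ^+ 2) * denq t ^+ 2.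
    apply: (@intr_inj rat); rewrite [LHS]intrM [RHS]intrM -tE !rmorphXn /= numqE.
    rewrite -[d%:Z%:~R]/(d%:R : rat); ring.
  have : (denq t ^+ 2 %| d%:Z)%Z.
    have c2 : coprimez (denq t ^+ 2) (numq t ^+ 2).
      by apply/coprimezXl/coprimezXr; rewrite coprimez_sym.
    by rewrite -(Gauss_dvdzl _ c2) e dvdz_mull.
  move: cop den0 e; rewrite numqE; case: (denq t) => // q _ _ _ hq.
  have -> : q = 1%N by apply: sqf; move: hq; rewrite dvdzE abszX.
  by rewrite mulr1.
exists u, v; split.
- by rewrite -uE [2 * r]mulrC mulfK.
- by rewrite -vE [2 * s]mulrC mulfK.
- have -> : u ^+ 2 + d%:Z * v ^+ 2 = n * 4; last exact: dvdz_mull.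
  apply: (@intr_inj rat); rewrite [LHS]intrD [(d%:Z * _)%:~R]intrM [RHS]intrM !rmorphXn /= -uE -vE -nE.
  rewrite -[d%:Z%:~R]/(d%:R : rat); ring.
Qed.

Lemma parity_split (u : int) : exists a i : int, u = 2 * a + i /\ (i = 0 \/ i = 1).
Proof.
exists (u %/ 2)%Z, (u %% 2)%Z; split; first by rewrite {1}(divz_eq u 2) mulrC.
by have := modz_ge0 u (isT : 2 != 0 :> int); have := ltz_pmod u (isT : 0 < 2 :> int);
  move: (u %% 2)%Z => i; lia.
Qed.

(** The generator will be [w = (T + c de) / 2] with [de ^ 2 = - d]. An odd prime
    divisor of [d] ramifies, and so does [2] if [d] is not [3] modulo [4]. The
    choice of [T] makes the minimal polynomial of [w] Eisenstein: if
    [d = 3] modulo [4] then [c = 1] and [T = p]; if [d = 1] then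
    [w = 1 + de]; otherwise [w = de]. *)
Lemma integral_basis_data (d : nat) : (0 < d)%N ->
  (forall q : nat, ((q ^ 2)%N %| d)%N -> q = 1%N) ->
  exists (p : nat) (T M c : int),
  [/\ prime p, (p%:Z %| T)%Z, (p%:Z %| M)%Z & ~~ ((p ^ 2)%N%:Z %| M)%Z] /\
  [/\ 4 * M = T ^+ 2 + c ^+ 2 * d%:Z, c = 1 \/ c = 2 &
   forall u v : int, (4 %| u ^+ 2 + d%:Z * v ^+ 2)%Z -> exists x y : int, u = 2 * x + T * y /\ v = c * y].
Proof.
move=> d0 sqf.
have psq (p : nat) : prime p -> ~~ (p ^ 2 %| d)%N.
  by move=> pp; apply/negP => /sqf e; move: pp; rewrite e.
have split4 (u v e : int) (i j : int) a b k : d%:Z = 4 * e + k -> u = 2 * a + i -> v = 2 * b + j ->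
    (i = 0 \/ i = 1) -> (j = 0 \/ j = 1) -> (4 %| u ^+ 2 + d%:Z * v ^+ 2)%Z ->
    exists n : int, 4 * n = i + k * j.
  move=> -> -> -> hi hj /dvdzP[n nE].
  exists (n - (a ^+ 2 + a * i) - e * (2 * b + j) ^+ 2 - k * (b ^+ 2 + b * j)).
  have i2 : i ^+ 2 = i by case: hi => ->.
  have j2 : j ^+ 2 = j by case: hj => ->.
  rewrite !mulrBr [4 * n]mulrC -nE -[in RHS]i2 -[in RHS]j2; ring.
have [d3|d3] := eqVneq (d %% 4)%N 3.
  have d1 : (1 < d)%N by case: (d) d3 => [|[]].
  have pp := pdiv_prime d1; pose p := pdiv d; rewrite -/p in pp.
  have pd : (p %| d)%N := pdiv_dvd d.
  have po : odd p.
    have : odd d by rewrite (divn_eq d 4) d3 oddD oddM andbF.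
    by have /dvdnP[e ->] := pd; rewrite oddM => /andP[].
  have dE : d%:Z = 4 * (d %/ 4)%N%:Z + 3 by rewrite {1}(divn_eq d 4) d3 PoszD PoszM mulrC.
  have pE : p%:Z = 2 * p./2%:Z + 1.
    by rewrite -[p in LHS]odd_double_half po -mul2n add1n -addn1 PoszD PoszM.
  pose M := p./2%:Z ^+ 2 + p./2%:Z + (d %/ 4)%N%:Z + 1.
  have ME : 4 * M = p%:Z ^+ 2 + d%:Z by rewrite dE pE /M; ring.
  exists p, p%:Z, M, 1; split; split=> //.
  - rewrite -(@Gauss_dvdzr _ 4); last first.
      have : coprime p (2 ^ 2) by rewrite coprimeXr // coprimen2.
      by [].
    by rewrite ME rpredD ?dvdz_exp //.
  - apply: contra (psq _ pp) => h; change ((p ^ 2)%N%:Z %| d%:Z)%Z.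
    have -> : d%:Z = 4 * M - p%:Z ^+ 2 by rewrite ME; ring.
    by rewrite PoszX in h *; rewrite rpredB // dvdz_mull.
  - by rewrite ME expr1n mul1r.
  - by left.
  move=> u v uv; have [a [i [uE hi]]] := parity_split u; have [b [j [vE hj]]] := parity_split v.
  have [n nE] := split4 _ _ _ _ _ _ _ _ dE uE vE hi hj uv.
  have ij : i = j by move: nE hi hj; clear; lia.
  exists (a - b - p./2%:Z * v), v; split; last by rewrite mul1r.
  by rewrite pE uE vE ij; ring.
have [k dE hk] : exists2 k : int, d%:Z = 4 * (d %/ 4)%N%:Z + k & k = 1 \/ k = 2.
  exists (d %% 4)%N%:Z; first by rewrite {1}(divn_eq d 4) PoszD PoszM mulrC.
  have : (d %% 4 != 0)%N by apply/negP => d4; have := sqf 2%N d4.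
  by move: d3 (ltn_pmod d (isT : 0 < 4)%N); case: (d %% 4)%N => [|[|[|[|]]]] //= _ _ _; [left|right].
have even (u v : int) : (4 %| u ^+ 2 + d%:Z * v ^+ 2)%Z -> exists a b : int, u = 2 * a /\ v = 2 * b.
  move=> uv; have [a [i [uE hi]]] := parity_split u; have [b [j [vE hj]]] := parity_split v.
  have [n nE] := split4 _ _ _ _ _ _ _ _ dE uE vE hi hj uv.
  have [i0 j0] : i = 0 /\ j = 0.
    by move: nE; case: hi hj hk => -> [] -> [] ->; lia.
  by exists a, b; rewrite uE vE i0 j0 !addr0.
have [d1|d1] := eqVneq d 1%N.
  exists 2%N, 2, 2, 2; split; split=> //; first by rewrite d1.
    by right.
  by move=> u v /even[a [b [-> ->]]]; exists (a - b), b; split=> //; ring.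
have d2 : (1 < d)%N by rewrite ltn_neqAle eq_sym d1.
exists (pdiv d), 0, d%:Z, 2; split; split=> //.
- exact: pdiv_prime.
- exact: pdiv_dvd.
- exact: psq (pdiv_prime d2).
- by right.
by move=> u v /even[a [b [-> ->]]]; exists a, b; split=> //; ring.
Qed.

(** A positive [D] would make every element real under the embedding that sends
    [de] to the square root of [D]. *)
Lemma ring_of_integers_basis (K : fieldExtType rat) : imaginary_quadratic K ->
  exists (p : nat) (T M : int) (w : K) (iota : {rmorphism K -> algC}),
  [/\ prime p, (p%:Z %| T)%Z, (p%:Z %| M)%Z & ~~ ((p ^ 2)%N%:Z %| M)%Z] /\
  [/\ 0 < Disc T M,
   forall x : K, integralOver (intr : int -> K) x <-> exists a b : int, x = a%:~R + b%:~R * w &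
   forall a b : int, `|iota (a%:~R + b%:~R * w)| ^+ 2 = (nrm T M (a, b))%:~R].
Proof.
move=> [dimK complex]; have [de [D [ide deE D0 sqf]]] := squarefree_root_exists dimK.
have Dneg : D < 0.
  rewrite lt_neqAle D0 leNgt /=; apply/negP => Dpos.
  have zE : sqrtC D%:~R ^+ 2 = D%:~R :> algC by rewrite sqrtCK.
  have [iota iE] := quadratic_embedding dimK ide deE zE.
  have [x] := complex iota; have [r [s ->]] := quadratic_basis dimK ide x.
  have rr (q : rat) : (ratr q : algC) \is Num.real by rewrite Creal_Crat // Crat_rat.
  have zr : (sqrtC D%:~R : algC) \is Num.real by rewrite ger0_real // sqrtC_ge0 ler0z ltW.
  by rewrite iE; apply/negP/negPn; rewrite rpredD // rpredM.
have [d dE] : exists d : nat, D = - d%:Z by exists `|D|%N; rewrite ltz0_abs ?opprK.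
have d0 : (0 < d)%N by rewrite dE oppr_lt0 in Dneg.
have {}sqf q : ((q ^ 2)%N %| d)%N -> q = 1%N.
  by move=> h; apply: sqf; rewrite dE rpredN.
have zE := imaginary_sqr d; rewrite -dE in zE.
have [iota iE] := quadratic_embedding dimK ide deE zE.
have [p [T [M [c [[pp pT pM pM2] [MR c12 half]]]]]] := integral_basis_data d0 sqf.
pose w : K := (T%:~R / 2)%:A + (c%:~R / 2) *: de.
have intK (n : int) : n%:~R = (n%:~R)%:A :> K.
  by rewrite -[RHS]/(in_alg K _) rmorph_int.
have wE (a b : int) : a%:~R + b%:~R * w =
    (a%:~R + b%:~R * (T%:~R / 2))%:A + (b%:~R * (c%:~R / 2)) *: de.
  by rewrite !intK mulr_algl scalerDr !scalerA addrA -scalerDl.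
exists p, T, M, w, iota; split=> //; split.
- by rewrite /Disc MR [T ^+ 2 + _]addrC addrK mulr_gt0 //; case: c12 => ->.
- move=> x; split=> [xint|[a [b ->]]].
    have [r [s xE]] := quadratic_basis dimK ide x.
    rewrite xE in xint *.
    have [u [v [-> -> uv]]] := integral_half_integers sqf iE xint.
    have [a [b [-> ->]]] := half u v uv; exists a, b.
    rewrite wE; congr (_%:A + _ *: _).
      by rewrite [(2 * a + T * b)%:~R]intrD [(2 * a)%:~R]intrM [(T * b)%:~R]intrM; field.
    by rewrite [(c * b)%:~R]intrM mulrAC mulrC.
  have wint : integralOver (intr : int -> K) w.
    exists ('X^2 + (M%:P - T *: 'X)).
      rewrite monicE lead_coefDl ?lead_coefXn // size_polyXn.
      rewrite (leq_ltn_trans (size_polyD _ _)) // gtn_max size_polyN.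
      by rewrite (leq_ltn_trans (size_polyC_leq1 _)) // (leq_ltn_trans (size_scale_leq _ _)) ?size_polyX.
    have two : 2 != 0 :> K by rewrite -[2]/(2%:~R) intK scaler_eq0 oner_eq0 orbF.
    have w2 : 2 * w = T%:~R + c%:~R * de.
      rewrite /w (intK T) (intK c) -[2]/(2%:~R) (intK 2) !mulr_algl scalerDr !scalerA.
      by rewrite ![2%:~R * (_ / _)]mulrC !divfK.
    rewrite rootE rmorphD rmorphB /= map_polyXn map_polyC map_polyZ map_polyX !hornerE.
    have four : 4 != 0 :> K by rewrite (_ : 4 = 2 * 2) ?mulf_neq0 //; ring.
    apply/eqP; suff e : w ^+ 2 + M%:~R - T%:~R * w = 0 by exact: e.
    apply: (mulfI four); rewrite mulr0.
    have gen (L : comNzRingType) (y m t u : L) : 4 * m = t ^+ 2 + u -> (2 * y - t) ^+ 2 = - u ->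
        4 * (y ^+ 2 + m - t * y) = 0.
      move=> mE yE; have -> : 4 * (y ^+ 2 + m - t * y) = (2 * y - t) ^+ 2 - t ^+ 2 + 4 * m by ring.
      by rewrite mE yE; ring.
    apply: (gen _ _ _ _ (c ^+ 2 * d%:Z)%:~R).
      by rewrite -rmorphXn -intrD -MR intrM.
    by rewrite w2 addrAC subrr add0r exprMn deE dE [(- d%:Z)%:~R]rmorphN mulrN
      [(c ^+ 2 * _)%:~R]intrM rmorphXn.
  apply: integral_add; first exact: integral_id.
  by apply: integral_mul => //; exact: integral_id.
- move=> a b; rewrite wE iE imaginary_norm -[RHS](ratr_int algC); congr ratr.
  have MQ : 4 * M%:~R = T%:~R ^+ 2 + c%:~R ^+ 2 * d%:R :> rat.
    have := congr1 (intr : int -> rat) MR.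
    by rewrite [LHS]intrM [RHS]intrD [(c ^+ 2 * _)%:~R]intrM !rmorphXn.
  have ME : M%:~R = (T%:~R ^+ 2 + c%:~R ^+ 2 * d%:R) / 4 :> rat by rewrite -MQ mulrC mulKf.
  by rewrite /nrm /= !intrD !intrM ME; field.
Qed.

(** * Optimal sets have a minimal norm product *)

Section Interpolation.
Variables (K : fieldType) (m : nat) (X : 'I_m -> K).
Hypothesis X_inj : injective X.

Definition lagrange_poly (i : 'I_m) : {poly K} :=
  (\prod_(j | j != i) (X i - X j))^-1 *: \prod_(j | j != i) ('X - (X j)%:P).

Lemma size_lagrange_poly i : (size (lagrange_poly i) <= m)%N.
Proof.
apply: (leq_trans (size_scale_leq _ _)); rewrite -big_filter size_prod_XsubC size_filter.
have := count_predC (pred1 i) (index_enum 'I_m).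
rewrite count_uniq_mem ?index_enum_uniq // mem_index_enum add1n => e.
have -> : count (fun j => j != i) (index_enum 'I_m) = count (predC (pred1 i)) (index_enum 'I_m) by [].
rewrite e -[leqRHS]size_enum_ord uniq_leq_size ?index_enum_uniq // => j _.
by rewrite mem_enum.
Qed.

Lemma lagrange_polyE i j : (lagrange_poly i).[X j] = (j == i)%:R.
Proof.
rewrite hornerZ horner_prod; have [->|ji] := eqVneq j i.
  have -> : \prod_(k | k != i) ('X - (X k)%:P).[X i] = \prod_(k | k != i) (X i - X k).
    by apply: eq_bigr => k _; rewrite !hornerE.
  rewrite mulVf //; apply/prodf_neq0 => k ki.
  by rewrite subr_eq0 (inj_eq X_inj) eq_sym.
by rewrite [X in _ * X](bigD1 j) //= hornerXsubC subrr mul0r mulr0.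
Qed.

Lemma lagrange_interpolation (p : {poly K}) : (size p <= m)%N ->
  p = \sum_i p.[X i] *: lagrange_poly i.
Proof.
move=> pm; apply/eqP; rewrite -subr_eq0; apply/eqP.
apply: (@roots_geq_poly_eq0 _ _ [seq X i | i <- enum 'I_m]).
- apply/allP => _ /mapP[j _ ->]; rewrite rootE hornerD hornerN horner_sum (bigD1 j) //=.
  rewrite hornerZ lagrange_polyE eqxx mulr1 big1 ?addr0 ?subrr // => i ij.
  by rewrite hornerZ lagrange_polyE eq_sym (negPf ij) mulr0.
- by rewrite map_inj_uniq ?enum_uniq.
- rewrite size_map size_enum_ord (leq_trans (size_polyD _ _)) // geq_max pm size_polyN.
  apply: (leq_trans (size_sum _ _ _)); apply/bigmax_leqP => i _.
  by rewrite (leq_trans (size_scale_leq _ _)) ?size_lagrange_poly.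
Qed.

(** Interpolation of the monomials at the points [X], evaluated at [Y], is an
    identity between the Vandermonde matrices. *)
Lemma det_Vandermonde_interpolation (Y : 'I_m -> K) :
  \det (Vandermonde m (\row_j Y j)) =
  \det (Vandermonde m (\row_j X j)) * \det (\matrix_(i, j) (lagrange_poly i).[Y j]).
Proof.
rewrite -det_mulmx; congr (\det _); apply/matrixP => k j; rewrite !mxE.
have km : (size ('X^k : {poly K}) <= m)%N by rewrite size_polyXn.
have := congr1 (horner^~ (Y j)) (lagrange_interpolation km).
rewrite /= hornerXn horner_sum => ->; apply: eq_bigr => i _.
by rewrite hornerZ hornerXn !mxE.
Qed.
End Interpolation.

Lemma prod_off_diagonal (C : comNzRingType) (m : nat) (f : 'I_m -> 'I_m -> C) :
  (forall i j, f i j = f j i) ->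
  \prod_i \prod_(j | j != i) f i j = (\prod_(i < m) \prod_(j < m | (i < j)%N) f i j) ^+ 2.
Proof.
move=> fC; rewrite expr2 [X in _ = _ * X](exchange_big_dep xpredT) //= -big_split /=.
apply: eq_bigr => i _; rewrite (bigID (fun j : 'I_m => (i < j)%N)) /=; congr (_ * _).
  by apply: eq_bigl => j; rewrite -val_eqE; case: ltngtP.
by apply: eq_big => [j|j _]; [rewrite -val_eqE; case: ltngtP|exact: fC].
Qed.

Lemma integral_det (K : fieldType) (m : nat) (A : 'M[K]_m) :
  (forall i j, integralOver (intr : int -> K) (A i j)) -> integralOver (intr : int -> K) (\det A).
Proof.
move=> hA; apply: (big_ind (integralOver (intr : int -> K))).
- exact: integral0.
- exact: integral_add.
move=> s _; apply: integral_mul.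
  case: (perm.odd_perm s); rewrite ?expr1 ?expr0; last exact: integral1.
  exact/integral_opp/integral1.
apply: (big_ind (integralOver (intr : int -> K))) => //; first exact: integral1.
exact: integral_mul.
Qed.

Section OptimalSets.
Variables (K : fieldExtType rat) (T M : int) (w : K) (iota : {rmorphism K -> algC}).
Hypothesis D0 : 0 < Disc T M.
Hypothesis ringK : forall x : K,
  integralOver (intr : int -> K) x <-> exists a b : int, x = a%:~R + b%:~R * w.
Hypothesis normK : forall a b : int, `|iota (a%:~R + b%:~R * w)| ^+ 2 = (nrm T M (a, b))%:~R.

Definition lattice_elt (z : int * int) : K := z.1%:~R + z.2%:~R * w.

Lemma lattice_eltB x y : lattice_elt (x - y) = lattice_elt x - lattice_elt y.
Proof. by rewrite /lattice_elt /= !rmorphB mulrBl /= opprD addrACA. Qed.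

Lemma lattice_elt_norm z : `|iota (lattice_elt z)| ^+ 2 = `|nrm T M z|%N%:R.
Proof.
rewrite normK -surjective_pairing; have [->|z0] := eqVneq z 0.
  by rewrite /nrm /= !expr0n !mulr0 !addr0.
by rewrite -[in LHS](gtz0_abs (nrm_gt0 D0 z0)).
Qed.

Lemma lattice_elt_inj : injective lattice_elt.
Proof.
move=> x y e; apply/eqP; rewrite -subr_eq0; apply/contraT => /(nrm_gt0 D0) h.
have := lattice_elt_norm (x - y); rewrite lattice_eltB e subrr rmorph0 normr0 expr0n /=.
by move/eqP; rewrite eq_sym pnatr_eq0 absz_eq0 gt_eqF.
Qed.

Definition vandermonde_det (m : nat) (s : seq (int * int)) : K :=
  \det (Vandermonde m (\row_(j < m) lattice_elt (nth 0 s j))).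

Lemma norm_product_det (s : seq (int * int)) : uniq s ->
  (norm_product T M s)%:R = (`|iota (vandermonde_det (size s) s)| ^+ 2) ^+ 2 :> algC.
Proof.
move=> us; rewrite /vandermonde_det det_Vandermonde [iota _]rmorph_prod normr_prod -prodrXl.
rewrite (eq_bigr (fun i : 'I_(size s) => \prod_(j < size s | (i < j)%N)
   (`|nrm T M (nth 0 s i - nth 0 s j)%R|%N%:R : algC))); last first.
  move=> i _; rewrite rmorph_prod normr_prod -prodrXl; apply: eq_bigr => j _.
  rewrite !mxE -lattice_eltB lattice_elt_norm; congr (`|_|%N%:R).
  by rewrite -[in RHS]opprB /nrm /=; ring.
rewrite -prod_off_diagonal; last first.
  move=> i j; congr (`|_|%N%:R).
  by rewrite -[in RHS]opprB /nrm /=; ring.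
have -> : norm_product T M s = (\prod_(i < size s) \prod_(j < size s | j != i)
    `|nrm T M (nth 0 s i - nth 0 s j)%R|)%N.
  rewrite /norm_product [LHS](big_nth 0) big_mkord; apply: eq_bigr => i _.
  by rewrite [LHS](big_nth 0) big_mkord; apply: eq_bigl => j; rewrite nth_uniq.
by rewrite natr_prod; apply: eq_bigr => i _; rewrite natr_prod.
Qed.

(** The Lagrange polynomials of [S] take the values [0] and [1] on [S], so they
    map the ring of integers to itself. By [det_Vandermonde_interpolation] the
    Vandermonde determinant of [S] divides that of every other set of the same
    size, and the norm product is the square of the norm of this
    determinant. *)
Lemma optimal_norm_product (n : nat) (S : {fset K}) :
  n_optimal (ring_of_integers K) n S ->
  exists s : seq (int * int), [/\ uniq s, size s = n.+1 &
    forall t, uniq t -> size t = size s -> (norm_product T M s %| norm_product T M t)%N].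
Proof.
move=> [[SO univ] cardS].
have /choice[f fP] : forall x : K, exists z : int * int, x \in S -> lattice_elt z = x.
  move=> x; have [xS|xS] := boolP (x \in S); last by exists 0.
  have /ringK[a [b ->]] : integralOver (intr : int -> K) x by apply: SO.
  by exists (a, b).
pose s := [seq f x | x <- enum_fset S].
have sS : [seq lattice_elt z | z <- s] = enum_fset S.
  by rewrite -map_comp -[RHS]map_id; apply/eq_in_map => x xS; exact: fP.
have us : uniq s by rewrite -(map_inj_uniq lattice_elt_inj) sS fset_uniq.
have ss : size s = n.+1 by rewrite size_map -cardS.
exists s; split=> // t ut st.
pose X (j : 'I_(size s)) := lattice_elt (nth 0 s j).
have X_inj : injective X.
  move=> i j /lattice_elt_inj /eqP; rewrite nth_uniq // => /eqP; exact: val_inj.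
have XS x : x \in S -> exists i, x = X i.
  move=> xS; have fs : f x \in s by apply: map_f.
  have lt : (index (f x) s < size s)%N by rewrite index_mem.
  by exists (Ordinal lt); rewrite /X /= nth_index // fP.
have latO z : integralOver (intr : int -> K) (lattice_elt z).
  by apply/ringK; exists z.1, z.2.
have entry (i j : 'I_(size s)) :
    integralOver (intr : int -> K) (lagrange_poly X i).[lattice_elt (nth 0 t j)].
  have sz : (size (lagrange_poly X i) <= n.+1)%N by rewrite -ss size_lagrange_poly.
  have [_ back] := univ _ sz; apply: back; last by exists (lattice_elt (nth 0 t j)) => //; exact: latO.
  move=> _ [x /= /XS[k ->] <-]; rewrite lagrange_polyE //.
  exact: integral_nat.
pose F := \matrix_(i < size s, j < size s) (lagrange_poly X i).[lattice_elt (nth 0 t j)].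
have /ringK[a [b ab]] : integralOver (intr : int -> K) (\det F).
  by apply: integral_det => i j; rewrite mxE.
have e : (norm_product T M t)%:R = (norm_product T M s * `|nrm T M (a, b)| ^ 2)%N%:R :> algC.
  rewrite natrM natrX -lattice_elt_norm !norm_product_det // -exprMn -exprMn -normrM -rmorphM.
  rewrite /vandermonde_det st (det_Vandermonde_interpolation X_inj (fun j => lattice_elt (nth 0 t j))).
  by rewrite ab.
move/eqP: e; rewrite eqr_nat => /eqP ->; exact: dvdn_mulr.
Qed.

End OptimalSets.

Theorem theorem1p2 (K : fieldExtType rat) (hK : imaginary_quadratic K) :
  exists N : nat, forall n : nat, (N <= n)%N ->
    ~ exists S : {fset K}, n_optimal (ring_of_integers K) n S.
Proof.
have [p [T [M [w [iota [[pp pT pM pM2] [D0 ringK normK]]]]]]] := ring_of_integers_basis hK.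
have [N hN] := no_norm_optimal D0 Rdefinitions.R pp pT pM pM2.
exists N => n Nn [S /(optimal_norm_product D0 ringK normK)[s [us ss]]].
by apply: hN => //; rewrite ss ltnW.
Qed.
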